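(* Let $d\ge1$ be an integer and $\gamma_1,\dots,\gamma_d\in(0,1)$ such that $\gamma=\frac{\gamma_1+\cdots+\gamma_d}{d}>\frac{d-1}{d}$. There is a unique multilinear operator $$\mathrm{d}: C^{\gamma_1}([0,1]^d)\times\cdots\times C^{\gamma_d}([0,1]^d)\to\operatorname{sch}^\gamma([0,1]^d),\qquad g=(g_1,\dots,g_d)\mapsto \mathrm{d}g=\mathrm{d}g_1\wedge\cdots\wedge\mathrm{d}g_d,$$ satisfying: (A) if $g=(g_1,\dots,g_d)$ is $C^\infty$, then $\mathrm{d}g=\det Dg\,d\mathcal{L}$, where $Dg$ is the Jacobian matrix of $g$; (B) if for each $i=1,\dots,d$, $(g_{p,i})_{p\ge0}$ is a sequence of $\gamma_i$-Hölder continuous functions on $[0,1]^d$ converging uniformly to $g_i$ with $(\operatorname{Lip}^{\gamma_i}(g_{p,i}))_p$ bounded, then $$\lim_{p\to\infty}\left\|\mathrm{d}g_1\wedge\cdots\wedge\mathrm{d}g_d-\mathrm{d}g_{p,1}\wedge\cdots\wedge\mathrm{d}g_{p,d}\right\|=0 .$$ Moreover, there is a constant $C$ such that for all $g=(g_1,\dots,g_d)\in C^{\gamma_1}([0,1]^d)\times\cdots\times C^{\gamma_d}([0,1]^d)$, $$\|\mathrm{d}g_1\wedge\cdots\wedge\mathrm{d}g_d\|_\gamma\le C\prod_{i=1}^d\operatorname{Lip}^{\gamma_i}(g_i).$$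
   Context: $|E|$ denotes Lebesgue measure. For integrable $u:\mathbb{R}^d\to\mathbb{R}$, $\mathbf{V}u=\sup\{\int u\operatorname{div}v: v\in C^1_c(\mathbb{R}^d;\mathbb{R}^d),\ |v(x)|\le 1\ \forall x\}$. The perimeter of a measurable set $A$ is $\|A\|=\mathbf{V}\mathbf{1}_A$; a $BV$-set is a bounded measurable set of finite perimeter. $\mathcal{BV}([0,1]^d)$ is the collection of $BV$-subsets of $[0,1]^d$. A sequence $(B_n)$ in $\mathcal{BV}([0,1]^d)$ $BV$-converges to $B$ if $|B_n\triangle B|\to0$ and $\sup_n\|B_n\|<\infty$. A charge on $[0,1]^d$ is a function $\boldsymbol{\omega}:\mathcal{BV}([0,1]^d)\to\mathbb{R}$ such that $\boldsymbol{\omega}(B_1\cup B_2)=\boldsymbol{\omega}(B_1)+\boldsymbol{\omega}(B_2)$ whenever $|B_1\cap B_2|=0$, and $\boldsymbol{\omega}(B_n)\to\boldsymbol{\omega}(B)$ whenever $(B_n)$ $BV$-converges to $B$. For $h\in L^1([0,1]^d)$, $h\,d\mathcal{L}$ is the charge $B\mapsto\int_Bh$. Strong charges: let $BV([0,1]^d)$ be the space of functions of bounded variation on $\mathbb{R}^d$ vanishing a.e. outside $[0,1]^d$, normed by $\|u\|_{BV}=\mathbf{V}u$. For $h\in L^d([0,1]^d)$ let $T_h\in BV([0,1]^d)^*$, $T_h(u)=\int hu$. A charge $\boldsymbol{\omega}$ is strong if there is $\lambda$ in the norm closure of $\{T_h:h\in L^d\}$ in $BV([0,1]^d)^*$ with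 $\boldsymbol{\omega}(B)=\lambda(\mathbf{1}_B)$ for all $B$; such $\lambda$ is unique and $\|\boldsymbol{\omega}\|$ denotes its operator norm. A dyadic cube is a set $\prod_{i=1}^d[2^{-n}k_i,2^{-n}(k_i+1)]$ with integers $n\ge0$, $0\le k_i\le 2^n-1$. For $\frac{d-1}{d}<\gamma\le1$, a charge is $\gamma$-Hölder if $\|\boldsymbol{\omega}\|_\gamma:=\sup\{|\boldsymbol{\omega}(K)|/|K|^\gamma: K\text{ dyadic cube}\}<\infty$; $\operatorname{sch}^\gamma([0,1]^d)$ is the space of $\gamma$-Hölder charges, which are automatically strong. For $f$ on $[0,1]^d$, $\operatorname{Lip}^\beta(f)=\sup_{x\ne y}|f(x)-f(y)|/|x-y|^\beta$; $C^\beta([0,1]^d)$ is the set of $f:[0,1]^d\to\mathbb{R}$ with $\operatorname{Lip}^\beta(f)<\infty$. *)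

(* Defs.v *)
From HB Require Import structures.
From mathcomp Require Import all_boot all_order all_algebra.
From mathcomp Require Import all_classical all_reals all_analysis.

Set Implicit Arguments.
Unset Strict Implicit.
Unset Printing Implicit Defensive.

Import Order.TTheory GRing.Theory Num.Theory.
Import numFieldNormedType.Exports.

Local Open Scope classical_set_scope.
Local Open Scope ring_scope.

Fact rV_display : measure_display. Proof. exact. Qed.

Section rV_measurable.
Context (R : realType) (n : nat).

Let coor (i : 'I_n) (x : 'rV[R]_n) : measurableTypeR R := x ord0 i.

Let rV_set0 : g_sigma_preimage coor set0.
Proof. exact: sigma_algebra0. Qed.

Let rV_setC A : g_sigma_preimage coor A -> g_sigma_preimage coor (~` A).
Proof. exact: sigma_algebraC. Qed.

Let rV_bigcup (F : (set 'rV[R]_n)^nat) : (forall i, g_sigma_preimage coor (F i)) ->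
  g_sigma_preimage coor (\bigcup_i (F i)).
Proof. exact: sigma_algebra_bigcup. Qed.

(* The Borel sigma-algebra of R^n, generated by the coordinates. *)
HB.instance Definition _ := @isMeasurable.Build rV_display
  'rV[R]_n (g_sigma_preimage coor) rV_set0 rV_setC rV_bigcup.

End rV_measurable.

Section rV_cons.
Context (R : realType) (n : nat).

Definition rV_cons (p : measurableTypeR R * 'rV[R]_n) : 'rV[R]_n.+1 :=
  \row_i (if unlift ord0 i is Some j then p.2 ord0 j else p.1).

Definition rV_uncons (x : 'rV[R]_n.+1) : measurableTypeR R * 'rV[R]_n :=
  (x ord0 ord0, \row_j x ord0 (lift ord0 j)).

Lemma rV_cons0 p : rV_cons p ord0 ord0 = p.1.
Proof. by rewrite mxE unlift_none. Qed.

Lemma rV_consS p j : rV_cons p ord0 (lift ord0 j) = p.2 ord0 j.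
Proof. by rewrite mxE liftK. Qed.

Lemma rV_consK : cancel rV_cons rV_uncons.
Proof.
move=> [a x]; congr pair => /=; first exact: rV_cons0.
by apply/rowP => j; rewrite mxE rV_consS.
Qed.

Lemma measurable_coor m (i : 'I_m) :
  measurable_fun [set: 'rV[R]_m] (fun x => x ord0 i : measurableTypeR R).
Proof.
move=> _ Y mY; rewrite setTI; apply: sub_sigma_algebra => /=.
rewrite -bigcup_seq/=; exists i => /=; first by rewrite mem_index_enum.
by exists Y => //; rewrite setTI.
Qed.

Lemma measurable_rV d (T : measurableType d) m (f : T -> 'rV[R]_m) :
  (forall i, measurable_fun [set: T] (fun x => f x ord0 i : measurableTypeR R)) ->
  measurable_fun [set: T] f.
Proof.
move=> mf _ A mA; rewrite setTI.
pose G := [set B | measurable (f @^-1` B)].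
suff : g_sigma_preimage (fun (i : 'I_m) (x : 'rV[R]_m) =>
         x ord0 i : measurableTypeR R) `<=` G by apply.
apply: smallest_sub.
  split; first by rewrite /G /= preimage_set0.
    move=> B GB; by rewrite /G /= setTD; exact: (measurableC GB).
  by move=> F GF; rewrite /G /= preimage_bigcup; apply: bigcupT_measurable.
move=> B; rewrite -bigcup_seq => -[/= i _ [C mC <-]].
rewrite /G /= setTI -comp_preimage -[X in measurable X]setTI; exact: mf.
Qed.

Lemma measurable_rV_cons : measurable_fun setT rV_cons.
Proof.
apply: measurable_rV => i; have [j ->|->] := unliftP ord0 i.
  have -> : (fun p => rV_cons p ord0 (lift ord0 j)) =
    (fun x : 'rV[R]_n => x ord0 j : measurableTypeR R) \o snd.
    by apply/funext => p; rewrite rV_consS.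
  exact: measurableT_comp (measurable_coor j) measurable_snd.
have -> : (fun p => rV_cons p ord0 ord0) = fst.
  by apply/funext => p; rewrite rV_cons0.
exact: measurable_fst.
Qed.

Lemma measurable_rV_uncons : measurable_fun setT rV_uncons.
Proof.
apply/measurable_fun_pairP; split; first exact: measurable_coor.
apply: measurable_rV => i.
have -> : (fun x => (snd \o rV_uncons) x ord0 i : measurableTypeR R) =
          (fun x => x ord0 (lift ord0 i)) by apply/funext => x /=; rewrite mxE.
exact: measurable_coor.
Qed.

End rV_cons.

Section borel_lebesgue_step.
Context (R : realType) (n : nat).
Variable mu : {sigma_finite_measure set 'rV[R]_n -> \bar R}.

Definition borel_lebesgueS : set 'rV[R]_n.+1 -> \bar R :=
  pushforward (lebesgue_measure \x mu)%E (@rV_cons R n).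

Let mS0 : borel_lebesgueS set0 = 0%E.
Proof. by rewrite /borel_lebesgueS /pushforward preimage_set0 measure0. Qed.

Let mS_ge0 A : (0 <= borel_lebesgueS A)%E.
Proof. by rewrite /borel_lebesgueS /pushforward; apply: measure_ge0. Qed.

Let mS_sigma_additive : semi_sigma_additive borel_lebesgueS.
Proof.
move=> F mF tF mUF; rewrite /borel_lebesgueS /pushforward preimage_bigcup.
apply: measure_semi_sigma_additive.
- by move=> k; rewrite -[X in measurable X]setTI; exact: measurable_rV_cons.
- apply/trivIsetP => i j _ _ ij; rewrite -preimage_setI.
  by move/trivIsetP : tF => /(_ _ _ _ _ ij) ->//; rewrite preimage_set0.
- by rewrite -preimage_bigcup -[X in measurable X]setTI;
    exact: measurable_rV_cons.
Qed.

HB.instance Definition _ := isMeasure.Build _ _ _ borel_lebesgueS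
  mS0 mS_ge0 mS_sigma_additive.

Let mS_sigma_finite : sigma_finite setT borel_lebesgueS.
Proof.
have /sigma_finiteP[F [TF ndF Foo]] := sigma_finiteT (@lebesgue_measure R).
have /sigma_finiteP[G [TG ndG Goo]] := sigma_finiteT mu.
have mFG k : measurable (F k `*` G k).
  by have [? ?] := Foo k; have [? ?] := Goo k; exact: measurableX.
exists (fun k => @rV_uncons R n @^-1` (F k `*` G k)).
  rewrite predeqE => x; split => // _.
  have : [set: measurableTypeR R] (rV_uncons x).1 by [].
  have : [set: 'rV[R]_n] (rV_uncons x).2 by [].
  rewrite TF TG => -[j _ Gj] [k _ Fk]; exists (maxn j k) => //; split.
    by move: Fk; exact/subsetPset/ndF/leq_maxr.
  by move: Gj; exact/subsetPset/ndG/leq_maxl.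
move=> k; have [? ?] := Foo k; have [? ?] := Goo k; split.
  by rewrite -[X in measurable X]setTI; exact: measurable_rV_uncons.
rewrite /borel_lebesgueS /pushforward -comp_preimage.
have -> : @rV_uncons R n \o @rV_cons R n = id.
  by apply/funext => p /=; rewrite rV_consK.
rewrite preimage_id product_measure1E// lte_mul_pinfty// ge0_fin_numE//.
Qed.

HB.instance Definition _ := Measure_isSigmaFinite.Build _ _ _ borel_lebesgueS
  mS_sigma_finite.

End borel_lebesgue_step.

(* The n-fold product of the one-dimensional Lebesgue measure; R^0 is a point
   of mass 1. *)
Fixpoint borel_lebesgue (R : realType) (n : nat) :
    {sigma_finite_measure set 'rV[R]_n -> \bar R} :=
  match n with
  | 0 => dirac (0 : 'rV[R]_0)
  | m.+1 => borel_lebesgueS (borel_lebesgue R m)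
  end.

(* R^d with its sigma-algebra of Lebesgue-measurable sets, and the Lebesgue
   measure on it: the completion of [borel_lebesgue]. *)
Definition lebesgueT (R : realType) (d : nat) : Type :=
  caratheodory_type (mu_ext (borel_lebesgue R d)).
HB.instance Definition _ (R : realType) (d : nat) :=
  Measurable.on (lebesgueT R d).

Definition leb (R : realType) (d : nat) : set (lebesgueT R d) -> \bar R :=
  @completed_measure_extension _ 'rV[R]_d R (borel_lebesgue R d).
HB.instance Definition _ (R : realType) (d : nat) := Measure.on (@leb R d).
HB.instance Definition _ (R : realType) (d : nat) :=
  Measure_isSigmaFinite.Build _ _ _ (@leb R d)
    (completed_measure_extension_sigma_finite
       (sigma_finiteT (borel_lebesgue R d))).

Section setting.
Context {R : realType} {d : nat}.
Local Notation E := 'rV[R]_d.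
Local Notation mu := (@leb R d).

(* The library norm on row vectors is the sup norm. *)
Definition enorm (x : E) : R := Num.sqrt (\sum_i x ord0 i ^+ 2).

Definition unit_cube : set E := [set x | forall i, 0 <= x ord0 i <= 1].

Fixpoint is_Ck {V W : normedModType R} (k : nat) (f : V -> W) : Prop :=
  match k with
  | 0 => continuous f
  | k'.+1 => (forall x, differentiable f x) /\
             (forall v, is_Ck k' (fun x => 'D_v f x))
  end.

Definition is_smooth {V W : normedModType R} (f : V -> W) : Prop :=
  forall k, is_Ck k f.

Definition test_field (v : E -> E) : Prop :=
  [/\ is_Ck 1 v, compact (closure [set x | v x != 0]) &
      forall x, enorm (v x) <= 1].

(* The library's Jacobian acts on row vectors, hence is the transpose of the
   usual one; this affects neither its trace nor its determinant. *)
Definition divergence (v : E -> E) (x : E) : R := \tr ('J v x).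

Definition rV_variation (u : E -> R) : \bar R :=
  ereal_sup [set (\int[mu]_x (u x * divergence v x))%:E | v in test_field].

Definition perimeter (A : set E) : \bar R := rV_variation \1_A.

Definition bvset (A : set E) : Prop :=
  [/\ bounded_set A, measurable (A : set (lebesgueT R d)) &
      (perimeter A < +oo)%E].

Definition bvset_cube (A : set E) : Prop := bvset A /\ A `<=` unit_cube.

Definition bv_converges (B_ : (set E)^nat) (B : set E) : Prop :=
  (fun n => mu ((B_ n `\` B) `|` (B `\` B_ n))) @ \oo --> 0%E /\
  (ereal_sup (range (fun n => perimeter (B_ n))) < +oo)%E.

(* A function on BV([0,1]^d) is represented by a function on all sets, whose
   values off [bvset_cube] are irrelevant: see [eq_charge]. *)
Definition is_charge (w : set E -> R) : Prop :=
  (forall B1 B2, bvset_cube B1 -> bvset_cube B2 -> mu (B1 `&` B2) = 0%E ->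
     w (B1 `|` B2) = w B1 + w B2) /\
  (forall B_ B, (forall n, bvset_cube (B_ n)) -> bvset_cube B ->
     bv_converges B_ B -> w (B_ n) @[n --> \oo] --> w B).

Definition eq_charge (w1 w2 : set E -> R) : Prop :=
  forall B, bvset_cube B -> w1 B = w2 B.

Definition density_charge (h : E -> R) (B : set E) : R := \int[mu]_(x in B) h x.

Definition bvfun (u : E -> R) : Prop :=
  [/\ mu.-integrable setT (EFin \o u), (rV_variation u < +oo)%E &
      {ae mu, forall x, ~ unit_cube x -> u x = 0}].

Definition dual_norm (l : (E -> R) -> R) : \bar R :=
  ereal_sup [set (`|l u|)%:E | u in [set u | bvfun u /\ (rV_variation u <= 1)%E]].

(* Functionals are defined on functions rather than on classes modulo null
   sets: finiteness of the norm makes them vanish on null functions. *)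
Definition bv_dual (l : (E -> R) -> R) : Prop :=
  (forall a u v, bvfun u -> bvfun v ->
     l (fun x => a * u x + v x) = a * l u + l v) /\
  (dual_norm l < +oo)%E.

Definition Ld_cube (h : E -> R) : Prop :=
  measurable_fun (unit_cube : set (lebesgueT R d)) (h : lebesgueT R d -> R) /\
  (\int[mu]_(x in unit_cube) (`|h x| ^+ d)%:E < +oo)%E.

Definition Ld_functional (h u : E -> R) : R :=
  \int[mu]_(x in unit_cube) (h x * u x).

Definition represents (l : (E -> R) -> R) (w : set E -> R) : Prop :=
  [/\ bv_dual l,
      forall e : R, 0 < e -> exists2 h, Ld_cube h &
        (dual_norm (fun u => (l u - Ld_functional h u)%R) < e%:E)%E &
      forall B, bvset_cube B -> w B = l \1_B].

(* The representing functional is unique on BV([0,1]^d), so for a strong charge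
   this is the infimum of a singleton; it is +oo for other charges. *)
Definition strong_norm (w : set E -> R) : \bar R :=
  ereal_inf [set dual_norm l | l in [set l | represents l w]].

Definition dyadic_cube (K : set E) : Prop :=
  exists (n : nat) (k : 'I_d -> 'I_(2 ^ n)),
    K = [set x : E | forall i,
      (k i)%:R / 2 ^+ n <= x ord0 i <= ((k i).+1)%:R / 2 ^+ n].

Definition charge_holder_norm (gam : R) (w : set E -> R) : \bar R :=
  ereal_sup [set (`|w K| / (fine (mu K)) `^ gam)%:E | K in dyadic_cube].

Definition sch (gam : R) (w : set E -> R) : Prop :=
  is_charge w /\ (charge_holder_norm gam w < +oo)%E.

Definition Lip (beta : R) (f : unit_cube -> R) : \bar R :=
  ereal_sup [set r | exists x y : unit_cube, x != y /\
    r = (`|f x - f y| / enorm (val x - val y) `^ beta)%:E].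

Definition holder (beta : R) (f : unit_cube -> R) : Prop :=
  (Lip beta f < +oo)%E.

Definition holder_tuple (gam : 'I_d -> R) (g : 'I_d -> unit_cube -> R) : Prop :=
  forall i, holder (gam i) (g i).

Definition update (g : 'I_d -> unit_cube -> R) (i : 'I_d) (f : unit_cube -> R) :
    'I_d -> unit_cube -> R :=
  fun j => if j == i then f else g j.

Definition multilinear_on (gam : 'I_d -> R)
    (D : ('I_d -> unit_cube -> R) -> set E -> R) : Prop :=
  forall g i (a : R) (f h : unit_cube -> R),
    holder_tuple gam g -> holder (gam i) f -> holder (gam i) h ->
    eq_charge (D (update g i (fun x => a * f x + h x)))
              (fun B => a * D (update g i f) B + D (update g i h) B).

(* A tuple on the cube is smooth if it is the restriction of a smooth map on
   R^d. *)
Definition extends_jacobian (D : ('I_d -> unit_cube -> R) -> set E -> R) : Prop :=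
  forall G : E -> E, is_smooth G ->
    eq_charge (D (fun i x => G (val x) ord0 i))
              (density_charge (fun x => \det ('J G x))).

Definition weakly_continuous (gam : 'I_d -> R)
    (D : ('I_d -> unit_cube -> R) -> set E -> R) : Prop :=
  forall (g_ : nat -> 'I_d -> unit_cube -> R) (g : 'I_d -> unit_cube -> R),
    (forall p, holder_tuple gam (g_ p)) -> holder_tuple gam g ->
    (forall i, {uniform, (fun p => g_ p i) @ \oo --> g i}) ->
    (forall i, (ereal_sup (range (fun p => Lip (gam i) (g_ p i))) < +oo)%E) ->
    strong_norm (fun B => D g B - D (g_ p) B) @[p --> \oo] --> 0%E.

Definition exterior_product (gam : 'I_d -> R)
    (D : ('I_d -> unit_cube -> R) -> set E -> R) : Prop :=
  [/\ forall g, holder_tuple gam g -> sch ((\sum_i gam i) / d%:R) (D g),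
      multilinear_on gam D,
      extends_jacobian D &
      weakly_continuous gam D].

End setting.

(* Main.v *)
(* Extend each g_i to R^d by clamping, and let f_(n,i) be its tensor Bernstein
   polynomial on [-1,2]^d of degree 4^n.  Near the cube, at the scale s = 2^-n,
   f_(n,i) is within O(s^gamma_i) of g_i and its gradient is O(s^(gamma_i - 1)).
   The difference of two Jacobian determinants is a sum of d determinants each
   having a row D(f_i - h_i), and by Piola's identity such a determinant is the
   divergence of (f_i - h_i) times a cofactor row, so its integral against u is
   at most sup |f_i - h_i| times the product of the other gradient bounds times
   Vu.  Going from n to n + 1 therefore costs O(2^(n (d - 1 - sum gamma))) Vu, a
   convergent geometric series since gamma > (d-1)/d: the functionals
   u |-> int u det Df_n converge in BV([0,1]^d)^*, and dg is the limit.

   On a dyadic cube K of side 2^-m, summing the same series from n = m with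
   u = 1_K, of variation 2d 2^(-m (d-1)), gives |dg(K)| = O(|K|^gamma).  For the
   convergence (B), fix n so that the tails are small uniformly in p, and
   compare the determinants of the n-th approximants.  If g is smooth, the
   gradients of f_(n,i) are bounded and converge pointwise inside the cube, which
   gives (A).  Finally the f_(n,i) are smooth, uniformly gamma_i-Holder and
   converge uniformly to g_i, so (A) and (B) determine dg. *)

Require Import Defs.
From mathcomp Require Import all_boot all_order all_algebra.
From mathcomp Require Import all_classical all_reals all_analysis.
From mathcomp Require Import measurable_realfun fingroup perm.
From mathcomp Require Import ring lra.

Set Implicit Arguments.
Unset Strict Implicit.
Unset Printing Implicit Defensive.

Import Order.TTheory GRing.Theory Num.Theory.
Import numFieldNormedType.Exports.

Local Open Scope classical_set_scope.
Local Open Scope ring_scope.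

(** The obstacle is that [u] is merely BV: its variation is tested against compactly supported C^1
    fields of norm at most 1, while Piola's identity produces polynomial fields. These are
    multiplied by a cutoff that is 1 with zero gradient on the cube; as [u] vanishes a.e. elsewhere,
    the integral is unchanged. The price is that all field bounds must hold on a neighbourhood of
    the cube. This is why the Bernstein nodes fill [-1,2]^d: the derivative formula for the weights
    degenerates at the faces of the domain, and these are now kept at a distance. Bernstein weights
    form a probability law with variance O(1/N), and a derivative multiplies a weight by N (node -
    x), up to a factor bounded below near the cube. Hence a single scale N^(-1/2) governs values and
    gradients. The operator is linear, so every approximate wedge is already multilinear, and its
    values are polynomials, for which symmetry of derivatives, Fubini and measurability reduce to
    structural inductions. All that the estimates use about [u], apart from integrability, is
    [div_bounded]; it comes from the definition of variation for BV functions and from the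
    fundamental theorem of calculus for cubes. *)

Lemma continuous_row (R : realType) (V : normedModType R) n (F : V -> 'rV[R]_n) :
  (forall i, continuous (fun y => F y ord0 i)) -> continuous F.
Proof.
move=> cF x; apply/cvgrPdist_le => e e0; near=> y.
rewrite /Num.Def.normr/= mx_normrE (bigmax_le _ (ltW e0))//= => -[i j] _.
rewrite !mxE/= ord1; move: j; near: y; apply: filter_forall => j.
by have /cvgrPdist_le := cF j x; exact.
Unshelve. all: by end_near. Qed.

(** * Polynomial functions *)

Section polynomial_functions.
Context {R : realType} {d : nat}.
Local Notation E := 'rV[R]_d.

(** Generated by four rules, so that closure under derivatives, their symmetry, measurability,
    bounds on boxes and behaviour on slices each follow by one four-case induction. *)
Inductive polyfun : (E -> R) -> Prop :=
| polyfun_cst c : polyfun (fun=> c)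
| polyfun_coord i : polyfun (fun x => x ord0 i)
| polyfunD f g : polyfun f -> polyfun g -> polyfun (fun x => f x + g x)
| polyfunM f g : polyfun f -> polyfun g -> polyfun (fun x => f x * g x).

Lemma polyfunN f : polyfun f -> polyfun (fun x => - f x).
Proof.
move=> pf; rewrite (_ : (fun x => - f x) = (fun x => -1 * f x)).
  exact: polyfunM (polyfun_cst _) pf.
by apply/funext => x; rewrite mulN1r.
Qed.

Lemma polyfunB f g : polyfun f -> polyfun g -> polyfun (fun x => f x - g x).
Proof. by move=> pf pg; exact: polyfunD pf (polyfunN pg). Qed.

Lemma polyfun_sum I (r : seq I) (P : pred I) (F : I -> E -> R) :
  (forall i, polyfun (F i)) -> polyfun (fun x => \sum_(i <- r | P i) F i x).
Proof.
move=> pF; elim: r => [|i r IH].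
  by rewrite (_ : (fun x => _) = (fun=> 0));
    [exact: polyfun_cst|apply/funext => x; rewrite big_nil].
under eq_fun do rewrite big_cons.
by case: (P i) => //; exact: polyfunD.
Qed.

Lemma polyfun_prod I (r : seq I) (P : pred I) (F : I -> E -> R) :
  (forall i, polyfun (F i)) -> polyfun (fun x => \prod_(i <- r | P i) F i x).
Proof.
move=> pF; elim: r => [|i r IH].
  by rewrite (_ : (fun x => _) = (fun=> 1));
    [exact: polyfun_cst|apply/funext => x; rewrite big_nil].
under eq_fun do rewrite big_cons.
by case: (P i) => //; exact: polyfunM.
Qed.

Lemma polyfun_horner (p : {poly R}) f : polyfun f -> polyfun (fun x => p.[f x]).
Proof.
move=> pf; elim/poly_ind: p => [|p c IH].
  by under eq_fun do rewrite horner0; exact: polyfun_cst.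
under eq_fun do rewrite hornerMXaddC.
exact: polyfunD (polyfunM IH pf) (polyfun_cst _).
Qed.

Lemma polyfun_det (F : 'I_d -> 'I_d -> E -> R) :
  (forall i j, polyfun (F i j)) ->
  polyfun (fun x => \det (\matrix_(i, j) F i j x)).
Proof.
move=> pF; rewrite /determinant; apply: polyfun_sum => s.
apply: polyfunM; first exact: polyfun_cst.
apply: (@polyfun_prod _ _ _ (fun i x => _)) => i.
by under eq_fun do rewrite mxE; exact: pF.
Qed.

Lemma polyfun_differentiable f x : polyfun f -> differentiable f x.
Proof.
elim=> [c|i|g h _ dg _ dh|g h _ dg _ dh].
- exact: differentiable_cst.
- exact: differentiable_coord.
- exact: differentiableD.
- exact: differentiableM.
Qed.


Lemma derive_coord (v x : E) i : 'D_v (fun y : E => y ord0 i) x = v ord0 i.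
Proof.
have := derive_mx (@derivable_id _ _ x v).
by rewrite derive_id => /matrixP/(_ ord0 i); rewrite mxE => ->.
Qed.

Lemma polyfun_derivable f v x : polyfun f -> derivable f x v.
Proof. by move=> pf; apply/diff_derivable/polyfun_differentiable. Qed.

Lemma polyfun_derive f v : polyfun f -> polyfun ('D_v f).
Proof.
elim=> [c|i|g h pg Dg ph Dh|g h pg Dg ph Dh].
- rewrite (_ : 'D_v _ = fun=> 0); first exact: polyfun_cst.
  by apply/funext => x; rewrite derive_cst.
- rewrite (_ : 'D_v _ = fun=> v ord0 i); first exact: polyfun_cst.
  by apply/funext => x; rewrite derive_coord.
- rewrite (_ : 'D_v _ = fun x => 'D_v g x + 'D_v h x); first exact: polyfunD.
  by apply/funext => x; rewrite deriveD//; exact: polyfun_derivable.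
- rewrite (_ : 'D_v _ = fun x => g x * 'D_v h x + h x * 'D_v g x).
    by apply: polyfunD; exact: polyfunM.
  by apply/funext => x; rewrite deriveM//; exact: polyfun_derivable.
Qed.

(** Induction on the generation of [f]: for a product, the terms with two derivatives on one factor
    are symmetric by induction, and the two mixed terms exchange places. *)
Lemma polyfun_derive_comm f v w x : polyfun f ->
  'D_v ('D_w f) x = 'D_w ('D_v f) x.
Proof.
move=> pf; elim: pf x => [c|i|g h pg Cg ph Ch|g h pg Cg ph Ch] x.
- have e u : 'D_u (fun=> c) = fun=> 0 :> R.
    by apply/funext => y; rewrite derive_cst.
  by rewrite !e !derive_cst.
- have e u : 'D_u (fun y : E => y ord0 i) = fun=> u ord0 i.
    by apply/funext => y; rewrite derive_coord.
  by rewrite !e !derive_cst.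
- have e u : 'D_u (fun y : E => g y + h y) = 'D_u g + 'D_u h.
    by apply/funext => y; rewrite deriveD//; exact: polyfun_derivable.
  have e2 u u' : 'D_u ('D_u' g + 'D_u' h) x = 'D_u ('D_u' g) x + 'D_u ('D_u' h) x.
    by rewrite deriveD//; apply: polyfun_derivable; exact: polyfun_derive.
  by rewrite (e w) (e v) (e2 v w) (e2 w v) (Cg x) (Ch x).
- have e u y : 'D_u (fun z : E => g z * h z) y = g y * 'D_u h y + h y * 'D_u g y.
    by rewrite deriveM//; exact: polyfun_derivable.
  have e2 u u' : 'D_u ('D_u' (fun z : E => g z * h z)) x =
      (g x * 'D_u ('D_u' h) x + 'D_u' h x * 'D_u g x) +
      (h x * 'D_u ('D_u' g) x + 'D_u' g x * 'D_u h x).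
    rewrite (_ : 'D_u' (fun z : E => g z * h z) =
        (fun y => g y * 'D_u' h y) \+ (fun y => h y * 'D_u' g y)); last first.
      by apply/funext => y; rewrite e.
    have pDh := polyfun_derive u' ph; have pDg := polyfun_derive u' pg.
    rewrite deriveD; first by rewrite !deriveM//; exact: polyfun_derivable.
      by apply: polyfun_derivable; exact: (polyfunM pg pDh).
    by apply: polyfun_derivable; exact: (polyfunM ph pDg).
  rewrite (e2 v w) (e2 w v) (Cg x) (Ch x) addrACA [RHS]addrACA; congr (_ + _).
  by rewrite addrC mulrC [X in _ + X]mulrC.
Qed.

Lemma polyfun_continuous f : polyfun f -> continuous f.
Proof. by move=> pf x; exact/differentiable_continuous/polyfun_differentiable. Qed.

Lemma differentiable_row n (F : E -> 'rV[R]_n) x :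
  (forall i, differentiable (fun y => F y ord0 i) x) -> differentiable F x.
Proof.
move=> dF.
rewrite (_ : F = fun y => \sum_i (F y ord0 i) *: delta_mx ord0 i); last first.
  by apply/funext => y; rewrite -row_sum_delta.
rewrite (_ : (fun y => _) = \sum_i (fun y => (F y ord0 i) *: delta_mx ord0 i)).
  by apply: differentiable_sum => i; apply: differentiableZl.
by apply/funext => y; rewrite fct_sumE.
Qed.

Lemma derive_row n (F : E -> 'rV[R]_n) v x i :
  (forall i, differentiable (fun y => F y ord0 i) x) ->
  'D_v F x ord0 i = 'D_v (fun y => F y ord0 i) x.
Proof.
by move=> dF; rewrite derive_mx ?mxE//; exact/diff_derivable/differentiable_row.
Qed.

Lemma polyfun_Ck k (F : E -> E) :
  (forall i, polyfun (fun x => F x ord0 i)) -> is_Ck k F.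
Proof.
elim: k F => [|k IH] F pF /=.
  by apply: continuous_row => i; exact: polyfun_continuous.
split=> [x|v].
  by apply: differentiable_row => i; exact: polyfun_differentiable.
apply: IH => i; rewrite (_ : (fun x => _) = 'D_v (fun y => F y ord0 i)).
  exact: polyfun_derive.
apply/funext => x; rewrite derive_row// => j; exact: polyfun_differentiable.
Qed.

End polynomial_functions.

(** * Jacobian determinants as divergences *)

Section jacobian_determinant.
Context {R : realType} {d : nat}.
Local Notation E := 'rV[R]_d.
Implicit Types (f : E -> R) (g h : 'I_d -> E -> R).

Definition partial (k : 'I_d) f : E -> R := 'D_(delta_mx ord0 k) f.

Definition jdet g (x : E) : R := \det (\matrix_(i, j) partial j (g i) x).

(** The cofactor of the entry (i, k): the Leibniz terms with [s i = k], the factor of row [i] left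
    out. Staying with permutations of all indices avoids minors. *)
Definition jcof g (i k : 'I_d) (x : E) : R :=
  \sum_(s : 'S_d | s i == k)
     (-1) ^+ s * \prod_(j | j != i) partial (s j) (g j) x.

Lemma polyfun_partial k f : polyfun f -> polyfun (partial k f).
Proof. exact: polyfun_derive. Qed.

Lemma partialC k l f x : polyfun f ->
  partial k (partial l f) x = partial l (partial k f) x.
Proof. exact: polyfun_derive_comm. Qed.

Lemma partialB k f1 f2 x : polyfun f1 -> polyfun f2 ->
  partial k (fun y => f1 y - f2 y) x = partial k f1 x - partial k f2 x.
Proof. by move=> pf1 pf2; rewrite /partial deriveB//; exact: polyfun_derivable. Qed.

Lemma partialD k f1 f2 x : polyfun f1 -> polyfun f2 ->
  partial k (fun y => f1 y + f2 y) x = partial k f1 x + partial k f2 x.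
Proof. by move=> pf1 pf2; rewrite /partial deriveD//; exact: polyfun_derivable. Qed.

Lemma partialM k f1 f2 x : polyfun f1 -> polyfun f2 ->
  partial k (fun y => f1 y * f2 y) x =
  f1 x * partial k f2 x + f2 x * partial k f1 x.
Proof. by move=> pf1 pf2; rewrite /partial deriveM//; exact: polyfun_derivable. Qed.

Lemma partial_cst k c x : partial k (fun=> c) x = 0.
Proof. exact: derive_cst. Qed.

Lemma partialZ k f c x : polyfun f ->
  partial k (fun y => c * f y) x = c * partial k f x.
Proof.
by move=> pf; rewrite partialM ?partial_cst ?mulr0 ?addr0//; exact: polyfun_cst.
Qed.

Lemma partial_coord k i x : partial k (fun y => y ord0 i) x = (i == k)%:R.
Proof. by rewrite /partial derive_coord mxE eqxx. Qed.

Lemma partial_sum k I (r : seq I) (P : pred I) (F : I -> E -> R) x :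
  (forall i, polyfun (F i)) ->
  partial k (fun y => \sum_(i <- r | P i) F i y) x =
  \sum_(i <- r | P i) partial k (F i) x.
Proof.
move=> pF; elim: r => [|i r IH].
  rewrite big_nil (_ : (fun y => _) = fun=> 0); first exact: partial_cst.
  by apply/funext => y; rewrite big_nil.
rewrite big_cons -IH.
under [in LHS]eq_fun do rewrite big_cons.
by case: (P i) => //; rewrite partialD//; exact: polyfun_sum.
Qed.

(** Leibniz rule. The omitted factor is identified by its index rather than by its position, whence
    [uniq]. *)
Lemma partial_prod k (I : eqType) (r : seq I) (F : I -> E -> R) x :
  (forall i, polyfun (F i)) -> uniq r ->
  partial k (fun y => \prod_(i <- r) F i y) x =
  \sum_(l <- r) partial k (F l) x * \prod_(i <- r | i != l) F i x.
Proof.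
move=> pF; elim: r => [_|a r IH /= /andP[ar ur]].
  rewrite big_nil (_ : (fun y => _) = fun=> 1); first exact: partial_cst.
  by apply/funext => y; rewrite big_nil.
under [in LHS]eq_fun do rewrite big_cons.
rewrite partialM//; last exact: polyfun_prod.
rewrite IH// big_cons big_cons eqxx/= addrC mulrC; congr (_ + _).
  congr (_ * _); rewrite big_seq [RHS]big_seq_cond; apply: eq_bigl => i.
  by case: (boolP (i \in r)) => //= ir; apply/esym; apply: contraNneq ar => <-.
rewrite big_distrr/= big_seq [RHS]big_seq; apply: eq_bigr => l lr.
rewrite big_cons ifT; first by rewrite mulrCA.
by apply: contraNneq ar => ->.
Qed.

Lemma polyfun_jcof g i k : (forall j, polyfun (g j)) -> polyfun (jcof g i k).
Proof.
move=> pg; apply: polyfun_sum => s; apply: polyfunM; first exact: polyfun_cst.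
by apply: (@polyfun_prod _ _ _ _ _ (fun j => _)) => j; exact: polyfun_partial.
Qed.

Lemma polyfun_jdet g : (forall j, polyfun (g j)) -> polyfun (jdet g).
Proof.
by move=> pg; apply: (@polyfun_det _ _ (fun i j => _)) => i j;
  exact: polyfun_partial.
Qed.

Lemma jdet_expand g i x : jdet g x = \sum_k partial k (g i) x * jcof g i k x.
Proof.
rewrite /jdet /determinant (partition_big (fun s : 'S_d => s i) xpredT)//=.
apply: eq_bigr => k _; rewrite /jcof big_distrr/=; apply: eq_bigr => s /eqP si.
rewrite mulrCA; congr (_ * _); rewrite (bigD1 i)//= mxE si; congr (_ * _).
by apply: eq_bigr => j _; rewrite mxE.
Qed.

(* Composing with the transposition of [i] and [l] exchanges the two derivatives
   falling on [g l] and changes the sign, so the terms cancel in pairs. *)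
Lemma jcof_divergence_free g i x : (forall j, polyfun (g j)) ->
  \sum_k partial k (jcof g i k) x = 0.
Proof.
move=> pg.
pose A l (s : 'S_d) := partial (s i) (partial (s l) (g l)) x *
   \prod_(j | (j != i) && (j != l)) partial (s j) (g j) x.
have e k : partial k (jcof g i k) x =
    \sum_(l | l != i) \sum_(s : 'S_d | s i == k) (-1) ^+ s * A l s.
  have pp (s : 'S_d) j : polyfun (partial (s j) (g j)) by exact: polyfun_partial.
  rewrite /jcof partial_sum => [|s]; last first.
    apply: polyfunM; first exact: polyfun_cst.
    exact: (@polyfun_prod _ _ _ _ _ (fun j => _)).
  rewrite exchange_big/=; apply: eq_bigr => s /eqP sik.
  rewrite partialZ; last exact: (@polyfun_prod _ _ _ _ _ (fun j => _)).
  under [in LHS]eq_fun do rewrite -big_filter.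
  rewrite partial_prod//; last by rewrite filter_uniq// index_enum_uniq.
  rewrite -big_distrr/= big_filter; congr (_ * _); apply: eq_bigr => l li.
  rewrite /A sik; congr (_ * _); rewrite big_filter_cond; exact: eq_bigl.
under eq_bigr do rewrite e.
rewrite exchange_big/= big1// => l li.
rewrite (_ : \sum_k _ = \sum_(s : 'S_d) (-1) ^+ s * A l s); last first.
  by rewrite [RHS](partition_big (fun s : 'S_d => s i) xpredT).
set S := \sum_s _; suff : S = - S by move=> /eqP; rewrite -addr_eq0 -mulr2n mulrn_eq0/= => /eqP.
rewrite {1}/S (reindex_inj (mulgI (tperm i l)))/= -sumrN; apply: eq_bigr => s _.
rewrite odd_permM odd_tperm eq_sym li/= -mulNr; congr (_ * _).
  exact: signrN.
have ti : (tperm i l * s)%g i = s l by rewrite permM tpermL.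
have tl : (tperm i l * s)%g l = s i by rewrite permM tpermR.
rewrite /A ti tl (partialC _ _ _ (pg l)); congr (_ * _).
by apply: eq_bigr => j /andP[ji jl]; rewrite permM tpermD// eq_sym.
Qed.

(** The terms with a derivative on a cofactor cancel by [jcof_divergence_free]; the others form the
    expansion along row [i]. Under the divergence [g i] is no longer differentiated. *)
Lemma jdet_divergence g i x : (forall j, polyfun (g j)) ->
  jdet g x = \sum_k partial k (fun y => g i y * jcof g i k y) x.
Proof.
move=> pg; under eq_bigr => k _ do rewrite (partialM _ _ (pg i) (polyfun_jcof i k pg)).
rewrite big_split/= -big_distrr/= jcof_divergence_free// mulr0 add0r (jdet_expand _ i).
by apply: eq_bigr => k _; rewrite mulrC.
Qed.

(** A crude count: all d! permutations are charged, although only those with [s i = k] occur. *)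
Lemma jcof_le g i k x (b : 'I_d -> R) :
  (forall j l, j != i -> `|partial l (g j) x| <= b j) ->
  `|jcof g i k x| <= d`!%:R * \prod_(j | j != i) b j.
Proof.
move=> gb; have b0 j : j != i -> 0 <= b j.
  by move=> ji; exact: le_trans (gb j i ji).
rewrite (le_trans (ler_norm_sum _ _ _))//.
apply: (@le_trans _ _ (\sum_(s : 'S_d | s i == k) \prod_(j | j != i) b j)).
  apply: ler_sum => s _; rewrite normrM normrX normrN1 expr1n mul1r normr_prod.
  by apply: ler_prod => j ji; rewrite normr_ge0 gb.
rewrite sumr_const -[leLHS]mulr_natl ler_wpM2r ?prodr_ge0// ler_nat -(card_Sn d).
exact: subset_leq_card (subset_predT _).
Qed.

Lemma jdet_le g x (b : 'I_d -> R) : (forall j l, `|partial l (g j) x| <= b j) ->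
  `|jdet g x| <= d`!%:R * \prod_j b j.
Proof.
move=> gb; rewrite (le_trans (ler_norm_sum _ _ _))//.
apply: (@le_trans _ _ (\sum_(s : 'S_d) \prod_j b j)).
  apply: ler_sum => s _; rewrite normrM normrX normrN1 expr1n mul1r normr_prod.
  by apply: ler_prod => j _; rewrite mxE normr_ge0 gb.
by rewrite sumr_const -[leLHS]mulr_natl -(card_Sn d) cardE.
Qed.

Definition jmix g h (i : 'I_d) (j : 'I_d) : E -> R :=
  if (j < i)%N then g j else if j == i then (fun x => g j x - h j x) else h j.

Lemma jdetB g h x : (forall j, polyfun (g j)) -> (forall j, polyfun (h j)) ->
  jdet g x - jdet h x = \sum_i jdet (jmix g h i) x.
Proof.
move=> pg ph.
(* [H n] takes its first [n] rows from [g]. Consecutive tuples differ in one row only, so linearity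
   in that row turns each telescoping difference into a determinant. *)
pose H (n : nat) (j : 'I_d) : E -> R := if (j < n)%N then g j else h j.
have Hd : H d = g by apply/funext => j; rewrite /H ltn_ord.
have H0 : H 0%N = h by [].
have lki i k : (lift i k == i :> nat) = false.
  by apply/negbTE; rewrite eq_sym; exact: neq_lift.
transitivity (jdet (H d) x - jdet (H 0%N) x); first by rewrite Hd H0.
rewrite -(telescope_sumr (fun n => jdet (H n) x))// big_mkord.
apply: eq_bigr => i _; apply/eqP; rewrite subr_eq addrC; apply/eqP.
rewrite [LHS](determinant_multilinear (B := \matrix_(k, j) partial j (H i k) x)
  (C := \matrix_(k, j) partial j (jmix g h i k) x) (i0 := i) (b := 1) (c := 1)).
- by rewrite !mul1r.
- apply/rowP => j; rewrite !mxE !mul1r /H /jmix ltnSn !ltnn eqxx partialB//.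
  by rewrite addrC subrK.
- apply/matrixP => k j; rewrite !mxE /H; congr (partial _ _ _).
  by rewrite ltnS [in RHS]leq_eqVlt lki.
- apply/matrixP => k j; rewrite !mxE /H /jmix; congr (partial _ _ _).
  by rewrite ltnS [in RHS]leq_eqVlt lki -val_eqE lki.
Qed.

End jacobian_determinant.

(** * Integrals over boxes *)

Section lebesgue_boxes.
Context {R : realType}.

Lemma measurable_rV_box n (A : 'I_n -> set R) : (forall i, measurable (A i)) ->
  measurable [set x : 'rV[R]_n | forall i, A i (x ord0 i)].
Proof.
move=> mA; rewrite (_ : [set x | _] =
    \bigcap_(i in [set: 'I_n]) [set x : 'rV[R]_n | A i (x ord0 i)]); last first.
  by apply/seteqP; split => x /= Ax i => [_|]; apply: Ax.
apply: fin_bigcap_measurable; first exact: finite_finset.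
move=> i _; rewrite -[X in measurable X]setTI.
exact: (measurable_coor i measurableT (mA i)).
Qed.

(** Follows the recursive construction of the measure: [rV_cons] pulls a product of sets back to the
    first factor times the product of the others. *)
Lemma borel_lebesgue_prod n (A : 'I_n -> set R) (l : 'I_n -> R) :
  (forall i, measurable (A i)) ->
  (forall i, lebesgue_measure (A i : set R) = (l i)%:E) ->
  borel_lebesgue R n [set x | forall i, A i (x ord0 i)] = (\prod_i l i)%:E.
Proof.
elim: n A l => [|n IH] A l mA lA /=.
  by rewrite big_ord0 diracE mem_set// => -[].
rewrite /borel_lebesgueS/= /pushforward.
rewrite (_ : _ @^-1` _ = A ord0 `*` [set y : 'rV[R]_n | forall i,
    A (lift ord0 i) (y ord0 i)]); last first.
  apply/seteqP; split => -[t y] /=.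
    move=> H; split; first by have := H ord0; rewrite rV_cons0.
    by move=> i; have := H (lift ord0 i); rewrite rV_consS.
  move=> [At Ay] i; have [j ->|->] := unliftP ord0 i.
    by rewrite rV_consS; exact: Ay.
  by rewrite rV_cons0.
rewrite product_measure1E; [|exact: mA|
  exact: (measurable_rV_box (fun i => mA (lift ord0 i)))].
rewrite big_ord_recl EFinM -(lA ord0); congr (_ * _)%E.
by apply: (IH (fun i => A (lift ord0 i)) (fun i => l (lift ord0 i))) => i; [exact: mA|exact: lA].
Qed.

Lemma measurable_lebesgueT n (A : set 'rV[R]_n) : measurable A ->
  measurable (A : set (lebesgueT R n)).
Proof. exact: caratheodory_measurable_mu_ext. Qed.

Lemma lebE n (A : set 'rV[R]_n) : measurable A ->
  leb (A : set (lebesgueT R n)) = borel_lebesgue R n A.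
Proof. by move=> mA; exact: measurable_mu_extE. Qed.

Lemma measurable_fun_lebesgueT n d (T : measurableType d) (D : set 'rV[R]_n)
    (f : 'rV[R]_n -> T) :
  measurable D -> measurable_fun D f ->
  measurable_fun (D : set (lebesgueT R n)) (f : lebesgueT R n -> T).
Proof. by move=> mD mf _ Y mY; apply: measurable_lebesgueT; exact: mf. Qed.

Definition box n (a b : 'I_n -> R) : set 'rV[R]_n :=
  [set x | forall i, a i <= x ord0 i <= b i].

Lemma measurable_box n (a b : 'I_n -> R) : measurable (box a b).
Proof.
rewrite (_ : box a b = [set x | forall i, `[a i, b i]%classic (x ord0 i)]).
  by apply: (measurable_rV_box (A := fun i => `[a i, b i]%classic)) => i.
by apply/seteqP; split => x /= H i; have := H i; rewrite /= in_itv.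
Qed.

Lemma borel_lebesgue_box n (a b : 'I_n -> R) : (forall i, a i <= b i) ->
  borel_lebesgue R n (box a b) = (\prod_i (b i - a i))%:E.
Proof.
move=> ab.
rewrite (_ : box a b = [set x | forall i, `[a i, b i]%classic (x ord0 i)]).
  apply: (borel_lebesgue_prod (A := fun i => `[a i, b i]%classic)) => // i.
  rewrite lebesgue_measure_itv/= lte_fin.
  by have := ab i; rewrite le_eqVlt => /predU1P[->|->]; rewrite ?ltxx ?subrr// EFinB.
by apply/seteqP; split => x /= H i; have := H i; rewrite /= in_itv.
Qed.

Lemma measurable_polyfun n (f : 'rV[R]_n -> R) : polyfun f ->
  measurable_fun [set: 'rV[R]_n] f.
Proof.
elim=> [c|i|g h _ mg _ mh|g h _ mg _ mh].
- exact: measurable_cst.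
- exact: measurable_coor.
- exact: measurable_funD.
- exact: measurable_funM.
Qed.

End lebesgue_boxes.

Section bounded_integrals.
Context d (T : measurableType d) (R : realType) (mu : {measure set T -> \bar R}).

Lemma bounded_integrable (A : set T) (f : T -> R) (M : R) :
  measurable A -> (mu A < +oo)%E -> measurable_fun A f ->
  (forall x, A x -> `|f x| <= M) -> mu.-integrable A (EFin \o f).
Proof.
move=> mA Afin mf fM; apply: measurable_bounded_integrable => //.
exists M; split; first exact: num_real.
by move=> y /ltW My x Ax; exact: le_trans (fM x Ax) My.
Qed.

Lemma le_abse_integral_indic (A : set T) (f : T -> \bar R) (c : R) :
  measurable A -> measurable_fun setT f -> 0 <= c ->
  (forall x, `|f x| <= (c * \1_A x)%:E)%E ->
  (`|\int[mu]_x f x| <= c%:E * mu A)%E.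
Proof.
move=> mA mf c0 fc; apply: le_trans (le_abse_integral mu measurableT mf) _.
have m1 : measurable_fun [set: T] (fun x => (\1_A x : R)%:E).
  by apply/measurable_EFinP; exact: measurable_indic.
apply: (@le_trans _ _ (\int[mu]_x (c%:E * (\1_A x)%:E)))%E.
  apply: ge0_le_integral => //.
  - exact: measurableT_comp.
  - by apply: emeasurable_funM => //; exact: measurable_cst.
rewrite ge0_integralZl_EFin//.
by rewrite integral_indic// setIT.
Qed.

End bounded_integrals.

Section box_divergence.
Context {R : realType}.
Local Notation bl := (borel_lebesgue R).

Lemma polyfun_box_bounded n (a b : 'I_n -> R) f : polyfun f ->
  exists M, forall x, box a b x -> `|f x| <= M.
Proof.
elim=> [c|i|g h _ [M gM] _ [N hN]|g h _ [M gM] _ [N hN]].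
- by exists `|c|.
- exists (Num.max `|a i| `|b i|) => x /(_ i)/andP[axi xbi].
  by rewrite le_max; case: (lerP 0 (x ord0 i)) => x0; apply/orP; [right|left];
    [rewrite ger0_norm// (le_trans xbi)// ler_norm|
     rewrite ltr0_norm// ler0_norm ?lerN2// (le_trans axi)// ltW].
- exists (M + N) => x abx; rewrite (le_trans (ler_normD _ _))// lerD//.
    exact: gM.
  exact: hN.
- exists (M * N) => x abx; rewrite normrM ler_pM//; first exact: gM.
  exact: hN.
Qed.

Lemma polyfun_cons1 n (f : 'rV[R]_n.+1 -> R) t : polyfun f ->
  polyfun (fun y => f (rV_cons (t, y))).
Proof.
elim=> [c|i|g h _ pg _ ph|g h _ pg _ ph].
- exact: polyfun_cst.
- have [j ->|->] := unliftP ord0 i.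
    by under eq_fun do rewrite rV_consS/=; exact: polyfun_coord.
  by under eq_fun do rewrite rV_cons0/=; exact: polyfun_cst.
- exact: polyfunD pg ph.
- exact: polyfunM pg ph.
Qed.

Lemma partial_lift n (f : 'rV[R]_n.+1 -> R) t y i : polyfun f ->
  partial (lift ord0 i) f (rV_cons (t, y)) =
  partial i (fun y => f (rV_cons (t, y))) y.
Proof.
elim=> [c|k|g h pg eg ph eh|g h pg eg ph eh].
- by rewrite !partial_cst.
- rewrite partial_coord; have [j ->|->] := unliftP ord0 k.
    under [in RHS]eq_fun do rewrite rV_consS/=.
    by rewrite partial_coord (inj_eq (@lift_inj _ _)).
  by under [in RHS]eq_fun do rewrite rV_cons0/=; rewrite partial_cst.
- by rewrite partialD// eg eh partialD//; exact: polyfun_cons1.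
- by rewrite partialM// eg eh partialM//; exact: polyfun_cons1.
Qed.

Lemma is_derive_cons n (f : 'rV[R]_n.+1 -> R) (t : R) (y : 'rV[R]_n) :
  polyfun f -> is_derive t 1 (fun s : R => f (rV_cons (s, y))) (partial ord0 f (rV_cons (t, y))).
Proof.
elim=> [c|k|g h pg eg ph eh|g h pg eg ph eh].
- by rewrite partial_cst; exact: is_derive_cst.
- rewrite partial_coord; have [j ->|->] := unliftP ord0 k.
    by under eq_fun do rewrite rV_consS/=; exact: is_derive_cst.
  by under eq_fun do rewrite rV_cons0/=; exact: is_derive_id.
- by rewrite partialD//; exact: is_deriveD.
- by rewrite partialM//; exact: is_deriveM.
Qed.

Lemma integral_borel_lebesgueS n (f : 'rV[R]_n.+1 -> \bar R) :
  measurable_fun setT f ->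
  (lebesgue_measure \x bl n)%E.-integrable setT (f \o @rV_cons R n) ->
  (\int[bl n.+1]_x f x =
   \int[lebesgue_measure \x bl n]_p f (rV_cons p))%E.
Proof.
move=> mf intf.
have := integral_pushforward (@measurable_rV_cons R n) mf intf measurableT.
by rewrite preimage_setT => <-; apply: eq_measure_integral => //; exact: measurable_rV_cons.
Qed.

(* The coordinate [i] is integrated first, by the fundamental theorem of
   calculus; Fubini lets the induction reach it. *)
Lemma box_partial_le n (a b : 'I_n -> R) (f : 'rV[R]_n -> R) (i : 'I_n) M :
  (forall j, a j < b j) -> polyfun f ->
  (forall x, box a b x -> `|f x| <= M) ->
  (`|\int[bl n]_(x in box a b) (partial i f x)%:E| <=
   (2 * M * \prod_(j | j != i) (b j - a j))%:E)%E.
Proof.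
elim: n a b f i => [|n IH] a b f i ab pf fM; first by case: i.
pose B := box a b; pose a' j := a (lift ord0 j); pose b' j := b (lift ord0 j).
pose B' := box a' b'.
have mB : measurable B by exact: measurable_box.
have mB' : measurable B' by exact: measurable_box.
have M0 : 0 <= M.
  apply: le_trans (fM (\row_j a j) _); first exact: normr_ge0.
  by move=> j; rewrite mxE lexx/= ltW.
have BE t y : B (rV_cons (t, y)) <-> (a ord0 <= t <= b ord0) /\ B' y.
  split=> [By|[abt By] j].
    split; first by have := By ord0; rewrite rV_cons0.
    by move=> j; have := By (lift ord0 j); rewrite rV_consS.
  have [k ->|->] := unliftP ord0 j; last by rewrite rV_cons0.
  by rewrite rV_consS; exact: By.
pose F := partial i f; have pF : polyfun F by exact: polyfun_partial.
pose G := ((EFin \o F) \_ B).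
have mF : measurable_fun setT (EFin \o F).
  by apply/measurable_EFinP; exact: measurable_polyfun.
have mG : measurable_fun setT G.
  by apply/(measurable_restrictT _ mB); exact: measurable_funTS.
have intG : (lebesgue_measure \x bl n)%E.-integrable setT (G \o @rV_cons R n).
  have [N FN] := polyfun_box_bounded a b pF.
  rewrite (_ : G \o _ = (EFin \o (F \o @rV_cons R n)) \_ (@rV_cons R n @^-1` B)).
    have mBc : measurable (@rV_cons R n @^-1` B).
      by rewrite -[X in measurable X]setTI; exact: measurable_rV_cons.
    apply/(integrable_mkcond _ mBc); apply: (bounded_integrable (M := N)) => //.
    - rewrite -[X in (X < _)%E]/(bl n.+1 B) borel_lebesgue_box ?ltry// => j.
      exact: ltW.
    - apply: measurable_funTS.
      exact: measurableT_comp (measurable_polyfun pF) (@measurable_rV_cons R n).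
    - by move=> p; exact: FN.
  by apply/funext => p; rewrite /G /= /patch /=.
rewrite integral_mkcond (integral_borel_lebesgueS mG intG).
(* If [i] is not the first coordinate, the induction hypothesis applies to the slices at fixed first
   coordinate, and integrating over that coordinate contributes the missing side. *)
have [k ik|i0] := unliftP ord0 i.
  have -> : \prod_(j | j != i) (b j - a j) =
     (\prod_(j | j != k) (b' j - a' j)) * (b ord0 - a ord0).
    rewrite big_mkcond big_ord_recl ik /= mulrC; congr (_ * _).
    by rewrite [RHS]big_mkcond; apply: eq_bigr => j _; rewrite (inj_eq (@lift_inj _ _)).
  rewrite -(integral12_prod_meas1 intG) mulrA EFinM.
  have -> : (b ord0 - a ord0)%:E = lebesgue_measure `[a ord0, b ord0]%classic.
    by rewrite lebesgue_measure_itv/= lte_fin ab EFinB.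
  apply: le_abse_integral_indic => //.
  - exact: measurable_fubini_F intG.
  - apply: mulr_ge0; first exact: mulr_ge0.
    by apply: prodr_ge0 => j _; rewrite subr_ge0 ltW//; exact: ab.
  move=> t; rewrite /fubini_F indicE; case: (boolP (t \in _)) => tab.
    have abt : a ord0 <= t <= b ord0 by have := set_mem tab; rewrite /= in_itv.
    rewrite mulr1.
    rewrite (_ : (fun y => _) = (EFin \o partial k (fun y => f (rV_cons (t, y)))) \_ B').
      rewrite -integral_mkcond; apply: IH; [by move=> j; exact: ab|exact: polyfun_cons1|].
      by move=> y By; apply: fM; apply/BE.
    apply/funext => y; rewrite /G /= /patch /F /= ik partial_lift//.
    congr (if _ then _ else _); apply/idP/idP => /set_mem By; apply/mem_set.
      by have /BE[] := By.
    by apply/BE.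
  rewrite mulr0 (_ : (fun y => _) = cst 0%E); first by rewrite integral0 abse0.
  apply/funext => y; rewrite /G /= /patch memNset// => /BE[abt _].
  by move/negP: tab; apply; apply/mem_set; rewrite /= in_itv.
(* If [i] is the first coordinate, the integral along each line leaves the values of [f] at its two
   ends, whence [2 * M]; the remaining coordinates contribute the volume of [B']. *)
have -> : \prod_(j | j != i) (b j - a j) = \prod_j (b' j - a' j).
  by rewrite big_mkcond big_ord_recl i0 /= mul1r.
rewrite -(integral21_prod_meas1 intG) EFinM.
have -> : (\prod_j (b' j - a' j))%:E = bl n B'.
  by rewrite borel_lebesgue_box// => j; exact/ltW/ab.
apply: le_abse_integral_indic => //.
- exact: measurable_fubini_G intG.
- exact: mulr_ge0.
move=> y; rewrite /fubini_G indicE; case: (boolP (y \in _)) => yB.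
  rewrite mulr1.
  rewrite (_ : (fun t => _) =
     (fun t => (partial ord0 f (rV_cons (t, y)))%:E) \_ `[a ord0, b ord0]%classic).
    rewrite -integral_mkcond.
    have cc (q : 'rV[R]_n.+1 -> R) : polyfun q -> continuous (fun t : R => q (rV_cons (t, y))).
      move=> pq t; apply: differentiable_continuous; apply/derivable1_diffP.
      by have [] := is_derive_cons t y pq.
    rewrite (continuous_FTC2 (F := fun t => f (rV_cons (t, y))))//.
    - rewrite -EFinB lee_fin mulr2n mulrDl mul1r (le_trans (ler_normB _ _))//.
      have By := set_mem yB.
      by rewrite lerD// fM//; apply/BE; rewrite lexx ltW.
    - by apply: continuous_subspaceT; apply: cc; rewrite -i0.
    - split.
      + by move=> t _; have [] := is_derive_cons t y pf.
      + by apply: cvg_at_right_filter; exact: cc.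
      + by apply: cvg_at_left_filter; exact: cc.
    - by move=> t _; rewrite derive1E; have [_] := is_derive_cons t y pf.
  apply/funext => t; rewrite /G /= /patch /F /= i0.
  congr (if _ then _ else _); apply/idP/idP => /set_mem tB; apply/mem_set.
    by have /BE[] := tB; rewrite /= in_itv.
  by apply/BE; split; [move: tB; rewrite /= in_itv|exact: set_mem].
rewrite mulr0 (_ : (fun t => _) = cst 0%E); first by rewrite integral0 abse0.
apply/funext => t; rewrite /G /= /patch memNset// => /BE[_ By].
by move/negP: yB; apply; exact: mem_set.
Qed.

End box_divergence.

(** * Bernstein polynomials on [-1,2]^d *)

Section bernstein_weights.
Context {R : realType} (N : nat).
Implicit Types (x t : R) (k : 'I_N.+1).

Definition bernp k : {poly R} := ('X^k * (1 - 'X) ^+ (N - k)) *+ 'C(N, k).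

(** The [m]-th central moment of the binomial law with [N] trials and success probability ['X]. *)
Let T m : {poly R} := \sum_k bernp k * (k%:R - N%:R * 'X) ^+ m.

Lemma sum_bernp : \sum_k bernp k = 1.
Proof.
have := exprDn (1 - 'X : {poly R}) 'X N; rewrite subrK expr1n => ->.
by apply: eq_bigr => k _; rewrite /bernp mulrC.
Qed.

(* Turns a derivative of the weights into a factor [k - N X], which yields the
   recursion for the central moments. *)
Lemma deriv_bernp k :
  'X * (1 - 'X) * (bernp k)^`() = bernp k * (k%:R - N%:R * 'X).
Proof.
have eX n : 'X * ('X^n)^`() = n%:R * 'X^n :> {poly R}.
  rewrite derivXn; case: n => [|n]; first by rewrite mulr0n mulr0 mul0r.
  by rewrite mulrnAr -exprS mulr_natl.
have eY n : (1 - 'X) * ((1 - 'X) ^+ n)^`() = - n%:R * (1 - 'X) ^+ n :> {poly R}.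
  rewrite deriv_exp derivB derivC derivX sub0r mulN1r mulNrn mulrN mulNr.
  case: n => [|n]; first by rewrite mulr0n mulr0 mul0r.
  by rewrite mulrnAr -exprS mulr_natl.
rewrite /bernp derivMn [LHS]mulrnAr [RHS]mulrnAl; congr (_ *+ _).
have kN : N%:R = k%:R + (N - k)%:R :> {poly R}.
  by rewrite -natrD subnKC// -ltnS.
rewrite derivM mulrDr.
rewrite (_ : _ * _ * (_ * _) = (1 - 'X) * ('X * ('X^k)^`()) * (1 - 'X) ^+ (N - k));
  last by ring.
rewrite (_ : 'X * (1 - 'X) * ('X^k * _) =
  'X * 'X^k * ((1 - 'X) * ((1 - 'X) ^+ (N - k))^`())); last by ring.
by rewrite eX eY kN; ring.
Qed.

Lemma deriv_natr n : (n%:R : {poly R})^`() = 0.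
Proof. by rewrite -polyC_natr derivC. Qed.

(** Differentiating [T m]: by [deriv_bernp] the derivative of the weight raises the power by one,
    and that of the power gives back [T m.-1]. For [m = 0] the truncated predecessor has coefficient
    0. *)
Lemma momentS m :
  T m.+1 = 'X * (1 - 'X) * ((T m)^`() + N%:R * m%:R * T m.-1).
Proof.
rewrite /T raddf_sum/= mulr_sumr -big_split/= mulr_sumr; apply: eq_bigr => k _.
have E : ((k%:R - N%:R * 'X) ^+ m)^`() =
    - (N%:R * m%:R * (k%:R - N%:R * 'X) ^+ m.-1) :> {poly R}.
  have dq : (k%:R - N%:R * 'X)^`() = - N%:R :> {poly R}.
    by rewrite derivB derivM !deriv_natr derivX; ring.
  by rewrite deriv_exp dq -mulr_natr; ring.
rewrite derivM E.
transitivity ('X * (1 - 'X) * (bernp k)^`() * (k%:R - N%:R * 'X) ^+ m).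
  by rewrite deriv_bernp exprS mulrA.
by ring.
Qed.

Lemma moment1 : T 1 = 0.
Proof.
rewrite momentS /= (_ : T 0 = 1); first by rewrite derivC mulr0 mul0r addr0 mulr0.
by rewrite /T; under eq_bigr do rewrite expr0 mulr1; exact: sum_bernp.
Qed.

Lemma moment2 : T 2 = N%:R * 'X * (1 - 'X).
Proof.
rewrite momentS /= moment1 (_ : T 0 = 1); first by rewrite derivC; ring.
by rewrite /T; under eq_bigr do rewrite expr0 mulr1; exact: sum_bernp.
Qed.

Lemma moment4 : T 4 = 'X * (1 - 'X) * N%:R *
  ((1 - 2 * 'X) ^+ 2 - 2 * 'X * (1 - 'X) + 3 * N%:R * 'X * (1 - 'X)).
Proof.
rewrite momentS /= momentS /= moment2 moment1.
rewrite !(derivD, derivM, derivN, derivX, deriv_natr, derivC, derivB); ring.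
Qed.

End bernstein_weights.

Section bernstein_nodes.
Context {R : realType} (N : nat) (N0 : (0 < N)%N).
Implicit Types (x : R) (k : 'I_N.+1).

(** The map t -> 3 t - 1 carries the grid [k / N] of [0, 1] to [-1, 2]; the weights are transported
    by its inverse. *)
Definition bnode k : R := 3 * k%:R / N%:R - 1.
Definition bweight k x : R := (bernp k).[(x + 1) / 3].

Let Nr0 : N%:R != 0 :> R. Proof. by rewrite pnatr_eq0 -lt0n. Qed.

Let bnodeE k x : k%:R - N%:R * ((x + 1) / 3) = N%:R / 3 * (bnode k - x).
Proof. by rewrite /bnode; field. Qed.

Lemma bweight_ge0 k x : -1 <= x <= 2 -> 0 <= bweight k x.
Proof.
move=> x12; rewrite /bweight /bernp hornerMn !hornerE.
rewrite mulrn_wge0// mulr_ge0// exprn_ge0//; lra.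
Qed.

Lemma sum_bweight x : \sum_k bweight k x = 1.
Proof. by rewrite -horner_sum sum_bernp hornerC. Qed.

Let momentE m x : \sum_k bweight k x * (bnode k - x) ^+ m = (3 / N%:R) ^+ m *
  (\sum_(k < N.+1) bernp k * (k%:R - N%:R * 'X) ^+ m).[(x + 1) / 3].
Proof.
rewrite horner_sum mulr_sumr; apply: eq_bigr => k _.
rewrite hornerM horner_exp hornerD hornerN hornerM hornerX -!polyC_natr !hornerC.
rewrite bnodeE [RHS]mulrCA; congr (_ * _); rewrite -exprMn mulrA.
by rewrite (_ : 3 / _ * _ = 1) ?mul1r//; field.
Qed.

Lemma sum_bweight_mean x : \sum_k bweight k x * bnode k = x.
Proof.
have := momentE 1 x; rewrite moment1 horner0 mulr0.
under eq_bigr do rewrite expr1 mulrBr.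
by rewrite sumrB -mulr_suml sum_bweight mul1r => /eqP; rewrite subr_eq0 => /eqP.
Qed.

Lemma sum_bweight_var x :
  \sum_k bweight k x * (bnode k - x) ^+ 2 = (x + 1) * (2 - x) / N%:R.
Proof.
by rewrite momentE moment2 -polyC_natr !hornerE /=; field.
Qed.

Lemma sum_bweight_kurtosis x : -1 <= x <= 2 ->
  \sum_k bweight k x * (bnode k - x) ^+ 4 <= 81 / N%:R ^+ 2.
Proof.
move=> x12; rewrite momentE moment4 -!polyC_natr !hornerE/=.
set n : R := N%:R; set q := (x + 1) / 3 * (1 - (x + 1) / 3).
have n1 : 1 <= n by rewrite ler1n.
have q0 : 0 <= q by apply: mulr_ge0; lra.
have q1 : q <= 1 / 4.
  rewrite -subr_ge0 (_ : _ - q = ((x + 1) / 3 - 1 / 2) ^+ 2) ?sqr_ge0//.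
  by rewrite /q; field.
(* With q = t (1 - t), the binomial moment is n q (1 - 6 q + 3 n q), at most n^2 because q <= 1/4
   and n >= 1. The stretching by 3 contributes 81 = 3^4. *)
rewrite [leLHS](_ : _ = 81 / n ^+ 4 * (n * (q * (1 - 6 * q + 3 * (n * q))))).
  rewrite [leRHS](_ : _ = 81 / n ^+ 4 * n ^+ 2); last by field.
  apply: ler_wpM2l; first by rewrite divr_ge0// exprn_ge0//; lra.
  rewrite expr2; apply: ler_wpM2l; first by lra.
  have nq : n * q <= n * (1 / 4) by apply: ler_wpM2l => //; lra.
  have q2 : q * (1 - 6 * q + 3 * (n * q)) <= q * (1 + 3 * n).
    by apply: ler_wpM2l => //; lra.
  have : q * (1 + 3 * n) <= (1 / 4) * (1 + 3 * n) by apply: ler_wpM2r => //; lra.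
  lra.
by rewrite /q; field.
Qed.

End bernstein_nodes.

Section bernstein_operator.
Context {R : realType} {d : nat} (N : nat) (N0 : (0 < N)%N).
Local Notation E := 'rV[R]_d.
Local Notation idx := {ffun 'I_d -> 'I_N.+1}.
Implicit Types (x : E) (k : idx) (f : E -> R).

Definition bpoint k : E := \row_i bnode (k i).
Definition bprod k x : R := \prod_i bweight (k i) (x ord0 i).
Definition bern f x : R := \sum_(k : idx) f (bpoint k) * bprod k x.

Local Notation Q3 := (box (fun=> -1) (fun=> 2) : set E).

Lemma bprod_ge0 k x : Q3 x -> 0 <= bprod k x.
Proof. by move=> x12; apply: prodr_ge0 => i _; exact/bweight_ge0/x12. Qed.

Lemma sum_bprod x : \sum_k bprod k x = 1.
Proof.
rewrite /bprod -(bigA_distr_bigA (fun i j => bweight j (x ord0 i))).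
by rewrite big1// => i _; exact: sum_bweight.
Qed.

(** The weights [bprod] are a law with independent coordinates, and a function of one coordinate
    only sees the corresponding marginal. *)
Lemma sum_bprod_marginal i (phi : 'I_N.+1 -> R) x :
  \sum_(k : idx) phi (k i) * bprod k x = \sum_j phi j * bweight j (x ord0 i).
Proof.
pose F l j := (if l == i then phi j else 1) * bweight j (x ord0 l).
transitivity (\prod_l \sum_j F l j); last first.
  rewrite (bigD1 i)//= [X in _ * X]big1 ?mulr1.
    by apply: eq_bigr => j _; rewrite /F eqxx.
  move=> l /negPf li; under eq_bigr do rewrite /F li mul1r.
  exact: sum_bweight.
rewrite bigA_distr_bigA; apply: eq_bigr => k _.
rewrite /F big_split/=; congr (_ * _).
by rewrite (bigD1 i)//= eqxx big1 ?mulr1// => l /negPf ->.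
Qed.

Lemma polyfun_bweight (j : 'I_N.+1) i : polyfun (fun x => bweight j (x ord0 i)).
Proof.
apply: polyfun_horner; apply: polyfunM; last exact: polyfun_cst.
by apply: polyfunD; [exact: polyfun_coord|exact: polyfun_cst].
Qed.

Lemma polyfun_bprod k : polyfun (bprod k).
Proof. by apply: polyfun_prod => i; exact: polyfun_bweight. Qed.

Lemma polyfun_bern f : polyfun (bern f).
Proof.
apply: polyfun_sum => k; apply: polyfunM; first exact: polyfun_cst.
exact: polyfun_bprod.
Qed.

Lemma partial_bern j f x :
  partial j (bern f) x = \sum_k f (bpoint k) * partial j (bprod k) x.
Proof.
rewrite /bern partial_sum.
  by apply: eq_bigr => k _; rewrite partialZ//; exact: polyfun_bprod.
move=> k; apply: polyfunM; first exact: polyfun_cst.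
exact: polyfun_bprod.
Qed.

Lemma sum_partial_bprod j x : \sum_k partial j (bprod k) x = 0.
Proof.
rewrite -partial_sum; last exact: polyfun_bprod.
under eq_fun do rewrite sum_bprod.
exact: partial_cst.
Qed.

(** [bern] fixes the coordinate functions, since the weights have mean [x]; this is the
    differentiated identity. *)
Lemma sum_partial_bprod_node i j x :
  \sum_(k : idx) bnode (k i) * partial j (bprod k) x = (i == j)%:R.
Proof.
have := partial_bern j (fun x => x ord0 i) x.
under [in RHS]eq_bigr do rewrite mxE.
move=> <-; rewrite (_ : bern _ = fun y => y ord0 i); first exact: partial_coord.
rewrite /bern; apply/funext => y; under eq_bigr do rewrite mxE.
rewrite (sum_bprod_marginal i (@bnode R N)).
by under eq_bigr do rewrite mulrC; exact: sum_bweight_mean.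
Qed.

Lemma partial_horner j (p : {poly R}) f x : polyfun f ->
  partial j (fun y => p.[f y]) x = p^`().[f x] * partial j f x.
Proof.
move=> pf; elim/poly_ind: p => [|p c IH].
  rewrite deriv0 horner0 mul0r; under eq_fun do rewrite horner0.
  exact: partial_cst.
under eq_fun do rewrite hornerMXaddC.
rewrite partialD; [|by apply: polyfunM => //; exact: polyfun_horner|exact: polyfun_cst].
rewrite partial_cst addr0 partialM//; last exact: polyfun_horner.
by rewrite IH derivMXaddC hornerD hornerMX; ring.
Qed.

(** The factor on the left is 9 t (1 - t) with t = (x_j + 1) / 3. It stays on that side because it
    vanishes on faces of [-1,2]^d. *)
Lemma partial_bweight (a : 'I_N.+1) i j x :
  (x ord0 j + 1) * (2 - x ord0 j) * partial j (fun y => bweight a (y ord0 i)) x =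
  (i == j)%:R * (N%:R * (bweight a (x ord0 j) * (bnode a - x ord0 j))).
Proof.
have pc : polyfun (fun y : E => (y ord0 i + 1) / 3).
  apply: polyfunM; last exact: polyfun_cst.
  by apply: polyfunD; [exact: polyfun_coord|exact: polyfun_cst].
rewrite /bweight partial_horner//.
have -> : partial j (fun y : E => (y ord0 i + 1) / 3) x = (i == j)%:R / 3.
  rewrite partialM; [|apply: polyfunD; [exact: polyfun_coord|exact: polyfun_cst]
    |exact: polyfun_cst].
  rewrite partial_cst mulr0 add0r partialD; [|exact: polyfun_coord|exact: polyfun_cst].
  by rewrite partial_coord partial_cst addr0 mulrC.
have [->|] := eqVneq i j; last by rewrite !mul0r !mulr0.
have := congr1 (fun p : {poly R} => p.[(x ord0 j + 1) / 3]) (deriv_bernp a).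
rewrite /= -!polyC_natr !(hornerM, hornerD, hornerN, hornerX, hornerC).
set t := (x ord0 j + 1) / 3 => e.
have Nr0 : N%:R != 0 :> R by rewrite pnatr_eq0 -lt0n.
transitivity (3 * (t * (1 - t) * (bernp a)^`().[t])).
  by rewrite /t; field.
by rewrite e /bnode /t; field.
Qed.

Lemma partial_bprod j k x :
  (x ord0 j + 1) * (2 - x ord0 j) * partial j (bprod k) x =
  N%:R * (bprod k x * (bnode (k j) - x ord0 j)).
Proof.
rewrite /bprod partial_prod ?index_enum_uniq//; last first.
  by move=> i; exact: polyfun_bweight.
rewrite (bigD1 j)//= mulrDr mulrA partial_bweight eqxx mul1r.
rewrite [X in _ + X](_ : _ = 0); last first.
  rewrite mulr_sumr big1// => i ij.
  by rewrite mulrA partial_bweight (negPf ij) mul0r mul0r.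
by rewrite addr0 [in RHS](bigD1 j)//=; ring.
Qed.

End bernstein_operator.

(** * Approximation and gradient estimates for Bernstein polynomials *)

Section euclidean_norm.
Context {R : realType} {d : nat}.
Local Notation E := 'rV[R]_d.
Implicit Types x y v : E.

Lemma enorm_ge0 x : 0 <= enorm x. Proof. exact: sqrtr_ge0. Qed.

Lemma enorm_sqr x : enorm x ^+ 2 = \sum_i x ord0 i ^+ 2.
Proof. by rewrite sqr_sqrtr// sumr_ge0// => i _; rewrite sqr_ge0. Qed.

Lemma coord_le_enorm x i : `|x ord0 i| <= enorm x.
Proof.
rewrite -ler_sqr ?nnegrE ?enorm_ge0// enorm_sqr real_normK ?num_real//.
by rewrite (bigD1 i)//= lerDl sumr_ge0// => j _; rewrite sqr_ge0.
Qed.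

Lemma enorm_le_coord x M : 0 <= M -> (forall i, `|x ord0 i| <= M) ->
  enorm x <= d%:R * M.
Proof.
move=> M0 xM; rewrite -ler_sqr ?nnegrE ?enorm_ge0 ?mulr_ge0// enorm_sqr.
apply: (@le_trans _ _ (\sum_(i < d) M ^+ 2)).
  apply: ler_sum => i _; rewrite -(real_normK (num_real (x ord0 i))).
  by rewrite ler_sqr ?nnegrE.
rewrite sumr_const card_ord -[leLHS]mulr_natl exprMn ler_wpM2r ?sqr_ge0//.
by rewrite -natrX ler_nat; case: (d) => // n; rewrite expnS leq_pmulr ?expn_gt0.
Qed.

Lemma enorm_le_diff x y : (forall i, `|x ord0 i| <= `|y ord0 i|) ->
  enorm x <= enorm y.
Proof.
move=> xy; rewrite -ler_sqr ?nnegrE ?enorm_ge0// !enorm_sqr; apply: ler_sum => i _.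
rewrite -(real_normK (num_real (x ord0 i))) -(real_normK (num_real (y ord0 i))).
by rewrite ler_sqr ?nnegrE.
Qed.

Lemma enorm_eq0 x : (enorm x == 0) = (x == 0).
Proof.
apply/eqP/eqP => [x0|->].
  apply/rowP => i; rewrite mxE; apply/normr0_eq0/eqP.
  by rewrite eq_le normr_ge0 andbT -x0 coord_le_enorm.
by rewrite /enorm big1 ?sqrtr0// => i _; rewrite mxE expr0n.
Qed.

End euclidean_norm.

Section power_scale.
Context {R : realType}.

(** Trades a fractional power of the distance to a node for its square, whose mean is known exactly
    from the variance. It serves for the exponents gamma and gamma + 1, whence the range up to 2. *)
Lemma powR_le_scale (z s a : R) : 0 <= z -> 0 < s -> 0 <= a <= 2 ->
  z `^ a <= s `^ a * (1 + (z / s) ^+ 2).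
Proof.
move=> z0 s0 /andP[a0 a2].
have [zs|sz] := lerP z s.
  apply: le_trans (_ : s `^ a <= _); first by rewrite ge0_ler_powR// nnegrE// ltW.
  by rewrite ler_peMr ?powR_ge0// lerDl sqr_ge0.
have -> : z = s * (z / s) by rewrite mulrCA divff ?mulr1// gt_eqF.
have zs1 : 1 <= z / s by rewrite ler_pdivlMr// mul1r ltW.
rewrite powRM ?(ltW s0)//; last exact: le_trans zs1.
rewrite ler_wpM2l ?powR_ge0// mulrCA divff ?gt_eqF// mulr1.
apply: (@le_trans _ _ ((z / s) `^ 2)); first by rewrite ler_powR.
by rewrite powR_mulrn ?lerDr//; exact: le_trans zs1.
Qed.

End power_scale.

Section enlarged_cube.
Context {R : realType} {d : nat}.
Local Notation E := 'rV[R]_d.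

(* Far enough from the faces of [-1,2]^d for the derivatives of the Bernstein
   weights to be controlled, and containing the cube in its interior, which
   leaves room for a cutoff. *)
Definition enlarged_cube : set E := box (fun=> - 2^-1) (fun=> 3 / 2).

Lemma enlarged_cube_node x : enlarged_cube x -> box (fun=> -1) (fun=> 2) x.
Proof. by move=> xQ i; have := xQ i; lra. Qed.

Lemma partial_bprod_le N j (k : {ffun 'I_d -> 'I_N.+1}) x :
  (0 < N)%N -> enlarged_cube x ->
  `|partial j (bprod k) x| <= N%:R * (bprod k x * `|bnode (k j) - x ord0 j|).
Proof.
move=> N0 xQ; have x12 := enlarged_cube_node xQ.
(* On [-1/2, 3/2] this product is smallest at the ends, where it equals 5/4; it can thus be inserted
   into the bound for free. *)
have c1 : 1 <= (x ord0 j + 1) * (2 - x ord0 j) by have := xQ j; nra.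
apply: (@le_trans _ _ `|(x ord0 j + 1) * (2 - x ord0 j) * partial j (bprod k) x|).
  by rewrite normrM ler_peMl// (le_trans c1)// ler_norm.
by rewrite partial_bprod// !normrM (ger0_norm (bprod_ge0 k x12)) (ger0_norm (ler0n _ N)).
Qed.

End enlarged_cube.

Section bernstein_estimates.
Context {R : realType} {d : nat} (N : nat) (s : R).
Hypotheses (s0 : 0 < s) (Ns : N%:R * s ^+ 2 = 1).
Local Notation E := 'rV[R]_d.
Local Notation idx := {ffun 'I_d -> 'I_N.+1}.

Definition holder_on_space (L gam : R) (f : E -> R) :=
  forall x y, `|f x - f y| <= L * enorm (x - y) `^ gam.

Let N0 : (0 < N)%N.
Proof.
by rewrite lt0n; apply: contra_eq_neq Ns => /= ->; rewrite mul0r eq_sym oner_eq0.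
Qed.

Let Nr0 : 0 < N%:R :> R. Proof. by rewrite ltr0n. Qed.

(** Each coordinate has variance [(x + 1) * (2 - x) / N], at most 3 / N, and dividing by s^2
    multiplies by [N]. Together with the total mass 1 this is the origin of the constant 1 + 3 d in
    all later estimates. *)
Lemma sum_bprod_sqr x : enlarged_cube x ->
  \sum_(k : idx) bprod k x * (1 + (enorm (bpoint k - x) / s) ^+ 2) <= 1 + 3 * d%:R.
Proof.
move=> xQ; under eq_bigr do rewrite mulrDr mulr1.
rewrite big_split/= sum_bprod lerD2l.
have -> : \sum_(k : idx) bprod k x * (enorm (bpoint k - x) / s) ^+ 2 =
    N%:R * \sum_i \sum_(k : idx) (bnode (k i) - x ord0 i) ^+ 2 * bprod k x.
  rewrite exchange_big mulr_sumr/=; apply: eq_bigr => k _.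
  rewrite expr_div_n enorm_sqr -mulr_suml; under eq_bigr do rewrite !mxE.
  have s20 : s ^+ 2 != 0 by rewrite expf_neq0// gt_eqF.
  have -> : N%:R = (s ^+ 2)^-1 by apply: (mulIf s20); rewrite Ns mulVf.
  by rewrite [RHS]mulrC -[RHS]mulrA mulrCA.
have -> : \sum_i \sum_(k : idx) (bnode (k i) - x ord0 i) ^+ 2 * bprod k x =
    \sum_i ((x ord0 i + 1) * (2 - x ord0 i) / N%:R).
  apply: eq_bigr => i _; rewrite -sum_bweight_var//.
  rewrite (sum_bprod_marginal i (fun j => (bnode j - x ord0 i) ^+ 2)).
  by apply: eq_bigr => j _; rewrite mulrC.
rewrite -mulr_suml mulrC mulfVK ?gt_eqF//.
apply: (@le_trans _ _ (\sum_(i < d) 3)); last by rewrite sumr_const card_ord -[leLHS]mulr_natr.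
by apply: ler_sum => i _; have := xQ i; nra.
Qed.

(** The weights sum to 1, so the error is an average of the differences [f (bpoint k) - f x],
    controlled through [powR_le_scale]. *)
Lemma bern_close L gam f x : 0 <= L -> 0 < gam <= 1 ->
  holder_on_space L gam f -> enlarged_cube x ->
  `|bern N f x - f x| <= (1 + 3 * d%:R) * L * s `^ gam.
Proof.
move=> L0 gam01 hf xQ.
have x12 := enlarged_cube_node xQ.
have -> : bern N f x - f x = \sum_(k : idx) (f (bpoint k) - f x) * bprod k x.
  by under eq_bigr do rewrite mulrBl; rewrite sumrB -mulr_sumr sum_bprod mulr1.
rewrite (le_trans (ler_norm_sum _ _ _))//.
apply: (@le_trans _ _ (\sum_(k : idx) L * s `^ gam *
   (bprod k x * (1 + (enorm (bpoint k - x) / s) ^+ 2)))).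
  apply: ler_sum => k _; rewrite normrM (ger0_norm (bprod_ge0 k x12)).
  rewrite [leRHS]mulrCA mulrC ler_wpM2l ?bprod_ge0//.
  rewrite (le_trans (hf _ _))// -mulrA ler_wpM2l//.
  by rewrite powR_le_scale ?enorm_ge0//; lra.
rewrite -mulr_sumr -[leRHS]mulrA [leLHS]mulrC ler_wpM2r ?mulr_ge0 ?powR_ge0//.
exact: sum_bprod_sqr.
Qed.

(** The derivatives of the weights sum to 0, so [f x] may be subtracted from every value. By
    [partial_bprod_le] a derivative costs N z = z / s^2, which raises the exponent to gam + 1 and
    leaves s^(gam + 1) / s^2. *)
Lemma partial_bern_le L gam f j x : 0 <= L -> 0 < gam <= 1 ->
  holder_on_space L gam f -> enlarged_cube x ->
  `|partial j (bern N f) x| <= (1 + 3 * d%:R) * L * (s `^ gam / s).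
Proof.
move=> L0 gam01 hf xQ; have x12 := enlarged_cube_node xQ.
have -> : partial j (bern N f) x =
    \sum_(k : idx) (f (bpoint k) - f x) * partial j (bprod k) x.
  under eq_bigr do rewrite mulrBl.
  by rewrite sumrB -mulr_sumr sum_partial_bprod mulr0 subr0 partial_bern.
rewrite (le_trans (ler_norm_sum _ _ _))//.
apply: (@le_trans _ _ (\sum_(k : idx) L * (s `^ gam / s) *
   (bprod k x * (1 + (enorm (bpoint k - x) / s) ^+ 2)))).
  apply: ler_sum => k _; rewrite normrM; set z := enorm _.
  have z0 : 0 <= z by exact: enorm_ge0.
  have zj : `|bnode (k j) - x ord0 j| <= z.
    by have := coord_le_enorm (bpoint k - x) j; rewrite !mxE.
  apply: (@le_trans _ _ ((L * z `^ gam) * (N%:R * (bprod k x * z)))).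
    apply: ler_pM; [exact: normr_ge0|exact: normr_ge0|exact: hf|].
    apply: le_trans (partial_bprod_le j k N0 xQ) _.
    by rewrite ler_wpM2l ?ler0n// ler_wpM2l ?bprod_ge0.
  have -> : L * z `^ gam * (N%:R * (bprod k x * z)) =
      L * (bprod k x * (N%:R * (z `^ gam * z))) by ring.
  rewrite -[leRHS]mulrA ler_wpM2l// [leRHS]mulrCA ler_wpM2l ?bprod_ge0//.
  have -> : z `^ gam * z = z `^ (gam + 1).
    have [->|zn0] := eqVneq z 0; first by rewrite mulr0 powR0//; lra.
    by rewrite powRD ?zn0 ?implybT// powRr1.
  have -> : s `^ gam / s * (1 + (z / s) ^+ 2) =
      N%:R * (s `^ (gam + 1) * (1 + (z / s) ^+ 2)).
    rewrite powRD ?(gt_eqF s0) ?implybT// powRr1 ?(ltW s0)//.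
    rewrite -mulrA [RHS]mulrA mulrA; congr (_ * _).
    transitivity (N%:R * s ^+ 2 * s `^ gam / s); first by rewrite Ns mul1r.
    by field; exact: lt0r_neq0.
  rewrite ler_wpM2l ?ler0n// powR_le_scale//; lra.
rewrite -mulr_sumr -[leRHS]mulrA [leLHS]mulrC ler_wpM2r//.
  by rewrite mulr_ge0// divr_ge0 ?powR_ge0// ltW.
exact: sum_bprod_sqr.
Qed.

End bernstein_estimates.

(** * Extension of functions on the cube and differentiability *)

Section mean_value.
Context {R : realType} {d : nat}.
Local Notation E := 'rV[R]_d.

Lemma derive_sum_partial (f : E -> R) v x : differentiable f x ->
  'D_v f x = \sum_i v ord0 i * partial i f x.
Proof.
move=> df; rewrite deriveE// [in LHS](row_sum_delta v) linear_sum.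
by apply: eq_bigr => i _; rewrite linearZ/= /partial deriveE.
Qed.

Lemma is_derive_line (f : E -> R) (y v : E) (t : R) :
  differentiable f (t *: v + y) ->
  is_derive t 1 (fun s : R => f (s *: v + y)) ('D_v f (t *: v + y)).
Proof.
move=> df; have dv : derivable f (t *: v + y) v by exact: diff_derivable.
have e : (fun h : R => h^-1 *: (f ((h *: (1 : R) + t) *: v + y) - f (t *: v + y))) =
         (fun h : R => h^-1 *: (f (h *: v + (t *: v + y)) - f (t *: v + y))).
  by apply/funext => h; rewrite scalerDl -addrA [h *: 1]mulr1.
by split; rewrite /derivable /derive /shift /= e.
Qed.

Lemma segment_lipschitz (a b : 'I_d -> R) (f : E -> R) M x y :
  (forall z, box a b z -> differentiable f z) ->
  (forall z j, box a b z -> `|partial j f z| <= M) ->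
  box a b x -> box a b y ->
  `|f x - f y| <= M * d%:R * enorm (x - y).
Proof.
move=> df fM abx aby; set v := x - y.
have zB (t : R) : t \in `[0, 1] -> box a b (t *: v + y).
  rewrite in_itv/= => /andP[t0 t1] i; rewrite !mxE.
  by have := abx i; have := aby i => /andP[? ?] /andP[? ?]; apply/andP; split; nra.
have dphi (t : R) : t \in `]0, 1[ -> is_derive t 1 (fun s : R => f (s *: v + y))
    ('D_v f (t *: v + y)).
  by move=> t01; apply/is_derive_line/df/zB; exact: subset_itv_oo_cc.
have cphi : {within `[0, 1], continuous (fun s : R => f (s *: v + y))}.
  apply: derivable_within_continuous => t t01.
  by have [] := is_derive_line (df _ (zB _ t01)).
have [c c01] := MVT ltr01 dphi cphi.
rewrite scale1r scale0r add0r subr0 mulr1 /v subrK => ->.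
have cB := zB c (subset_itv_oo_cc c01).
rewrite derive_sum_partial; last exact: df.
rewrite (le_trans (ler_norm_sum _ _ _))//.
apply: (@le_trans _ _ (\sum_(i < d) (M * enorm v))).
  apply: ler_sum => i _; rewrite normrM mulrC.
  by apply: ler_pM => //; [exact: fM|exact: coord_le_enorm].
by rewrite sumr_const card_ord -[leLHS]mulr_natr mulrAC.
Qed.

End mean_value.

Section clamping.
Context {R : realType} {d : nat}.
Local Notation E := 'rV[R]_d.

Definition clamp (x : E) : E := \row_i Num.max 0 (Num.min 1 (x ord0 i)).

Lemma clamp_cube x : unit_cube (clamp x).
Proof.
by move=> i; rewrite mxE le_max lexx/= ge_max ler01/= ge_min lexx.
Qed.

Lemma clampK x : unit_cube x -> clamp x = x.
Proof.
move=> x01; apply/rowP => i; rewrite mxE; have /andP[x0 x1] := x01 i.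
by rewrite min_r// max_r.
Qed.

(** Clamping is 1-Lipschitz in each coordinate; hence extended functions keep their Hölder
    constants. *)
Lemma enorm_clamp x y : enorm (clamp x - clamp y) <= enorm (x - y).
Proof.
apply: enorm_le_diff => i; rewrite !mxE.
have H (a b : R) : a <= b ->
    0 <= Num.max 0 (Num.min 1 b) - Num.max 0 (Num.min 1 a) <= b - a.
  move=> ab; rewrite /Order.max /Order.min.
  by repeat case: ifPn; rewrite -?leNgt => *; apply/andP; split; lra.
have [/H|/ltW/H] := leP (x ord0 i) (y ord0 i) => /andP[c0 cab].
  by rewrite distrC (ger0_norm c0) distrC (le_trans cab)// ler_norm.
by rewrite (ger0_norm c0) (le_trans cab)// ler_norm.
Qed.

End clamping.

Section bernstein_derivatives_converge.
Context {R : realType} {d : nat}.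
Local Notation E := 'rV[R]_d.

Lemma sum_coord_sqr_bprod N (x : E) : (0 < N)%N -> enlarged_cube x ->
  \sum_(k : {ffun 'I_d -> 'I_N.+1}) bprod k x *
    (\sum_i (bnode (k i) - x ord0 i) ^+ 2) <= 3 * d%:R / N%:R.
Proof.
move=> N0 xQ; under eq_bigr do rewrite mulr_sumr.
rewrite exchange_big/=.
apply: (@le_trans _ _ (\sum_(i < d) 3 / N%:R)).
  apply: ler_sum => i _; under eq_bigr do rewrite mulrC.
  rewrite (sum_bprod_marginal i (fun j => (bnode j - x ord0 i) ^+ 2)).
  under eq_bigr do rewrite mulrC.
  rewrite sum_bweight_var// ler_wpM2r ?invr_ge0//.
  by have := xQ i; nra.
by rewrite sumr_const card_ord -[leLHS]mulr_natr mulrAC.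
Qed.

(** A derivative of the weights costs a factor [N], which the variance O(1/N) merely balances; the
    fourth moment O(1/N^2) beats it, as nodes far from [x] require. *)
Lemma sum_coord_exp4_bprod N (x : E) : (0 < N)%N -> enlarged_cube x ->
  \sum_(k : {ffun 'I_d -> 'I_N.+1}) bprod k x *
    (\sum_i (bnode (k i) - x ord0 i) ^+ 4) <= 81 * d%:R / N%:R ^+ 2.
Proof.
move=> N0 xQ; under eq_bigr do rewrite mulr_sumr.
rewrite exchange_big/=.
apply: (@le_trans _ _ (\sum_(i < d) 81 / N%:R ^+ 2)).
  apply: ler_sum => i _; under eq_bigr do rewrite mulrC.
  rewrite (sum_bprod_marginal i (fun j => (bnode j - x ord0 i) ^+ 4)).
  under eq_bigr do rewrite mulrC.
  by rewrite sum_bweight_kurtosis//; exact: (enlarged_cube_node xQ i).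
by rewrite sumr_const card_ord -[leLHS]mulr_natr mulrAC.
Qed.

Lemma differentiable_expansion (f : E -> R) x : differentiable f x ->
  forall e : R, 0 < e -> exists2 r : R, 0 < r & forall y, `|y - x| < r ->
  `|f y - f x - \sum_i (y ord0 i - x ord0 i) * partial i f x| <= e * `|y - x|.
Proof.
move=> df e e0; have := diff_locally df; set k := 'o _ => fE.
have /(littleoP [littleo of k]) /nbhs_ballP[r r0 Hr] := e0.
exists r => // y yr.
have fy : f y = f x + 'd f x (y - x) + k (y - x).
  by have := congr1 (fun g : E -> R => g (y - x)) fE; rewrite /= subrK.
have -> : \sum_i (y ord0 i - x ord0 i) * partial i f x = 'd f x (y - x).
  rewrite -deriveE// derive_sum_partial//.
  by apply: eq_bigr => i _; rewrite !mxE.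
rewrite (_ : _ - _ - _ = k (y - x)); last by rewrite fy; ring.
by apply: Hr; rewrite -ball_normE/= sub0r normrN.
Qed.

(* A pointwise statement: [f] is only differentiable at [x], with gradient [c],
   since clamped functions need not be smooth elsewhere. *)
Lemma partial_bern_approx (f : E -> R) (c : 'I_d -> R) (x : E) (M : R) j :
  (forall e : R, 0 < e -> exists2 r : R, 0 < r & forall y, `|y - x| < r ->
    `|f y - f x - \sum_i (y ord0 i - x ord0 i) * c i| <= e * `|y - x|) ->
  enlarged_cube x -> (forall y, `|f y - f x| <= M) ->
  forall e : R, 0 < e -> exists C, forall N, (0 < N)%N ->
    `|partial j (bern N f) x - c j| <= e + C / N%:R.
Proof.
move=> fc xQ fM e0 e0p; set e := e0 / (1 + 3 * d%:R).
have D0 : 0 < 1 + 3 * d%:R :> R by rewrite ltr_wpDr ?mulr_ge0.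
have e1 : 0 < e by rewrite divr_gt0.
have [r r0 Hr] := fc e e1.
pose rem y := f y - f x - \sum_i (y ord0 i - x ord0 i) * c i.
pose M2 := M + \sum_i 3 * `|c i|.
have M20 : 0 <= M2.
  by rewrite addr_ge0 ?(le_trans _ (fM x))// sumr_ge0// => i _; rewrite mulr_ge0.
exists (3 * M2 * (81 * d%:R) / r ^+ 4) => N N0.
have Nr0 : 0 < N%:R :> R by rewrite ltr0n.
(* The operator reproduces affine functions and their gradients, so the error only sees the
   first-order remainder [rem]. *)
have -> : partial j (bern N f) x - c j =
    \sum_(k : {ffun 'I_d -> 'I_N.+1}) rem (bpoint k) * partial j (bprod k) x.
  rewrite /rem; under [RHS]eq_bigr do rewrite !mulrBl.
  rewrite !sumrB -partial_bern// -mulr_sumr sum_partial_bprod mulr0 subr0.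
  congr (_ - _); under [RHS]eq_bigr do rewrite mulr_suml.
  rewrite exchange_big/= (bigD1 j)//= [X in _ + X]big1 => [|i ij].
    rewrite addr0; under eq_bigr do rewrite mxE mulrAC mulrBl.
    by rewrite -mulr_suml sumrB -mulr_sumr sum_partial_bprod_node// eqxx
      sum_partial_bprod mulr0 subr0 mul1r.
  under eq_bigr do rewrite mxE mulrAC mulrBl.
  by rewrite -mulr_suml sumrB -mulr_sumr sum_partial_bprod_node// (negPf ij)
    sum_partial_bprod mulr0 subr0 mul0r.
have z3 (k : {ffun 'I_d -> 'I_N.+1}) i : `|bnode (k i) - x ord0 i| <= 3.
  have := enlarged_cube_node xQ i; rewrite /bnode ler_norml.
  pose t : R := (k i)%:R / N%:R; have /andP[t0 t1] : 0 <= t <= 1.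
    by apply/andP; split; rewrite ?divr_ge0// ler_pdivrMr// mul1r ler_nat -ltnS.
  by rewrite -mulrA -/t; lra.
have x12 := enlarged_cube_node xQ.
have c0 : 0 <= 3 * M2 / r ^+ 4.
  by apply: divr_ge0; [exact: mulr_ge0|exact/exprn_ge0/ltW].
rewrite (le_trans (ler_norm_sum _ _ _))//.
pose S2 (k : {ffun 'I_d -> 'I_N.+1}) := \sum_i (bnode (k i) - x ord0 i) ^+ 2.
pose S4 (k : {ffun 'I_d -> 'I_N.+1}) := \sum_i (bnode (k i) - x ord0 i) ^+ 4.
apply: (@le_trans _ _ (\sum_(k : {ffun 'I_d -> 'I_N.+1})
    (N%:R * e * (bprod k x * S2 k) +
     N%:R * (3 * M2 / r ^+ 4) * (bprod k x * S4 k)))).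
  apply: ler_sum => k _; rewrite normrM.
  have b0 := bprod_ge0 k x12.
  set z := `|bpoint k - x|.
  have zi i : `|bnode (k i) - x ord0 i| <= z.
    rewrite /z [leRHS]/Num.Def.normr/= mx_normrE.
    apply: le_trans; last exact: (le_bigmax _ _ (ord0, i)).
    by rewrite /= !mxE.
  have zE : z = 0 \/ exists i, z = `|bnode (k i) - x ord0 i|.
    have [z0|z0] := eqVneq z 0; [by left|right].
    have [[i0 i] e4] := mx_norm_neq0 z0.
    by exists i; rewrite /z /Num.Def.normr/= e4 !mxE ord1.
  have S20 : 0 <= S2 k by apply: sumr_ge0 => i _; rewrite sqr_ge0.
  have S40 : 0 <= S4 k by apply: sumr_ge0 => i _; rewrite exprn_even_ge0.
  apply: (@le_trans _ _ (`|rem (bpoint k)| *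
      (N%:R * (bprod k x * `|bnode (k j) - x ord0 j|)))).
    by rewrite ler_wpM2l// partial_bprod_le.
  (* Near nodes have remainder at most [e * z], and the variance is enough. At far nodes the
     remainder is only bounded by [M2], but 1 <= z^4 / r^4 brings in the fourth moment. *)
  have [zr|rz] := ltP z r.
    apply: (@le_trans _ _ (N%:R * e * (bprod k x * S2 k))); last first.
      by rewrite lerDl; apply: mulr_ge0; apply: mulr_ge0.
    rewrite mulrCA -mulrA ler_wpM2l// mulrCA [leRHS]mulrCA ler_wpM2l//.
    apply: (@le_trans _ _ (e * z * z)).
      by apply: ler_pM; [exact: normr_ge0|exact: normr_ge0|exact: Hr|exact: zi].
    rewrite -mulrA ler_wpM2l ?(ltW e1)//.
    case: zE => [->|[i ->]]; first by rewrite mul0r.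
    rewrite -expr2 real_normK ?num_real//.
    by rewrite /S2 (bigD1 i)//= lerDl sumr_ge0// => l _; rewrite sqr_ge0.
  apply: (@le_trans _ _ (N%:R * (3 * M2 / r ^+ 4) * (bprod k x * S4 k))); last first.
    by rewrite lerDr; apply: mulr_ge0; apply: mulr_ge0 => //; exact: ltW.
  rewrite mulrCA -mulrA ler_wpM2l// mulrCA [leRHS]mulrCA ler_wpM2l//.
  have remM : `|rem (bpoint k)| <= M2.
    rewrite (le_trans (ler_normB _ _))// lerD// (le_trans (ler_norm_sum _ _ _))//.
    by apply: ler_sum => i _; rewrite normrM mxE ler_wpM2r.
  apply: (@le_trans _ _ (M2 * 3)); first by apply: ler_pM; [exact: normr_ge0|exact: normr_ge0|exact: remM|exact: z3].
  rewrite (mulrC 3) -mulrA [leLHS]mulrC -[leRHS]mulrA.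
  have S4r : r ^+ 4 <= S4 k.
    apply: (@le_trans _ _ (z ^+ 4)); first by rewrite lerXn2r ?nnegrE ?(ltW r0) ?normr_ge0.
    case: zE => [->|[i ->]]; first by rewrite expr0n.
    rewrite (_ : 4 = 2 * 2)%N// exprM real_normK ?num_real// -exprM.
    by rewrite /S4 (bigD1 i)//= lerDl sumr_ge0// => l _; rewrite exprn_even_ge0.
  by rewrite [leLHS]mulrC ler_wpM2l// ler_peMr// mulrC ler_pdivlMr ?exprn_gt0// mul1r.
rewrite big_split/= -!mulr_sumr lerD//.
  apply: (@le_trans _ _ (N%:R * e * (3 * d%:R / N%:R))).
    apply: ler_wpM2l; last exact: sum_coord_sqr_bprod.
    by apply: mulr_ge0; exact: ltW.
  rewrite (_ : N%:R * e * _ = e * (3 * d%:R)); last by field; rewrite gt_eqF.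
  by rewrite /e mulrAC ler_pdivrMr// ler_wpM2l ?(ltW e0p)// lerDr.
apply: (@le_trans _ _ (N%:R * (3 * M2 / r ^+ 4) * (81 * d%:R / N%:R ^+ 2))).
  by apply: ler_wpM2l; [exact: mulr_ge0|exact: sum_coord_exp4_bprod].
rewrite le_eqVlt; apply/orP; left; apply/eqP; field.
by rewrite !gt_eqF.
Qed.

End bernstein_derivatives_converge.

(** * Testing the variation with polynomial fields *)

Section cutoff.
Context {R : realType}.

(* The simplest C^1 ramp; [is_Ck 1] is all that test fields require. *)
Definition possq (s : R) : R := (Num.max 0 s) ^+ 2.

Lemma possq_ge0 s : 0 <= possq s. Proof. exact: sqr_ge0. Qed.

Lemma possq_le0 s : s <= 0 -> possq s = 0.
Proof. by move=> s0; rewrite /possq max_l// expr0n. Qed.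

Lemma possq_expansion (s h : R) :
  `|possq (h + s) - possq s - h * (2 * Num.max 0 s)| <= h ^+ 2.
Proof.
rewrite ler_norml /possq /Order.max.
by case: ifPn; case: ifPn; rewrite -?leNgt => ? ?; apply/andP; split; nra.
Qed.

Lemma is_derive_possq (s : R) : is_derive s 1 possq (2 * Num.max 0 s).
Proof.
suff H : (fun h : R => h^-1 *: (possq (h *: (1 : R) + s) - possq s)) @ 0^' -->
    2 * Num.max 0 s.
  split; first by apply/cvg_ex; exists (2 * Num.max 0 s).
  exact: (cvg_lim _ H).
apply/cvgrPdist_le => e e0; near=> h.
have h0 : h != 0 by near: h; exact: nbhs_dnbhs_neq.
rewrite [h *: 1]mulr1 distrC [_ *: _]mulrC.
rewrite (_ : _ / h - _ = (possq (h + s) - possq s - h * (2 * Num.max 0 s)) / h).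
  rewrite normrM normfV ler_pdivrMr ?normr_gt0//.
  apply: le_trans (possq_expansion s h) _.
  rewrite -(real_normK (num_real h)) expr2 ler_wpM2r//.
  by near: h; exact: dnbhs0_le.
by field.
Unshelve. all: by end_near. Qed.

End cutoff.

Section cutoff_fields.
Context {R : realType} {d : nat}.
Local Notation E := 'rV[R]_d.

Lemma derive_comp1 (f : E -> R) (p : R -> R) dp (v x : E) : differentiable f x ->
  is_derive (f x) 1 p dp ->
  differentiable (fun y => p (f y)) x /\
  'D_v (fun y => p (f y)) x = 'D_v f x * dp.
Proof.
move=> df [dp1 dpE].
have dfp : differentiable p (f x) by exact/derivable1_diffP.
have dc : differentiable (p \o f) x by exact: differentiable_comp.
split=> //; rewrite -[LHS]/('D_v (p \o f) x) deriveE// diff_comp//=.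
by rewrite deriv1E// derive1E dpE -deriveE.
Qed.

(** A coordinate at distance 1/2 from [0, 1] contributes 1/4; the factor 4 thus brings the gap to 0
    or below off [enlarged_cube], while it is 1 on the cube. *)
Definition gap (x : E) : R :=
  1 - 4 * \sum_i (possq (- x ord0 i) + possq (x ord0 i - 1)).

(** The second squared ramp cuts the gap off at 0 without leaving C^1. *)
Definition cutoff (x : E) : R := possq (gap x).

Let sgap (x : E) i := possq (- x ord0 i) + possq (x ord0 i - 1).

Let dsgap (v x : E) i :=
  - v ord0 i * (2 * Num.max 0 (- x ord0 i)) + v ord0 i * (2 * Num.max 0 (x ord0 i - 1)).

Let sgap_derive (v x : E) i :
  differentiable (fun y => sgap y i) x /\ 'D_v (fun y => sgap y i) x = dsgap v x i.
Proof.
have dc : differentiable (fun y : E => y ord0 i) x by exact: differentiable_coord.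
have dN : differentiable (fun y : E => - y ord0 i) x by exact: differentiableN.
have dB : differentiable (fun y : E => y ord0 i - 1) x.
  by apply: differentiableB => //; exact: differentiable_cst.
have [d1 e1] := derive_comp1 v dN (is_derive_possq (- x ord0 i)).
have [d2 e2] := derive_comp1 v dB (is_derive_possq (x ord0 i - 1)).
split; first exact: differentiableD.
rewrite /sgap deriveD; [|exact: diff_derivable|exact: diff_derivable].
rewrite e1 e2 /dsgap deriveN; last exact: diff_derivable.
rewrite deriveB; [|exact: diff_derivable|exact: derivable_cst].
by rewrite derive_cst subr0 derive_coord.
Qed.

Lemma gap_derive (v x : E) : differentiable gap x /\
  'D_v gap x = - 4 * \sum_i dsgap v x i.
Proof.
have dS : differentiable (\sum_i (fun y => sgap y i)) x.
  by apply: differentiable_sum => i; have [] := sgap_derive 0 x i.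
have e : gap = cst 1 - 4 *: (\sum_i (fun y => sgap y i)).
  by apply/funext => y; rewrite /gap -[RHS]/(1 - 4 * (\sum_i (fun y => sgap y i)) y) fct_sumE.
have dS4 : differentiable (4 *: (\sum_i (fun y => sgap y i))) x by exact: differentiableZ.
split; first by rewrite e; apply: differentiableB => //; exact: differentiable_cst.
rewrite e deriveB; [|exact: derivable_cst|exact: diff_derivable].
rewrite derive_cst sub0r deriveZ; last exact: diff_derivable.
rewrite derive_sum => [|i]; last by apply: diff_derivable; have [] := sgap_derive v x i.
rewrite mulNr; congr (- (_ * _)); apply: eq_bigr => i _.
by have [_] := sgap_derive v x i.
Qed.

Lemma cutoff_derive (v x : E) : differentiable cutoff x /\
  'D_v cutoff x = (- 4 * \sum_i dsgap v x i) * (2 * Num.max 0 (gap x)).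
Proof.
have [dg eg] := gap_derive v x.
by have := derive_comp1 v dg (is_derive_possq (gap x)); rewrite eg.
Qed.

Lemma continuous_mul (f g : E -> R) : continuous f -> continuous g ->
  continuous (fun x => f x * g x).
Proof. by move=> cf cg x; exact: (continuousM (cf x) (cg x)). Qed.

Lemma continuous_add (f g : E -> R) : continuous f -> continuous g ->
  continuous (fun x => f x + g x).
Proof. by move=> cf cg x; exact: (continuousD (cf x) (cg x)). Qed.

Lemma continuous_cst (c : R) : continuous (fun _ : E => c).
Proof. by move=> x; exact: cst_continuous. Qed.

Lemma continuous_sum I (r : seq I) (f : I -> E -> R) :
  (forall i, continuous (f i)) -> continuous (fun x => \sum_(i <- r) f i x).
Proof.
move=> cf; elim: r => [|i r IH].
  by under eq_fun do rewrite big_nil; exact: continuous_cst.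
by under eq_fun do rewrite big_cons; exact: continuous_add.
Qed.

Lemma continuous_derive_cutoff (v : E) : continuous ('D_v cutoff).
Proof.
have cg : continuous gap.
  by move=> x; apply: differentiable_continuous; have [] := gap_derive 0 x.
have cmax (f : E -> R) : continuous f -> continuous (fun x => Num.max 0 (f x)).
  move=> cf x; apply: (@continuous_max _ _ (fun=> 0) f) => //.
    exact: cst_continuous.
  exact: cf.
rewrite (_ : 'D_v cutoff = fun x =>
  (- 4 * \sum_i dsgap v x i) * (2 * Num.max 0 (gap x))); last first.
  by apply/funext => x; have [] := cutoff_derive v x.
have ccoord i : continuous (fun x : E => x ord0 i) := polyfun_continuous (polyfun_coord i).
apply: continuous_mul; last first.
  by apply: continuous_mul; [exact: continuous_cst|exact: cmax].
apply: continuous_mul; first exact: continuous_cst.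
apply: continuous_sum => i; apply: continuous_add; apply: continuous_mul;
  try exact: continuous_cst; apply: continuous_mul; try exact: continuous_cst.
  apply: cmax; apply: polyfun_continuous; apply: polyfunN; exact: polyfun_coord.
apply: cmax; apply: continuous_add; [exact: ccoord|exact: continuous_cst].
Qed.

Lemma cutoff_ge0 x : 0 <= cutoff x. Proof. exact: possq_ge0. Qed.

Lemma cutoff_le1 x : cutoff x <= 1.
Proof.
have g1 : gap x <= 1.
  rewrite /gap gerBl mulr_ge0// sumr_ge0// => i _.
  by rewrite addr_ge0 ?possq_ge0.
rewrite /cutoff /possq expr_le1// ?le_max ?lexx//.
by rewrite ge_max ler01.
Qed.

Let gap_cube x : unit_cube x -> gap x = 1.
Proof.
move=> x01; rewrite /gap big1 ?mulr0 ?subr0// => i _.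
by have /andP[x0 x1] := x01 i; rewrite !possq_le0 ?addr0//; lra.
Qed.

Lemma cutoff_cube x : unit_cube x -> cutoff x = 1.
Proof.
by move=> x01; rewrite /cutoff gap_cube// /possq max_r// expr1n.
Qed.

(** The ramps have slope 0 at their thresholds, so the gradient vanishes on the closed cube, faces
    included, and the cutoff adds nothing to divergences there. *)
Lemma derive_cutoff_cube v x : unit_cube x -> 'D_v cutoff x = 0.
Proof.
move=> x01; have [_ ->] := cutoff_derive v x; rewrite big1 ?mulr0 ?mul0r// => i _.
have /andP[x0 x1] := x01 i.
by rewrite /dsgap !max_l ?mulr0 ?addr0//; lra.
Qed.

Lemma cutoff_out x : ~ enlarged_cube x -> cutoff x = 0.
Proof.
move=> xQ; apply: possq_le0.
have [i xi] : exists i, ~ (- 2^-1 <= x ord0 i <= 3 / 2).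
  by apply: contrapT => H; apply: xQ => i; apply: contrapT => xi; apply: H; exists i.
have si : 1 <= 4 * (possq (- x ord0 i) + possq (x ord0 i - 1)).
  have [x1|x1] := ltP (x ord0 i) (- 2^-1).
    have := possq_ge0 (x ord0 i - 1).
    by rewrite /possq [Num.max 0 (- _)]max_r; [nra|lra].
  have [x2|x2] := ltP (3 / 2) (x ord0 i).
    have := possq_ge0 (- x ord0 i).
    by rewrite /possq [Num.max 0 (_ - 1)]max_r; [nra|lra].
  by exfalso; apply: xi; rewrite x1 x2.
rewrite /gap subr_le0 (le_trans si)// ler_wpM2l// (bigD1 i)//= lerDl sumr_ge0// => j _.
by rewrite addr_ge0 ?possq_ge0.
Qed.

End cutoff_fields.

Section jacobian_matrix.
Context {R : realType} {d : nat}.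
Local Notation E := 'rV[R]_d.

Lemma jacobian_partial (F : E -> E) x i j :
  (forall k, differentiable (fun y => F y ord0 k) x) ->
  'J F x i j = partial i (fun y => F y ord0 j) x.
Proof.
move=> dF; rewrite /partial -derive_row// deriveEjacobian.
  by rewrite -rowE [RHS]mxE.
exact: differentiable_row.
Qed.

Lemma divergence_partial (F : E -> E) x :
  (forall k, differentiable (fun y => F y ord0 k) x) ->
  divergence F x = \sum_i partial i (fun y => F y ord0 i) x.
Proof.
by move=> dF; apply: eq_bigr => i _; rewrite jacobian_partial.
Qed.

Lemma det_jacobian (F : E -> E) x :
  (forall k, differentiable (fun y => F y ord0 k) x) ->
  \det ('J F x) = jdet (fun i y => F y ord0 i) x.
Proof.
move=> dF; rewrite /jdet -det_tr; congr (\det _); apply/matrixP => i j.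
by rewrite [LHS]mxE [RHS]mxE jacobian_partial.
Qed.

End jacobian_matrix.

Section cube_integrals.
Context {R : realType} {d : nat}.
Local Notation E := 'rV[R]_d.
Local Notation mu := (@leb R d).
Local Notation cube := (unit_cube : set (lebesgueT R d)).
Implicit Types u h : E -> R.

Lemma unit_cubeE : unit_cube = box (fun=> 0) (fun=> 1) :> set E.
Proof. by []. Qed.

Lemma measurable_unit_cube : measurable cube.
Proof. by apply: measurable_lebesgueT; exact: measurable_box. Qed.

Lemma leb_box (a b : 'I_d -> R) : (forall i, a i <= b i) ->
  mu (box a b) = (\prod_i (b i - a i))%:E.
Proof.
move=> ab; rewrite -(borel_lebesgue_box ab); apply: lebE; exact: measurable_box.
Qed.

Lemma leb_unit_cube : mu cube = 1%E.
Proof.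
rewrite unit_cubeE leb_box// big1// => i _; exact: subr0.
Qed.

Lemma measurable_polyfun_leb (D : set (lebesgueT R d)) h : polyfun h ->
  measurable_fun D (h : lebesgueT R d -> R).
Proof.
move=> ph; apply: measurable_funTS.
by apply: measurable_fun_lebesgueT => //; exact: measurable_polyfun.
Qed.

Lemma leb_is_complete : measure_is_complete mu.
Proof. exact: measure_is_complete_caratheodory. Qed.

Lemma integrable_cube_mul h u M :
  measurable_fun cube (h : lebesgueT R d -> R) ->
  (forall x, unit_cube x -> `|h x| <= M) ->
  mu.-integrable setT (EFin \o u) ->
  mu.-integrable cube (EFin \o (fun x => h x * u x)).
Proof.
move=> mh hM iu.
have iu1 : mu.-integrable cube (EFin \o u).
  by apply: integrableS iu => //; exact: measurable_unit_cube.
rewrite (_ : EFin \o _ = (EFin \o h) \* (EFin \o u))%E.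
  apply: integrableMr => //; first exact: measurable_unit_cube.
  exists M; split; first exact: num_real.
  by move=> y /ltW My x Ax; exact: le_trans (hM x Ax) My.
by apply/funext => x /=; rewrite EFinM.
Qed.

Lemma integrable_cube_polyfun h u : polyfun h ->
  mu.-integrable setT (EFin \o u) ->
  mu.-integrable cube (EFin \o (fun x => h x * u x)).
Proof.
move=> ph; have [M hM] := polyfun_box_bounded (fun=> 0) (fun=> 1) ph.
by apply: (@integrable_cube_mul _ _ M) => //; exact: measurable_polyfun_leb.
Qed.

End cube_integrals.

Section bv_divergence.
Context {R : realType} {d : nat}.
Local Notation E := 'rV[R]_d.
Local Notation mu := (@leb R d).
Local Notation cube := (unit_cube : set (lebesgueT R d)).

Lemma compact_enlarged_cube : compact (enlarged_cube : set E).
Proof.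
have C : compact [set v : E | forall i, v ord0 i \in `[- 2^-1, 3 / 2]].
  apply: (@rV_compact _ _ (fun=> `[(- 2^-1 : R), (3 / 2 : R)]%classic)).
  by move=> _; exact: segment_compact.
rewrite (_ : enlarged_cube = [set v : E | forall i, v ord0 i \in `[- 2^-1, 3 / 2]])//.
Qed.

Definition cutoff_field (c : R) (v : 'I_d -> E -> R) (x : E) : E :=
  \row_k (c * (cutoff x * v k x)).

Variables (v : 'I_d -> E -> R).
Hypothesis pv : forall k, polyfun (v k).

Let dcomp c k x : differentiable (fun y => cutoff_field c v y ord0 k) x /\
  forall w, 'D_w (fun y => cutoff_field c v y ord0 k) x =
    c * (cutoff x * 'D_w (v k) x + v k x * 'D_w cutoff x).
Proof.
have -> : (fun y => cutoff_field c v y ord0 k) = c *: (cutoff * v k).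
  by apply/funext => y; rewrite mxE.
have dc : differentiable cutoff x by have [] := cutoff_derive 0 x.
have dv : differentiable (v k) x by exact: polyfun_differentiable.
have dcv : differentiable (cutoff * v k) x by exact: differentiableM.
split=> [|w]; first exact: differentiableZ.
rewrite deriveZ; last exact: diff_derivable.
by rewrite deriveM//; exact: diff_derivable.
Qed.

(** The coordinatewise bound 1/d absorbs the factor [d] of [enorm_le_coord]; the support lies in
    [enlarged_cube], where alone [v] has to be bounded. *)
Lemma test_field_cutoff c : (0 <= c) ->
  (forall x k, enlarged_cube x -> c * `|v k x| <= d%:R^-1) ->
  test_field (cutoff_field c v).
Proof.
move=> c0 cv; split.
- split=> [x|w].
    by apply: differentiable_row => k; have [] := dcomp c k x.
  apply: continuous_row => k.
  rewrite (_ : (fun x => _) = fun x =>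
      c * (cutoff x * 'D_w (v k) x + v k x * 'D_w cutoff x)).
    apply: continuous_mul; first exact: continuous_cst.
    apply: continuous_add; apply: continuous_mul.
    - by move=> x; apply: differentiable_continuous; have [] := cutoff_derive 0 x.
    - by apply: polyfun_continuous; exact: polyfun_derive.
    - exact: polyfun_continuous.
    - exact: continuous_derive_cutoff.
  apply/funext => x; rewrite derive_row => [|j]; last by have [] := dcomp c j x.
  by have [_ ->] := dcomp c k x.
- have clQ : closed (enlarged_cube : set E).
    by apply: compact_closed; [exact: norm_hausdorff|exact: compact_enlarged_cube].
  apply: (subclosed_compact (@closed_closure _ _) compact_enlarged_cube).
  rewrite [X in _ `<=` X](closure_id _).1//; apply: closure_subset => x /= wx.
  apply: contrapT => xQ; move/eqP: wx; apply; apply/rowP => k.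
  by rewrite !mxE cutoff_out// mul0r mulr0.
- move=> x; have [xQ|xQ] := pselect (enlarged_cube x); last first.
    rewrite (_ : cutoff_field c v x = 0); last first.
      by apply/rowP => k; rewrite !mxE cutoff_out// mul0r mulr0.
    by have := enorm_eq0 (0 : E); rewrite eqxx => /eqP ->.
  apply: (@le_trans _ _ (d%:R * d%:R^-1)).
    apply: enorm_le_coord => [|k]; first by rewrite invr_ge0.
    rewrite mxE (normrM c) (normrM (cutoff x)) (ger0_norm c0) (ger0_norm (cutoff_ge0 x)).
    apply: le_trans (cv x k xQ); rewrite mulrCA ler_piMl ?cutoff_le1//.
    exact: mulr_ge0.
  by have [->|d0] := eqVneq (d%:R : R) 0; rewrite ?mul0r// divff.
Qed.

Lemma divergence_cutoff c x : unit_cube x ->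
  divergence (cutoff_field c v) x = c * \sum_k partial k (v k) x.
Proof.
move=> x01; rewrite divergence_partial => [|k]; last by have [] := dcomp c k x.
rewrite mulr_sumr; apply: eq_bigr => k _; have [_ H] := dcomp c k x.
by rewrite /partial H cutoff_cube// mul1r derive_cutoff_cube// mulr0 addr0.
Qed.

(** Scaling by 1 / (d M) and cutting off turn [v] into a test field. On the cube its divergence is
    the scaled divergence of [v], and elsewhere [u] vanishes a.e. *)
Lemma bv_divergence_upper u M : bvfun u -> 0 < M ->
  (forall x k, enlarged_cube x -> `|v k x| <= M) -> (0 < d)%N ->
  Ld_functional (fun x => \sum_k partial k (v k) x) u <=
  d%:R * M * fine (rV_variation u).
Proof.
move=> [iu Vu u0] M0 vM d0.
have dr0 : 0 < d%:R :> R by rewrite ltr0n.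
set c := (d%:R * M)^-1.
have cp : 0 < c by rewrite invr_gt0 mulr_gt0.
have tw : test_field (cutoff_field c v).
  apply: test_field_cutoff => [|x k xQ]; first exact: ltW.
  rewrite /c invfM -mulrA ler_piMr ?invr_ge0 ?(ltW dr0)//.
  by rewrite mulrC ler_pdivrMr// mul1r vM.
set h := fun x => \sum_k partial k (v k) x.
have ph : polyfun h by apply: polyfun_sum => k; exact: polyfun_partial.
have ihu := integrable_cube_polyfun ph iu.
have e : \int[mu]_x (u x * divergence (cutoff_field c v) x) = c * Ld_functional h u.
  rewrite /Ld_functional -RintegralZl//; last exact: measurable_unit_cube.
  rewrite [RHS]Rintegral_mkcond; congr fine.
  set g := ((fun x => (c * (h x * u x))%R) \_ cube).
  have mg : measurable_fun setT (EFin \o g).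
    rewrite -restrict_EFin.
    apply/(measurable_restrictT _ measurable_unit_cube).
    apply/measurable_EFinP; apply: measurable_funM; first exact: measurable_cst.
    by apply/measurable_EFinP; have /integrableP[] := ihu.
  (* [u] is 0 off the cube only almost everywhere; completeness of [leb] transfers measurability
     along this equality. *)
  have ae : ae_eq mu setT (EFin \o g)
      (EFin \o (fun x => u x * divergence (cutoff_field c v) x)).
    have FF := ae_filter_ringOfSetsType (@leb R d : {measure set (lebesgueT R d) -> \bar R}).
    apply: (@filterS _ _ FF _ _ _ u0) => x {}u0 _ /=; congr EFin; rewrite /g /patch.
    case: ifPn => [/set_mem xc|/negP xc].
      by rewrite divergence_cutoff// mulrCA mulrC mulrA mulrAC mulrC mulrA.
    by rewrite u0 ?mul0r// => xc'; apply: xc; exact: mem_set.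
  have mf := ae_measurable_fun (@leb_is_complete R d) ae mg.
  apply/esym.
  refine (@ae_eq_integral _ _ _ (@leb R d : {measure set (lebesgueT R d) -> \bar R}) setT _ _ measurableT mg mf ae).
have Vle : ((c * Ld_functional h u)%:E <= rV_variation u)%E.
  by rewrite -e; apply: ereal_sup_ubound; exists (cutoff_field c v).
have Vfin : rV_variation u \is a fin_num.
  by rewrite fin_numElt Vu andbT (lt_le_trans _ Vle)// ltNyr.
have := Vle; rewrite -(fineK Vfin) lee_fin /c mulrC ler_pdivrMr ?mulr_gt0//.
by rewrite mulrC.
Qed.

End bv_divergence.

(** * Jacobian determinants tested against functions of bounded variation *)

Section functional_bounds.
Context {R : realType} {d : nat}.
Local Notation E := 'rV[R]_d.
Local Notation mu := (@leb R d).
Local Notation bl := (borel_lebesgue R d).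
Local Notation cube := (unit_cube : set (lebesgueT R d)).
Implicit Types (u : E -> R).

Lemma Ld_functionalN h u : polyfun h -> mu.-integrable setT (EFin \o u) ->
  Ld_functional (fun x => - h x) u = - Ld_functional h u.
Proof.
move=> ph iu; rewrite -mulN1r -RintegralZl.
- by apply: eq_Rintegral => x _; rewrite mulN1r mulNr.
- exact: measurable_unit_cube.
- exact: integrable_cube_polyfun.
Qed.

Lemma Ld_functionalD h1 h2 u : polyfun h1 -> polyfun h2 ->
  mu.-integrable setT (EFin \o u) ->
  Ld_functional (fun x => h1 x + h2 x) u = Ld_functional h1 u + Ld_functional h2 u.
Proof.
move=> ph1 ph2 iu; rewrite -RintegralD.
- by apply: eq_Rintegral => x _; rewrite mulrDl.
- exact: measurable_unit_cube.
- exact: integrable_cube_polyfun.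
- exact: integrable_cube_polyfun.
Qed.

Lemma Ld_functionalB h1 h2 u : polyfun h1 -> polyfun h2 ->
  mu.-integrable setT (EFin \o u) ->
  Ld_functional (fun x => h1 x - h2 x) u = Ld_functional h1 u - Ld_functional h2 u.
Proof.
by move=> ph1 ph2 iu; rewrite Ld_functionalD ?Ld_functionalN//; exact: polyfunN.
Qed.

Lemma Ld_functional0 u : Ld_functional (fun=> 0) u = 0.
Proof.
rewrite /Ld_functional (_ : (fun x => _) = fun=> 0).
  by rewrite /Rintegral integral0.
by apply/funext => x; rewrite mul0r.
Qed.

Lemma Ld_functional_sum (I : Type) (r : seq I) (h : I -> E -> R) u :
  (forall i, polyfun (h i)) -> mu.-integrable setT (EFin \o u) ->
  Ld_functional (fun x => \sum_(i <- r) h i x) u = \sum_(i <- r) Ld_functional (h i) u.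
Proof.
move=> ph iu; elim: r => [|i r IH].
  by rewrite big_nil; under eq_fun do rewrite big_nil; exact: Ld_functional0.
rewrite big_cons -IH -Ld_functionalD//; last exact: polyfun_sum.
by congr (Ld_functional _ _); apply/funext => x; rewrite big_cons.
Qed.

(* The weak form of [|Du|(R^d) <= W], tested on polynomial fields only. *)
Definition div_bounded u (W : R) := forall (v : 'I_d -> E -> R) M,
  (forall k, polyfun (v k)) -> 0 < M ->
  (forall x k, enlarged_cube x -> `|v k x| <= M) ->
  Ld_functional (fun x => \sum_k partial k (v k) x) u <= M * W.

Lemma bvfun_div_bounded u : (0 < d)%N -> bvfun u ->
  div_bounded u (d%:R * fine (rV_variation u)).
Proof.
move=> d0 bu v M pv M0 vM; rewrite mulrA [M * _]mulrC.
exact: bv_divergence_upper.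
Qed.

(** Fubini is available for the Borel product measure, whereas the functionals integrate against its
    completion. The identity map pushes the latter forward to the former. *)
Lemma integral_leb (K : set E) (h : E -> R) : measurable K -> polyfun h ->
  mu.-integrable K (EFin \o h) ->
  (\int[mu]_(x in (K : set (lebesgueT R d))) (h x)%:E =
   \int[bl]_(x in K) (h x)%:E)%E.
Proof.
move=> mK ph ih.
have mid : measurable_fun [set: lebesgueT R d] (id : lebesgueT R d -> 'rV[R]_d).
  exact: measurable_fun_lebesgueT.
have mh : measurable_fun [set: 'rV[R]_d] (EFin \o h).
  by apply/measurable_EFinP; exact: measurable_polyfun.
have := @integral_pushforward _ _ _ _ _ _ mid (@leb R d : {measure set (lebesgueT R d) -> \bar R}) K _ mh ih mK.
move=> <-; apply: eq_measure_integral => // A mA _.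
exact: lebE.
Qed.

(** Each coordinate contributes two opposite faces of area r^(d-1), by [box_partial_le]; the total
    is the perimeter of a cube of side [r]. *)
Lemma box_div_bounded (a b : 'I_d -> R) r : (0 < d)%N -> 0 < r ->
  (forall i, 0 <= a i) -> (forall i, b i <= 1) -> (forall i, b i - a i = r) ->
  div_bounded \1_(box a b) (2 * d%:R * r ^+ d.-1).
Proof.
move=> d0 r0 a0 b1 bar v M pv M0 vM.
have mK : measurable (box a b) by exact: measurable_box.
set h := fun x => \sum_k partial k (v k) x.
have ab i : a i < b i by rewrite -subr_gt0 bar.
have Kc : box a b `<=` unit_cube.
  move=> x xK i; have /andP[ax xb] := xK i.
  by rewrite (le_trans (a0 i) ax) (le_trans xb).
have ph : polyfun h by apply: polyfun_sum => k; exact: polyfun_partial.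
have blK : (bl (box a b) < +oo)%E.
  by rewrite borel_lebesgue_box ?ltry// => i; exact: ltW.
have iK (q : E -> R) : polyfun q -> bl.-integrable (box a b) (EFin \o q).
  move=> pq; have [B qB] := polyfun_box_bounded a b pq.
  apply: (bounded_integrable (M := B)) => //.
  by apply: measurable_funTS; exact: measurable_polyfun.
have mubK : (mu (box a b) < +oo)%E.
  by rewrite leb_box ?ltry// => i; exact: ltW.
have ihK : mu.-integrable (box a b : set (lebesgueT R d)) (EFin \o h).
  have [B qB] := polyfun_box_bounded a b ph.
  apply: (bounded_integrable (M := B)) => //; first exact: measurable_lebesgueT.
  exact: measurable_polyfun_leb.
have -> : Ld_functional h \1_(box a b) = fine (\int[bl]_(x in box a b) (h x)%:E).
  rewrite -integral_leb// -[X in fine (integral _ X _)](setIidr Kc).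
  rewrite -[RHS]/(\int[mu]_(x in cube `&` (box a b : set (lebesgueT R d))) h x).
  rewrite Rintegral_mkcondr; apply: eq_Rintegral => x _.
  by rewrite /patch indicE; case: ifP => _; rewrite ?mulr1 ?mulr0.
have bnd k : (`|\int[bl]_(x in box a b) (partial k (v k) x)%:E| <=
    (2 * M * r ^+ d.-1)%:E)%E.
  apply: le_trans (box_partial_le (M := M) k ab (pv k) _) _.
    by move=> x xK; apply: vM => i; have := Kc x xK i; lra.
  rewrite lee_fin ler_wpM2l ?mulr_ge0 ?(ltW M0)//.
  rewrite (eq_bigr (fun=> r)) => [|i _]; last exact: bar.
  by rewrite prodr_const cardC1 card_ord.
have : (`|\int[bl]_(x in box a b) (h x)%:E| <= (M * (2 * d%:R * r ^+ d.-1))%:E)%E.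
  under eq_integral do rewrite -sumEFin.
  rewrite integral_sum//; last by move=> k; apply: iK; exact: polyfun_partial.
  apply: le_trans (lee_abs_sum _ _ _) _.
  apply: (@le_trans _ _ (\sum_(k < d) (2 * M * r ^+ d.-1)%:E)%E).
    by apply: lee_sum => k _; exact: bnd.
  rewrite sumEFin lee_fin sumr_const card_ord -[leLHS]mulr_natr.
  by rewrite le_eqVlt; apply/orP; left; apply/eqP; ring.
have /fineK <- : (\int[bl]_(x in box a b) (h x)%:E)%E \is a fin_num.
  by apply: integrable_fin_num => //; exact: iK.
rewrite lee_fin; apply: le_trans; exact: ler_norm.
Qed.

(** [div_bounded] asks for a strictly positive field bound, while the bounds at hand may be 0; the
    slack [e] is added and then removed. *)
Lemma ler_eps_mul (x M W : R) : 0 <= W ->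
  (forall e, 0 < e -> x <= (M + e) * W) -> x <= M * W.
Proof.
move=> W0 H; apply/ler_addgt0Pr => e e0.
have W1 : 0 < W + 1 by rewrite ltr_wpDl.
apply: le_trans (H (e / (W + 1)) (divr_gt0 e0 W1)) _.
rewrite mulrDl lerD2l mulrAC ler_pdivrMr// ler_wpM2l ?(ltW e0)// lerDl//.
Qed.

(* The bound involves only the values of [f i], not its gradient. *)
Lemma jdet_functional_le u W (f : 'I_d -> E -> R) i a (b : 'I_d -> R) :
  mu.-integrable setT (EFin \o u) -> 0 <= W -> div_bounded u W ->
  (forall j, polyfun (f j)) -> (forall j, 0 <= b j) ->
  (forall x, enlarged_cube x -> `|f i x| <= a) ->
  (forall x j l, enlarged_cube x -> j != i -> `|partial l (f j) x| <= b j) ->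
  `|Ld_functional (jdet f) u| <= d`!%:R * a * \prod_(j | j != i) b j * W.
Proof.
move=> iu W0 uW pf b0 fa fb.
set P := \prod_(j | j != i) b j; set M := d`!%:R * a * P.
have P0 : 0 <= P by apply: prodr_ge0.
have a0 : 0 <= a.
  apply: le_trans (fa 0 _); first exact: normr_ge0.
  by move=> j; rewrite mxE; lra.
have M0 : 0 <= M by rewrite !mulr_ge0.
pose v k x := f i x * jcof f i k x.
have pv k : polyfun (v k) by apply: polyfunM => //; exact: polyfun_jcof.
have vM x k : enlarged_cube x -> `|v k x| <= M.
  move=> xQ; rewrite normrM (_ : M = a * (d`!%:R * P)); last by rewrite /M; ring.
  apply: ler_pM; [exact: normr_ge0|exact: normr_ge0|exact: fa|].
  by apply: jcof_le => j l ji; exact: fb.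
have jE : jdet f = fun x => \sum_k partial k (v k) x.
  by apply/funext => x; exact: jdet_divergence.
have ub : Ld_functional (jdet f) u <= M * W.
  apply: ler_eps_mul => // e e0; rewrite jE; apply: uW => //.
    by rewrite ltr_wpDl.
  by move=> x k xQ; rewrite (le_trans (vM x k xQ))// lerDl ltW.
(* The lower bound is the upper bound for the opposite field. *)
have lb : - Ld_functional (jdet f) u <= M * W.
  apply: ler_eps_mul => // e e0; rewrite -Ld_functionalN//; last exact: polyfun_jdet.
  rewrite (_ : (fun x => - _) = fun x => \sum_k partial k (fun y => - v k y) x).
    apply: uW => [k||x k xQ]; first exact: polyfunN.
      by rewrite ltr_wpDl.
    by rewrite normrN (le_trans (vM x k xQ))// lerDl ltW.
  apply/funext => x; rewrite jE -sumrN; apply: eq_bigr => k _.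
  by rewrite /partial deriveN//; exact: polyfun_derivable.
by rewrite ler_norml ub lerNl lb.
Qed.

Lemma jdet_functional_sub_le u W (f g : 'I_d -> E -> R) a (b : 'I_d -> R) :
  mu.-integrable setT (EFin \o u) -> 0 <= W -> div_bounded u W ->
  (forall j, polyfun (f j)) -> (forall j, polyfun (g j)) -> (forall j, 0 <= b j) ->
  (forall x j, enlarged_cube x -> `|f j x - g j x| <= a j) ->
  (forall x j l, enlarged_cube x -> `|partial l (f j) x| <= b j) ->
  (forall x j l, enlarged_cube x -> `|partial l (g j) x| <= b j) ->
  `|Ld_functional (jdet f) u - Ld_functional (jdet g) u| <=
  \sum_i d`!%:R * a i * (\prod_(j | j != i) b j) * W.
Proof.
move=> iu W0 uW pf pg b0 fga fb gb.
have pm i j : polyfun (jmix f g i j).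
  by rewrite /jmix; case: ifP => // _; case: ifP => // _; exact: polyfunB.
rewrite -Ld_functionalB//; [|exact: polyfun_jdet|exact: polyfun_jdet].
rewrite (_ : (fun x => _) = fun x => \sum_i jdet (jmix f g i) x); last first.
  by apply/funext => x; exact: jdetB.
rewrite Ld_functional_sum// => [|i]; last exact: polyfun_jdet.
rewrite (le_trans (ler_norm_sum _ _ _))//; apply: ler_sum => i _.
apply: jdet_functional_le => //.
  by move=> x xQ; rewrite /jmix ltnn eqxx; exact: fga.
move=> x j l xQ ji; rewrite /jmix (negPf ji); case: ifP => _; [exact: fb|exact: gb].
Qed.

End functional_bounds.

(** * Borel measurability, extension from the cube, geometric series *)

Section continuous_measurable.
Context {R : realType} {d : nat}.
Local Notation E := 'rV[R]_d.

(** Each point of an open set has a rational box around it inside the set, a ball of the sup norm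
    being a box, and there are countably many rational boxes. *)
Lemma open_measurable_rV (O : set E) : open O -> measurable O.
Proof.
move=> oO.
pose B (p : {ffun 'I_d -> rat} * {ffun 'I_d -> rat}) : set E :=
  box (fun i => ratr (p.1 i)) (fun i => ratr (p.2 i)).
pose F p := if `[< B p `<=` O >] then B p else set0.
rewrite (_ : O = \bigcup_(p in setT) F p).
  apply: countable_bigcupT_measurable; first exact: countableP.
  move=> p; rewrite /F.
  by case: ifP => _ //; exact: measurable_box.
apply/seteqP; split => [x Ox|x [p _]]; last by rewrite /F; case: asboolP => [|_ []]; exact.
have /nbhs_ballP[r /= r0 rO] := oO x Ox.
have ra i : {q : rat | x ord0 i - r < ratr q < x ord0 i}.
  have /rat_in_itvoo/cid[q] : x ord0 i - r < x ord0 i by rewrite ltrBlDr ltrDl.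
  by rewrite in_itv => qi; exists q.
have rb i : {q : rat | x ord0 i < ratr q < x ord0 i + r}.
  have /rat_in_itvoo/cid[q] : x ord0 i < x ord0 i + r by rewrite ltrDl.
  by rewrite in_itv => qi; exists q.
exists ([ffun i => sval (ra i)], [ffun i => sval (rb i)]) => //.
rewrite /F; case: asboolP => [_ i|].
  rewrite !ffunE; case: (ra i) => a /= /andP[_ /ltW ->].
  by case: (rb i) => b /= /andP[/ltW ->].
move=> nBO; exfalso; apply: nBO => y yB; apply: rO; rewrite -ball_normE/=.
rewrite /Num.Def.normr/= mx_normrE; apply: bigmax_lt => // -[i0 i] _.
rewrite !mxE/= ord1; have := yB i; rewrite /= !ffunE.
case: (ra i) => a /= /andP[xa _]; case: (rb i) => b /= /andP[_ xb] /andP[ay yb].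
by rewrite ltr_norml; apply/andP; split; lra.
Qed.

Lemma continuous_measurable_rV (f : E -> R) : continuous f ->
  measurable_fun [set: E] f.
Proof.
move=> cf; apply: (measurability _ (RGenOInfty.measurableE R)) => //.
move=> /= _ [_ [a ->] <-]; rewrite setTI.
by apply: open_measurable_rV; apply: open_comp => // x _; exact: cf.
Qed.

End continuous_measurable.

Section cube_functions.
Context {R : realType} {d : nat}.
Local Notation E := 'rV[R]_d.
Implicit Types (g : @unit_cube R d -> R).

Definition squeeze (x : E) : @unit_cube R d :=
  exist _ (clamp x) (mem_set (clamp_cube x)).

Definition ext g (x : E) : R := g (squeeze x).

Lemma ext_val g (v : @unit_cube R d) : ext g (val v) = g v.
Proof.
by congr g; apply: val_inj => /=; apply: clampK; exact: set_mem (valP v).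
Qed.

Lemma Lip_fine_ge0 beta g : 0 <= fine (Lip beta g).
Proof.
rewrite /Lip; set S := [set _ | _].
(* An empty family of quotients has supremum -oo, whose [fine] is 0. *)
have [[r Sr]|/set0P/negP/negPn/eqP ->] := pselect (S !=set0); last by rewrite ereal_sup0.
apply: fine_ge0; apply: le_trans (ereal_sup_ubound Sr).
by case: Sr => x [y [_ ->]]; rewrite lee_fin divr_ge0// powR_ge0.
Qed.

Lemma holder_le beta g x y : 0 < beta -> holder beta g ->
  `|g x - g y| <= fine (Lip beta g) * enorm (val x - val y) `^ beta.
Proof.
move=> b0 hg; have [->|xy] := eqVneq x y.
  by rewrite subrr normr0 mulr_ge0 ?Lip_fine_ge0 ?powR_ge0.
have e0 : 0 < enorm (val x - val y).
  rewrite lt_neqAle enorm_ge0 andbT eq_sym enorm_eq0 subr_eq0.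
  by apply: contraNneq xy => /val_inj ->.
have Sxy : ((`|g x - g y| / enorm (val x - val y) `^ beta)%:E <= Lip beta g)%E.
  by apply: ereal_sup_ubound; exists x, y.
have Lfin : Lip beta g \is a fin_num.
  by rewrite fin_numElt (lt_le_trans (ltNyr _) Sxy).
by move: Sxy; rewrite -{1}(fineK Lfin) lee_fin ler_pdivrMr ?powR_gt0.
Qed.

Lemma holder_ext beta g : 0 < beta -> holder beta g ->
  holder_on_space (fine (Lip beta g)) beta (ext g).
Proof.
move=> b0 hg x y; apply: le_trans (holder_le _ _ b0 hg) _.
apply: ler_wpM2l; first exact: Lip_fine_ge0.
apply: ge0_ler_powR; [exact: ltW|by rewrite nnegrE enorm_ge0
  |by rewrite nnegrE enorm_ge0|exact: enorm_clamp].
Qed.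

Lemma Lip_le beta g C : (forall x y, `|g x - g y| <= C * enorm (val x - val y) `^ beta) ->
  (Lip beta g <= C%:E)%E.
Proof.
move=> gC; apply: ge_ereal_sup => _ [x [y [xy ->]]].
have e0 : 0 < enorm (val x - val y).
  rewrite lt_neqAle enorm_ge0 andbT eq_sym enorm_eq0 subr_eq0.
  by apply: contraNneq xy => /val_inj ->.
by rewrite lee_fin ler_pdivrMr ?powR_gt0.
Qed.

End cube_functions.

Section geometric_sequences.
Context {R : realType}.

Lemma geometric_cauchy (x : nat -> R) (A q : R) : 0 <= q < 1 ->
  (forall n, `|x n.+1 - x n| <= A * q ^+ n) ->
  cvgn x /\ forall n, `|limn x - x n| <= A * q ^+ n / (1 - q).
Proof.
move=> /andP[q0 q1] xq; have q10 : 0 < 1 - q by rewrite subr_gt0.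
have A0 : 0 <= A by have := le_trans (normr_ge0 _) (xq 0%N); rewrite expr0 mulr1.
have cs : cvgn (series (fun n => x n.+1 - x n)).
  apply: normed_cvg; apply: (series_le_cvg (v_ := geometric A q)) => [n|n|n|].
  - exact: normr_ge0.
  - by rewrite /geometric/= mulr_ge0// exprn_ge0.
  - exact: xq.
  - by apply: is_cvg_geometric_series; rewrite ger0_norm.
have xE : x = (fun n => series (fun n => x n.+1 - x n) n + x 0%N).
  by apply/funext => n; rewrite /series/= telescope_sumr// subrK.
have cx : cvgn x by rewrite xE; apply: is_cvgD => //; exact: is_cvg_cst.
split=> // n.
have tail k : `|x (n + k)%N - x n| <= A * q ^+ n / (1 - q).
  (* The induction on [k] closes for the finite geometric sum, not for its limit. *)
  apply: (@le_trans _ _ (A * q ^+ n * ((1 - q ^+ k) / (1 - q)))); last first.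
    rewrite ler_wpM2l ?mulr_ge0 ?exprn_ge0// ler_piMl ?invr_ge0 ?(ltW q10)//.
    by rewrite gerBl exprn_ge0.
  elim: k => [|k IH]; first by rewrite addn0 subrr normr0 expr0 subrr mul0r mulr0.
  rewrite addnS -(subrKA (x (n + k)%N)) (le_trans (ler_normD _ _))//.
  apply: le_trans (lerD (xq (n + k)%N) IH) _.
  rewrite le_eqVlt; apply/orP; left; apply/eqP; rewrite exprD exprS.
  by field; rewrite gt_eqF.
have cn : (`|x m - x n|) @[m --> \oo] --> `|limn x - x n|.
  by apply: cvg_norm; apply: cvgB => //; exact: cvg_cst.
apply: (cvgr_to_le cn); exists n => // m /= nm.
by rewrite -(subnKC nm); exact: tail.
Qed.

End geometric_sequences.

(** * Variation and dual norms *)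

Section variation.
Context {R : realType} {d : nat}.
Local Notation E := 'rV[R]_d.
Local Notation mu := (@leb R d).
Local Notation cube := (unit_cube : set (lebesgueT R d)).
Implicit Types (u : E -> R) (B : set E).

Lemma continuous_cube_bounded (f : E -> R) : continuous f ->
  exists M, forall x, unit_cube x -> `|f x| <= M.
Proof.
move=> cf.
have C : compact (unit_cube : set E).
  have C : compact [set v : E | forall i, v ord0 i \in `[0, 1]].
    apply: (@rV_compact _ _ (fun=> `[(0 : R), (1 : R)]%classic)).
    by move=> _; exact: segment_compact.
  by rewrite (_ : unit_cube = [set v : E | forall i, v ord0 i \in `[0, 1]]).
have C0 : (unit_cube : set E) !=set0.
  by exists 0 => i; rewrite mxE lexx ler01.
have cn : continuous (fun x => `|f x|).
  by move=> x; apply: continuous_comp; [exact: cf|exact: norm_continuous].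
have [c _ H] := EVT_max_rV C0 C (continuous_subspaceT cn).
by exists `|f c| => x xc; apply: H; exact: mem_set.
Qed.

Lemma continuous_coord_derive (G : E -> E) : is_Ck 1 G ->
  forall v i, continuous (fun x => 'D_v G x ord0 i).
Proof.
move=> [dG cG] v i x.
have c : {for x, continuous ('D_v G)} by exact: cG.
exact: (continuous_comp c (@coord_continuous _ _ _ ord0 i ('D_v G x))).
Qed.

Lemma jacobian_derive (G : E -> E) x i j : differentiable G x ->
  'J G x i j = 'D_(delta_mx ord0 i) G x ord0 j.
Proof. by move=> dG; rewrite deriveEjacobian// -rowE [RHS]mxE. Qed.

Lemma continuous_divergence (G : E -> E) : is_Ck 1 G -> continuous (divergence G).
Proof.
move=> G1; have [dG _] := G1.
rewrite (_ : divergence G = fun x => \sum_i 'D_(delta_mx ord0 i) G x ord0 i).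
  by apply: continuous_sum => i; exact: continuous_coord_derive.
by apply/funext => x; apply: eq_bigr => i _; rewrite jacobian_derive.
Qed.

Lemma rV_variation_ge0 u : (0 <= rV_variation u)%E.
Proof.
have t0 : test_field (cutoff_field 0 (fun _ (_ : E) => 0 : R)).
  apply: test_field_cutoff => // [k|x k _]; first exact: polyfun_cst.
  by rewrite mul0r invr_ge0.
apply: (le_trans _ (ereal_sup_ubound _)); last by exists (cutoff_field 0 (fun _ (_ : E) => 0 : R)).
rewrite lee_fin (_ : \int[mu]_x _ = 0)// /Rintegral.
rewrite (_ : (fun x => _) = cst 0%E) ?integral0//.
apply/funext => x; rewrite (_ : divergence _ _ = 0) ?mulr0//.
have -> : cutoff_field 0 (fun _ (_ : E) => 0 : R) = fun=> 0.
  by apply/funext => y; apply/rowP => k; rewrite !mxE mul0r.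
rewrite divergence_partial => [|k]; last first.
  by under eq_fun do rewrite mxE; exact: differentiable_cst.
by rewrite big1// => i _; under eq_fun do rewrite mxE; exact: partial_cst.
Qed.

Lemma variation_fin u : (rV_variation u < +oo)%E ->
  rV_variation u = (fine (rV_variation u))%:E.
Proof.
by move=> Vu; rewrite fineK// fin_numElt Vu (lt_le_trans _ (rV_variation_ge0 u)).
Qed.

Lemma fine_variation_ge0 u : 0 <= fine (rV_variation u).
Proof. exact/fine_ge0/rV_variation_ge0. Qed.

Lemma variation0 : (rV_variation (fun _ : E => 0%R : R) <= 0)%E.
Proof.
apply: ge_ereal_sup => _ [v _ <-]; rewrite lee_fin (_ : \int[mu]_x _ = 0)//.
rewrite /Rintegral (_ : (fun x => _) = cst 0%E) ?integral0//.
by apply/funext => x; rewrite mul0r.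
Qed.

Lemma bvfun0 : bvfun ((fun=> 0) : E -> R).
Proof.
split; first exact: integrable0.
- exact: le_lt_trans variation0 (ltry _).
- by apply: aeW.
Qed.

Lemma leb_subcube B : measurable (B : set (lebesgueT R d)) -> B `<=` unit_cube ->
  (mu B <= 1)%E.
Proof.
move=> mB BI; rewrite -(@leb_unit_cube R d); apply: le_measure => //; apply: mem_set => //.
exact: measurable_unit_cube.
Qed.

Lemma integrable_indic_cube B : measurable (B : set (lebesgueT R d)) ->
  B `<=` unit_cube -> mu.-integrable setT (EFin \o (\1_B : E -> R)).
Proof.
move=> mB BI.
have i1 : mu.-integrable (B : set (lebesgueT R d)) (EFin \o (fun=> 1)).
  apply: (bounded_integrable (M := 1)) => //.
    exact: (le_lt_trans (leb_subcube mB BI) (ltry _)).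
  by move=> x _; rewrite normr1.
rewrite (_ : EFin \o _ = (EFin \o (fun=> 1)) \_ (B : set (lebesgueT R d))).
  by apply/(integrable_mkcond _ mB).
by apply/funext => x; rewrite /patch /= indicE; case: ifP.
Qed.

Lemma bvfun_indic B : bvset_cube B -> bvfun (\1_B : E -> R).
Proof.
move=> [[_ mB VB] BI]; split => //; first exact: integrable_indic_cube.
apply: aeW => x xc; rewrite indicE memNset// => /BI; exact: xc.
Qed.

(** Used to normalise indicators. The divergence of a test field is continuous, hence bounded on the
    cube, and this gives the integrability needed to pull [t] out. *)
Lemma variation_indicZ B (t : R) : bvset_cube B -> 0 <= t ->
  (rV_variation (fun x => t * \1_B x)%R <= (t * fine (perimeter B))%:E)%E.
Proof.
move=> BB t0; have [[_ mB VB] BI] := BB.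
apply: ge_ereal_sup => _ [v tv <-]; rewrite lee_fin.
have [v1 _ _] := tv.
have cd := continuous_divergence v1.
have [M dM] := continuous_cube_bounded cd.
have mdiv : measurable_fun setT (divergence v : lebesgueT R d -> R).
  by apply: measurable_fun_lebesgueT => //; exact: continuous_measurable_rV.
have i1 : mu.-integrable setT (EFin \o (fun x => \1_B x * divergence v x)).
  have i2 : mu.-integrable cube (EFin \o (fun x => divergence v x * \1_B x)).
    apply: (integrable_cube_mul (M := M)) => //.
      exact: measurable_funTS.
    exact: integrable_indic_cube.
  rewrite (_ : EFin \o _ = (EFin \o (fun x => divergence v x * \1_B x)) \_ cube).
    by apply/(integrable_mkcond _ (@measurable_unit_cube R d)).
  apply/funext => x; rewrite /patch /=; case: ifPn => [_|/negP xc].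
    by rewrite mulrC.
  rewrite indicE memNset ?mul0r// => /BI xc'; apply: xc; exact: mem_set.
have -> : \int[mu]_x (t * \1_B x * divergence v x) =
    t * \int[mu]_x (\1_B x * divergence v x).
  rewrite -RintegralZl//; by apply: eq_Rintegral => x _; rewrite mulrA.
apply: ler_wpM2l => //.
rewrite -lee_fin -variation_fin//; apply: ereal_sup_ubound.
by exists v.
Qed.

Lemma bvfun_indicZ B (t : R) : bvset_cube B -> 0 <= t -> bvfun (fun x => t * \1_B x).
Proof.
move=> BB t0; have [i1 _ a1] := bvfun_indic BB; split.
- have := integrableZl measurableT t i1.
  by apply: eq_integrable => // x _ /=; rewrite EFinM.
- by apply: le_lt_trans (variation_indicZ BB t0) _; exact: ltry.
- have FF := ae_filter_ringOfSetsType (@leb R d : {measure set (lebesgueT R d) -> \bar R}).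
  by apply: (@filterS _ _ FF _ _ _ a1) => x H xc; rewrite H// mulr0.
Qed.

End variation.

Section dual_norms.
Context {R : realType} {d : nat}.
Local Notation E := 'rV[R]_d.
Implicit Types (l : (E -> R) -> R).

Lemma dual_norm_ge0 l : (0 <= dual_norm l)%E.
Proof.
apply: (le_trans _ (ereal_sup_ubound _)); last first.
  exists (fun=> 0) => //; split; first exact: bvfun0.
  by apply: le_trans variation0 _; rewrite lee_fin.
by rewrite lee_fin.
Qed.

Lemma dual_norm_le l C : 0 <= C ->
  (forall u, bvfun u -> `|l u| <= C * fine (rV_variation u)) ->
  (dual_norm l <= C%:E)%E.
Proof.
move=> C0 lC; apply: ge_ereal_sup => _ [u [bu V1] <-]; rewrite lee_fin.
apply: le_trans (lC u bu) _; rewrite ler_piMr// -lee_fin -variation_fin//.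
by have [] := bu.
Qed.

(** The indicator divided by perimeter plus 1 lies in the unit ball; the 1 guards against a zero
    perimeter. *)
Lemma dual_norm_indic l B D : bvset_cube B -> bv_dual l -> (dual_norm l <= D%:E)%E ->
  `|l \1_B| <= D * (fine (perimeter B) + 1).
Proof.
move=> BB [lin _] lD; set V := fine _.
have V1 : 0 < V + 1 by rewrite ltr_wpDl// fine_variation_ge0.
set t := (V + 1)^-1; have t0 : 0 <= t by rewrite invr_ge0 ltW.
have l0 : l (fun=> 0) = 0.
  have := lin 1 (fun=> 0) (fun=> 0) bvfun0 bvfun0.
  under eq_fun do rewrite mulr0 addr0.
  by move=> /eqP; rewrite mul1r -subr_eq0 opprD addrA subrr sub0r oppr_eq0 => /eqP.
have lt : l (fun x => t * \1_B x) = t * l \1_B.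
  have := lin t \1_B (fun=> 0) (bvfun_indic BB) bvfun0.
  by under eq_fun do rewrite addr0; rewrite l0 addr0.
have : (`|l (fun x => t * \1_B x)|%:E <= D%:E)%E.
  apply: le_trans lD; apply: ereal_sup_ubound; exists (fun x => t * \1_B x) => //.
  split; first exact: bvfun_indicZ.
  apply: le_trans (variation_indicZ BB t0) _; rewrite lee_fin.
  by rewrite mulrC ler_pdivrMr// mul1r lerDl.
by rewrite lee_fin lt normrM ger0_norm// mulrC ler_pdivrMr.
Qed.

Lemma strong_norm_ge0 (w : set E -> R) : (0 <= strong_norm w)%E.
Proof. by apply: le_ereal_inf_tmp => _ [l _ <-]; exact: dual_norm_ge0. Qed.

Lemma cvge0P (f : nat -> \bar R) : (forall n, 0 <= f n)%E ->
  f @ \oo --> 0%E <->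
  forall e : R, 0 < e -> \forall n \near \oo, (f n < e%:E)%E.
Proof.
move=> f0; split=> [cf e e0|H].
  by apply: (cf [set u | (u < e%:E)%E]); apply: open_ereal_lt'; rewrite lte_fin.
apply/fine_cvgP; split.
  apply: filterS (H 1 ltr01) => n fn.
  by rewrite fin_numElt (lt_le_trans _ (f0 n))//= (lt_trans fn (ltry _)).
apply/cvgrPdist_le => e e0; apply: filterS (H e e0) => n fn.
have fin : f n \is a fin_num.
  by rewrite fin_numElt (lt_le_trans _ (f0 n))//= (lt_trans fn (ltry _)).
by rewrite sub0r normrN ger0_norm ?fine_ge0//= -lee_fin fineK// ltW.
Qed.

(** Some representing functional has norm close to the infimum, and it bounds the value at [B] by
    [dual_norm_indic]. *)
Lemma strong_norm_cvg0 (w_ : nat -> set E -> R) B : bvset_cube B ->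
  strong_norm (w_ p) @[p --> \oo] --> 0%E -> w_ p B @[p --> \oo] --> 0.
Proof.
move=> BB /cvge0P H; set V := fine (perimeter B) + 1.
have V1 : 0 < V by rewrite ltr_wpDl// fine_variation_ge0.
apply/cvgrPdist_le => e e0.
have eV : 0 < e / V by exact: divr_gt0.
apply: filterS (H (fun=> strong_norm_ge0 _) _ eV) => p wp.
have [_ [l [bl _ wl] <-] le] := ereal_inf_lt wp.
rewrite sub0r normrN wl//; apply: le_trans (dual_norm_indic BB bl (ltW le)) _.
by rewrite -/V divfK ?gt_eqF.
Qed.

End dual_norms.

(** * Polynomial densities as functionals and as set functions *)

Section functionals_of_u.
Context {R : realType} {d : nat}.
Local Notation E := 'rV[R]_d.
Local Notation mu := (@leb R d).
Local Notation cube := (unit_cube : set (lebesgueT R d)).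
Implicit Types (u h : E -> R) (B : set E).

Lemma Ld_functional_linear h a u v : polyfun h ->
  mu.-integrable setT (EFin \o u) -> mu.-integrable setT (EFin \o v) ->
  Ld_functional h (fun x => a * u x + v x) =
  a * Ld_functional h u + Ld_functional h v.
Proof.
move=> ph iu iv.
have ihu := integrable_cube_polyfun ph iu; have ihv := integrable_cube_polyfun ph iv.
have mc := @measurable_unit_cube R d.
rewrite /Ld_functional -RintegralZl// -RintegralD//.
  by apply: eq_Rintegral => x _; rewrite mulrDr mulrCA.
have := integrableZl mc a ihu.
by apply: eq_integrable => // x _ /=; rewrite EFinM.
Qed.

Lemma Ld_functional_le_indic h u (A : set E) M :
  polyfun h -> mu.-integrable setT (EFin \o u) ->
  measurable (A : set (lebesgueT R d)) -> (mu A < +oo)%E -> 0 <= M ->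
  (forall x, unit_cube x -> `|h x * u x| <= M * \1_A x) ->
  `|Ld_functional h u| <= M * fine (mu A).
Proof.
move=> ph iu mA Afin M0 huM.
have ihu := integrable_cube_polyfun ph iu.
have mc := @measurable_unit_cube R d.
rewrite -lee_fin EFin_normr_Rintegral// EFinM fineK; last first.
  by rewrite ge0_fin_numE.
rewrite integral_mkcond; apply: le_abse_integral_indic => //.
  apply/(measurable_restrictT _ mc).
  by have /integrableP[] := ihu.
move=> x; rewrite /patch; case: ifPn => [/set_mem xc|_].
  by rewrite /= lee_fin; exact: huM.
by rewrite /= normr0 lee_fin mulr_ge0.
Qed.

Lemma Ld_cube_polyfun h : polyfun h -> Ld_cube h.
Proof.
move=> ph; split; first exact: measurable_polyfun_leb.
have [M hM] := polyfun_box_bounded (fun=> 0) (fun=> 1) ph.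
have mh : measurable_fun cube (fun x => `|h x| ^+ d : R).
  apply: measurable_funX; apply: measurableT_comp => //.
  exact: measurable_polyfun_leb.
have cfin : (mu cube < +oo)%E by rewrite leb_unit_cube ltry.
have : mu.-integrable cube (EFin \o (fun x => `|h x| ^+ d)).
  apply: (bounded_integrable (M := M ^+ d)) => //.
  - exact: measurable_unit_cube.
  - by move=> x xc; rewrite normrX normr_id lerXn2r ?nnegrE ?hM//
      (le_trans _ (hM x xc)).
move=> /integrableP[_]; congr (_ < _)%E; apply: eq_integral => x _ /=.
by rewrite ger0_norm// exprn_ge0.
Qed.

Lemma Ld_functional_symdiff h B1 B2 M : polyfun h ->
  (forall x, unit_cube x -> `|h x| <= M) ->
  measurable (B1 : set (lebesgueT R d)) -> measurable (B2 : set (lebesgueT R d)) ->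
  B1 `<=` unit_cube -> B2 `<=` unit_cube ->
  `|Ld_functional h \1_B1 - Ld_functional h \1_B2| <=
    M * fine (mu ((B1 `\` B2) `|` (B2 `\` B1))).
Proof.
move=> ph hM m1 m2 c1 c2.
have M0 : 0 <= M.
  by apply: le_trans (hM 0 _); rewrite ?normr_ge0// => i; rewrite mxE lexx ler01.
have i1 := integrable_indic_cube m1 c1; have i2 := integrable_indic_cube m2 c2.
set A : set E := _ `|` _.
have mA : measurable (A : set (lebesgueT R d)).
  by apply: measurableU; exact: measurableD.
have Ac : A `<=` unit_cube by move=> x [[/c1]|[/c2]].
have Afin : (mu A < +oo)%E by exact: le_lt_trans (leb_subcube mA Ac) (ltry _).
have -> : Ld_functional h \1_B1 - Ld_functional h \1_B2 =
    Ld_functional h (fun x => -1 * \1_B2 x + \1_B1 x).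
  by rewrite Ld_functional_linear// mulN1r addrC.
apply: Ld_functional_le_indic => //.
  rewrite (_ : EFin \o _ = (fun x => (-1)%:E * (\1_B2 x)%:E)%E \+ (EFin \o \1_B1))%E.
    by apply: integrableD => //; exact: integrableZl.
  by apply/funext => x /=; rewrite EFinD EFinM.
move=> x xc; rewrite normrM; apply: ler_pM => //; first exact: hM.
rewrite mulN1r !indicE.
have [x1|x1] := pselect (B1 x); have [x2|x2] := pselect (B2 x);
  rewrite ?(mem_set x1) ?(memNset x1) ?(mem_set x2) ?(memNset x2) /=.
- by rewrite addNr normr0.
- by rewrite oppr0 add0r normr1 mem_set//; left.
- by rewrite addr0 normrN normr1 mem_set//; right.
- by rewrite oppr0 add0r normr0.
Qed.

(** The sum of the two indicators exceeds that of the union by the indicator of the intersection, a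
    null set. *)
Lemma Ld_functional_setU h B1 B2 : polyfun h ->
  measurable (B1 : set (lebesgueT R d)) -> measurable (B2 : set (lebesgueT R d)) ->
  B1 `<=` unit_cube -> B2 `<=` unit_cube -> mu (B1 `&` B2) = 0%E ->
  Ld_functional h \1_(B1 `|` B2) = Ld_functional h \1_B1 + Ld_functional h \1_B2.
Proof.
move=> ph m1 m2 c1 c2 m12.
have [M hM] := polyfun_box_bounded (fun=> 0) (fun=> 1) ph.
have M0 : 0 <= M.
  by apply: le_trans (hM 0 _); rewrite ?normr_ge0// => i; rewrite mxE lexx ler01.
have i1 := integrable_indic_cube m1 c1; have i2 := integrable_indic_cube m2 c2.
have m3 : measurable (B1 `|` B2 : set (lebesgueT R d)) by exact: measurableU.
have c3 : B1 `|` B2 `<=` unit_cube by move=> x [/c1|/c2].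
have i3 := integrable_indic_cube m3 c3.
have i12 : mu.-integrable setT (EFin \o (fun x => 1 * \1_B1 x + \1_B2 x : R)).
  rewrite (_ : EFin \o _ = (EFin \o \1_B1) \+ (EFin \o \1_B2))%E.
    exact: integrableD.
  by apply/funext => x /=; rewrite mul1r EFinD.
have -> : Ld_functional h \1_B1 + Ld_functional h \1_B2 =
    Ld_functional h (fun x => 1 * \1_B1 x + \1_B2 x).
  by rewrite Ld_functional_linear// mul1r.
apply/eqP; rewrite -subr_eq0 -normr_le0.
have -> : Ld_functional h \1_(B1 `|` B2) -
    Ld_functional h (fun x => 1 * \1_B1 x + \1_B2 x) =
    Ld_functional h (fun x => -1 * (1 * \1_B1 x + \1_B2 x) + \1_(B1 `|` B2) x).
  by rewrite [RHS]Ld_functional_linear// mulN1r addrC.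
have m12' : measurable (B1 `&` B2 : set (lebesgueT R d)) by exact: measurableI.
apply: (@le_trans _ _ (M * fine (mu (B1 `&` B2)))); last by rewrite m12 mulr0.
apply: Ld_functional_le_indic => //.
- rewrite (_ : EFin \o _ = (fun x => (-1)%:E * (1 * \1_B1 x + \1_B2 x)%R%:E)%E \+
     (EFin \o \1_(B1 `|` B2)))%E.
    by apply: integrableD => //; exact: integrableZl.
  by apply/funext => x /=; rewrite EFinD EFinM.
- by rewrite m12 ltry.
move=> x xc; rewrite normrM; apply: ler_pM => //; first exact: hM.
rewrite mul1r mulN1r !indicE !in_setU !in_setI.
by case: (x \in B1); case: (x \in B2);
  rewrite /= ?oppr0 ?add0r ?addr0 ?opprD ?addrNK ?addNr ?normrN ?normr1 ?normr0.
Qed.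

End functionals_of_u.

(** * Limits of polynomial densities *)

Section polyfun_limits.
Context {R : realType} {d : nat}.
Local Notation E := 'rV[R]_d.
Local Notation mu := (@leb R d).
Local Notation V u := (fine (rV_variation u)).

Definition lim_functional (h : nat -> E -> R) (u : E -> R) : R :=
  limn (fun n => Ld_functional (h n) u).

Lemma limn_linear (a : R) (x y : nat -> R) : cvgn x -> cvgn y ->
  limn (fun n => a * x n + y n) = a * limn x + limn y.
Proof.
move=> cx cy; apply: cvg_lim; first exact: Rhausdorff.
by apply: cvgD => //; exact: cvgMl_tmp.
Qed.

Lemma geometric_small (K q e : R) : 0 <= q < 1 -> 0 < e ->
  exists n, K * q ^+ n <= e.
Proof.
move=> /andP[q0 q1] e0.
have : (fun n => K * q ^+ n) @ \oo --> K * 0.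
  by apply: cvgMl_tmp; apply: cvg_expr; rewrite ger0_norm.
rewrite mulr0 => /cvgrPdist_le/(_ e e0)[N _ /(_ N (leqnn N))]; rewrite /= sub0r normrN => H.
by exists N; exact: le_trans (ler_norm _) H.
Qed.

Variables (h : nat -> E -> R) (A q C0 : R).
Hypotheses (ph : forall n, polyfun (h n)) (q01 : 0 <= q < 1) (A0 : 0 <= A)
  (C00 : 0 <= C0)
  (hstep : forall u n, bvfun u ->
     `|Ld_functional (h n.+1) u - Ld_functional (h n) u| <= A * q ^+ n * V u)
  (hbase : forall u, bvfun u -> `|Ld_functional (h 0%N) u| <= C0 * V u).

Let q10 : 0 < 1 - q. Proof. by move: q01 => /andP[_]; rewrite subr_gt0. Qed.

Lemma lim_functional_cvg u : bvfun u ->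
  cvgn (fun n => Ld_functional (h n) u) /\
  forall n, `|lim_functional h u - Ld_functional (h n) u| <= A / (1 - q) * q ^+ n * V u.
Proof.
move=> bu.
have [|cu H] := @geometric_cauchy R (fun n => Ld_functional (h n) u) (A * V u) q q01.
  by move=> n; rewrite mulrAC; exact: hstep.
split=> // n; apply: le_trans (H n) _.
by rewrite le_eqVlt; apply/orP; left; apply/eqP; ring.
Qed.

Lemma lim_functional_bound u : bvfun u ->
  `|lim_functional h u| <= (C0 + A / (1 - q)) * V u.
Proof.
move=> bu; have [_ H] := lim_functional_cvg bu.
rewrite -(subrK (Ld_functional (h 0%N) u) (lim_functional h u)).
rewrite (le_trans (ler_normD _ _))// addrC mulrDl lerD ?hbase//.
by have := H 0%N; rewrite expr0 mulr1.
Qed.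

Lemma lim_functional_linear a u v : bvfun u -> bvfun v ->
  lim_functional h (fun x => a * u x + v x) =
  a * lim_functional h u + lim_functional h v.
Proof.
move=> bu bv; have [cu _] := lim_functional_cvg bu; have [cv _] := lim_functional_cvg bv.
have [iu _ _] := bu; have [iv _ _] := bv.
rewrite /lim_functional; under eq_fun do rewrite Ld_functional_linear//.
exact: limn_linear.
Qed.

(** The densities [h n] themselves are the required L^d approximations, the error in norm being a
    geometric tail. *)
Lemma represents_lim_functional :
  represents (lim_functional h) (fun B => lim_functional h \1_B).
Proof.
have C1 : 0 <= C0 + A / (1 - q) by rewrite addr_ge0 ?divr_ge0// ltW.
split=> //.
  split; first by move=> a u v; exact: lim_functional_linear.
  exact: le_lt_trans (dual_norm_le C1 lim_functional_bound) (ltry _).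
move=> e e0; have [n qn] := geometric_small (A / (1 - q)) q01 (divr_gt0 e0 (ltr0Sn _ 1)).
exists (h n); first exact: Ld_cube_polyfun.
apply: (@le_lt_trans _ _ (e / 2)%:E); last by rewrite lte_fin; lra.
apply: dual_norm_le => [|u bu]; first by rewrite divr_ge0// ltW.
have [_ H] := lim_functional_cvg bu; apply: le_trans (H n) _.
by rewrite ler_wpM2r// fine_variation_ge0.
Qed.

(** Continuity is an interchange of limits: bounded perimeters make the tail at some index [m] small
    for all [B_ n] and [B] at once, and the fixed density [h m], bounded on the cube, is controlled
    by the measure of the symmetric difference. *)
Lemma charge_lim_functional : is_charge (fun B => lim_functional h \1_B).
Proof.
split=> [B1 B2 b1 b2 m12|B_ B bB_ bB [muB VB]].
  have [c1 _] := lim_functional_cvg (bvfun_indic b1).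
  have [c2 _] := lim_functional_cvg (bvfun_indic b2).
  have [[_ m1 _] s1] := b1; have [[_ m2 _] s2] := b2.
  rewrite /lim_functional; under eq_fun do rewrite Ld_functional_setU//.
  have := limn_linear 1 c1 c2; rewrite mul1r => <-.
  by congr (limn _); apply/funext => n; rewrite mul1r.
set S := ereal_sup _ in VB.
have VS n : V (\1_(B_ n)) <= fine S.
  have le1 : (rV_variation \1_(B_ n) <= S)%E.
    by apply: ereal_sup_ubound; exists n.
  have Sfin : S \is a fin_num.
    by rewrite fin_numElt VB andbT (lt_le_trans _ le1)// (lt_le_trans _ (rV_variation_ge0 _)).
  have [[_ _ Vn] _] := bB_ n.
  by rewrite -lee_fin (fineK Sfin) -variation_fin.
have [[_ mB _] cB] := bB.
apply/cvgrPdist_le => e e0.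
have W0 : 0 <= fine S + V (\1_B).
  by rewrite addr_ge0 ?fine_variation_ge0// (le_trans _ (VS 0%N))// fine_variation_ge0.
have [m qm] := geometric_small (A / (1 - q) * (fine S + V (\1_B))) q01
  (divr_gt0 e0 (ltr0Sn _ 1)).
have [M hM] := polyfun_box_bounded (fun=> 0) (fun=> 1) (ph m).
have M0 : 0 <= M.
  by apply: le_trans (hM 0 _); rewrite ?normr_ge0// => i; rewrite mxE lexx ler01.
have M1 : 0 < M + 1 by rewrite ltr_wpDl.
have muP := (cvge0P (fun n => measure_ge0 (@leb R d) _)).1 muB.
have eM : 0 < e / 2 / (M + 1) by rewrite !divr_gt0.
apply: filterS (muP _ eM) => n mun.
have [[_ mn _] cn] := bB_ n.
have [_ Hn] := lim_functional_cvg (bvfun_indic (bB_ n)).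
have [_ HB] := lim_functional_cvg (bvfun_indic bB).
set l := lim_functional h; set Ln := Ld_functional (h m) \1_(B_ n).
set L := Ld_functional (h m) \1_B.
have -> : l \1_B - l \1_(B_ n) = (l \1_B - L) - (l \1_(B_ n) - Ln) - (Ln - L) by ring.
rewrite (le_trans (ler_normB _ _))//.
apply: (@le_trans _ _ (e / 2 + e / 2)); last by rewrite -splitr.
apply: lerD.
  rewrite (le_trans (ler_normB _ _))//; apply: le_trans (lerD (HB m) (Hn m)) _.
  apply: le_trans qm; rewrite -mulrDr [leRHS]mulrAC ler_wpM2l//.
    by apply: mulr_ge0; [exact: divr_ge0 A0 (ltW q10)|apply: exprn_ge0; case/andP: q01].
  by rewrite addrC lerD.
apply: le_trans (Ld_functional_symdiff (ph m) hM mn mB cn cB) _.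
set D := _ `|` _ in mun *.
have Dfin : mu D \is a fin_num.
  by rewrite ge0_fin_numE// (lt_trans mun)// ltry.
have : fine (mu D) <= e / 2 / (M + 1) by rewrite -lee_fin fineK// ltW.
move=> /(ler_wpM2l M0)/le_trans; apply.
by rewrite mulrCA ler_piMr ?divr_ge0 ?(ltW e0)// ler_pdivrMr// mul1r lerDl.
Qed.

End polyfun_limits.

Section real_lemmas.
Context {R : realType}.

Lemma powR_expr (x p : R) n : 0 <= x -> (x ^+ n) `^ p = (x `^ p) ^+ n.
Proof.
move=> x0; rewrite -(powR_mulrn n x0) -(powR_mulrn n (powR_ge0 x p)).
exact: powRAC.
Qed.

Lemma prod_powR d (x : R) (p : 'I_d -> R) : 0 < x ->
  \prod_i x `^ p i = x `^ (\sum_i p i).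
Proof.
move=> x0; elim/big_rec2: _ => [|i y z _ ->]; first by rewrite powRr0.
by rewrite powRD// (gt_eqF x0) implybT.
Qed.

Lemma prod_scale d (a : 'I_d -> R) t i :
  a i * \prod_(j | j != i) (a j * t) = (\prod_j a j) * t ^+ d.-1.
Proof.
rewrite big_split/= prodr_const cardC1 card_ord mulrA; congr (_ * _).
by rewrite [RHS](bigD1 i).
Qed.

End real_lemmas.

(** * The exterior product *)

Section approximants.
Context {R : realType} {d : nat} (gam : 'I_d -> R).
Local Notation E := 'rV[R]_d.
Local Notation mu := (@leb R d).
Hypotheses (d0 : (0 < d)%N) (gam01 : forall i, 0 < gam i < 1)
  (gamd : (d%:R - 1) / d%:R < (\sum_i gam i) / d%:R).
Implicit Types (g : 'I_d -> @unit_cube R d -> R).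

Definition mesh n : R := 2^-1 ^+ n.
(* This is 2^(d - 1 - sum gamma), smaller than 1 exactly when gamma > (d-1)/d. *)
Definition mesh_ratio : R := \prod_j (2^-1 `^ gam j) * 2 ^+ d.-1.
(* A Bernstein polynomial of degree [N] averages at the scale [N^(-1/2)], whence
   the degree [4 ^ n] for the mesh [2^-n]. *)
Definition approximant n g (i : 'I_d) : E -> R := bern (4 ^ n) (ext (g i)).
Definition wedge_approx n g : E -> R := jdet (approximant n g).
Definition Lips g i : R := fine (Lip (gam i) (g i)).

Local Notation K := (1 + 3 * d%:R : R).

Lemma mesh_gt0 n : 0 < mesh n. Proof. by rewrite exprn_gt0. Qed.

Lemma mesh_sqr n : (4 ^ n)%:R * mesh n ^+ 2 = 1 :> R.
Proof.
rewrite /mesh -exprM mulnC exprM natrX -exprMn (_ : 4 * _ = 1) ?expr1n//.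
by field.
Qed.

Lemma mesh_ratio_itv : 0 <= mesh_ratio < 1.
Proof.
apply/andP; split; first by rewrite mulr_ge0// prodr_ge0// => j _; exact: powR_ge0.
rewrite /mesh_ratio prod_powR// -ltr_pdivlMr ?exprn_gt0// div1r -exprVn -powR_mulrn//.
have d1 : 0 < d%:R :> R by rewrite ltr0n.
(* The hypothesis with the denominator cleared; since [d] is positive, [d.-1] is d - 1. *)
have H : d.-1%:R < \sum_i gam i.
  have e : d%:R = d.-1%:R + 1 :> R by rewrite natr1 prednK.
  by move: gamd; rewrite ltr_pM2r ?invr_gt0// e addrK.
rewrite -(@ltr_ln R) ?posrE ?powR_gt0// !ln_powR.
rewrite ltr_nM2r// lnV ?posrE// oppr_lt0 ln_gt0//.
by rewrite ltr1n.
Qed.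

Lemma Lips_ge0 g i : 0 <= Lips g i. Proof. exact: Lip_fine_ge0. Qed.

Lemma K_ge1 : 1 <= K. Proof. by rewrite lerDl mulr_ge0. Qed.

Lemma polyfun_approximant n g i : polyfun (approximant n g i).
Proof. exact: polyfun_bern. Qed.

Lemma polyfun_wedge_approx n g : polyfun (wedge_approx n g).
Proof. by apply: polyfun_jdet => i; exact: polyfun_approximant. Qed.

Let gam1 i : 0 < gam i <= 1. Proof. by have := gam01 i; lra. Qed.

Lemma approximant_close n g i x : holder (gam i) (g i) -> enlarged_cube x ->
  `|approximant n g i x - ext (g i) x| <= K * Lips g i * mesh n `^ gam i.
Proof.
move=> hg xQ; apply: (bern_close (mesh_gt0 n) (mesh_sqr n)) => //.
  exact: Lips_ge0.
by apply: holder_ext => //; have /andP[] := gam01 i.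
Qed.

Lemma approximant_partial n g i l x : holder (gam i) (g i) -> enlarged_cube x ->
  `|partial l (approximant n g i) x| <=
    K * Lips g i * (mesh n `^ gam i / mesh n).
Proof.
move=> hg xQ; apply: (partial_bern_le (mesh_gt0 n) (mesh_sqr n)) => //.
  exact: Lips_ge0.
by apply: holder_ext => //; have /andP[] := gam01 i.
Qed.

Lemma prod_mesh n : \prod_j mesh n `^ gam j * (mesh n)^-1 ^+ d.-1 = mesh_ratio ^+ n.
Proof.
rewrite /mesh_ratio exprMn -prodrXl /mesh; congr (_ * _).
  by apply: eq_bigr => j _; rewrite powR_expr.
by rewrite -exprVn invrK -!exprM mulnC.
Qed.

(** [d] rows are exchanged and the Leibniz expansion costs d!. Each factor carries 1 + 3 d, doubled
    for two reasons: values of two approximants are compared through [g], and gradients on the finer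
    mesh are divided by half the length. *)
Definition step_const : R := d%:R * (d`!%:R * (2 * K) ^+ d).

Lemma wedge_step u W n g : mu.-integrable setT (EFin \o u) -> 0 <= W ->
  div_bounded u W -> holder_tuple gam g ->
  `|Ld_functional (wedge_approx n.+1 g) u - Ld_functional (wedge_approx n g) u| <=
  step_const * (\prod_i Lips g i) * W * mesh_ratio ^+ n.
Proof.
move=> iu W0 uW hg.
(* [a j] serves twice: it bounds the difference of successive approximants, and divided by [mesh n]
   it bounds the gradients of both. *)
pose a j := 2 * K * Lips g j * mesh n `^ gam j.
pose t := (mesh n)^-1.
have s0 := mesh_gt0 n; have s1 := mesh_gt0 n.+1.
have sS : mesh n.+1 = mesh n / 2 by rewrite /mesh exprSr.
have KL j : 0 <= K * Lips g j.
  by rewrite mulr_ge0 ?Lips_ge0// (le_trans ler01)// K_ge1.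
have a0 j : 0 <= a j by rewrite mulr_ge0 ?powR_ge0// -mulrA mulr_ge0.
have t0 : 0 <= t by rewrite invr_ge0 ltW.
have sle j : mesh n.+1 `^ gam j <= mesh n `^ gam j.
  apply: ge0_ler_powR; rewrite ?nnegrE ?(ltW s0) ?(ltW s1)//.
    by have /andP[/ltW] := gam01 j.
  by rewrite sS; lra.
have b1 j x l : enlarged_cube x -> `|partial l (approximant n.+1 g j) x| <= a j * t.
  move=> xQ; apply: le_trans (approximant_partial n.+1 l (hg j) xQ) _.
  rewrite {2}sS invf_div /a /t [leRHS](_ : _ =
    K * Lips g j * (mesh n `^ gam j * (2 / mesh n))); last by ring.
  by rewrite ler_wpM2l// ler_wpM2r// divr_ge0// ltW.
have b2 j x l : enlarged_cube x -> `|partial l (approximant n g j) x| <= a j * t.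
  move=> xQ; apply: le_trans (approximant_partial n l (hg j) xQ) _.
  rewrite /a [leRHS](_ : _ =
    2 * (K * Lips g j * (mesh n `^ gam j / mesh n))); last by rewrite /t; ring.
  by rewrite ler_peMl ?ler1n// mulr_ge0// divr_ge0 ?powR_ge0// ltW.
have c1 x j : enlarged_cube x -> `|approximant n.+1 g j x - approximant n g j x| <= a j.
  move=> xQ; rewrite -(subrKA (ext (g j) x)) (le_trans (ler_normD _ _))//.
  rewrite [X in _ + X]distrC.
  apply: le_trans (lerD (approximant_close n.+1 (hg j) xQ) (approximant_close n (hg j) xQ)) _.
  rewrite /a [leRHS](_ : _ = K * Lips g j * mesh n `^ gam j +
    K * Lips g j * mesh n `^ gam j); last by ring.
  by rewrite lerD2r ler_wpM2l.
apply: le_trans (jdet_functional_sub_le (a := a) (b := fun j => a j * t) iu W0 uW _ _ _ _ _ _) _.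
- by move=> j; exact: polyfun_approximant.
- by move=> j; exact: polyfun_approximant.
- by move=> j; exact: mulr_ge0.
- exact: c1.
- by move=> x j l; exact: b1.
- by move=> x j l; exact: b2.
(* All summands have the same value: one row without and d - 1 rows with the factor 1 / mesh n. *)
rewrite [leLHS](eq_bigr (fun=> d`!%:R * ((\prod_j a j) * t ^+ d.-1) * W)) => [|i _];
  last by rewrite /= -(prod_scale a t i) !mulrA.
rewrite sumr_const card_ord -[leLHS]mulr_natl.
have -> : \prod_j a j = (2 * K) ^+ d * \prod_j Lips g j * \prod_j mesh n `^ gam j.
  by rewrite /a big_split/= big_split/= prodr_const card_ord.
rewrite -prod_mesh le_eqVlt; apply/orP; left; apply/eqP.
by rewrite /step_const /t; ring.
Qed.

End approximants.

Lemma cvg_uniformP (R : realType) (T : choiceType) (f_ : nat -> T -> R) (f : T -> R) :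
  {uniform, f_ @ \oo --> f} <->
  forall e : R, 0 < e -> \forall p \near \oo, forall x, `|f x - f_ p x| < e.
Proof.
split=> [cf e e0|H P /uniform_nbhs[X [entX XP]]].
  apply: (cf [set h | forall x, `|f x - h x| < e]); apply/uniform_nbhs.
  exists [set xy | ball xy.1 e xy.2]; split.
    by rewrite -entourage_ballE; exists e.
  by move=> h Hh x; exact: Hh.
move: entX; rewrite -entourage_ballE => -[e /= e0 eX].
apply: filterS (H e e0) => p fp; apply: XP => x _; apply: eX => /=.
exact: fp.
Qed.

Lemma limn_sub (R : realType) (x y : nat -> R) : cvgn x -> cvgn y ->
  limn (fun n => x n - y n) = limn x - limn y.
Proof. by move=> cx cy; exact: limB. Qed.

Section jdet_functional_bounded.
Context {R : realType} {d : nat}.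
Local Notation E := 'rV[R]_d.
Local Notation V u := (fine (rV_variation u)).

(** Supplies the start of the geometric series, a first functional of finite norm; the choice of the
    row [i0] is arbitrary. *)
Lemma jdet_functional_bounded (f : 'I_d -> E -> R) : (0 < d)%N ->
  (forall i, polyfun (f i)) ->
  exists2 C : R, 0 <= C &
    forall u, bvfun u -> `|Ld_functional (jdet f) u| <= C * V u.
Proof.
move=> d0 pf; pose i0 : 'I_d := Ordinal d0.
(* One polynomial dominates all squared partial derivatives, so a single bound on the box suffices;
   then t <= t^2 + 1/4 <= 1 + M. *)
have pF : polyfun (fun x => \sum_j \sum_l partial l (f j) x ^+ 2).
  apply: polyfun_sum => j; apply: polyfun_sum => l.
  under eq_fun do rewrite expr2.
  by apply: polyfunM; exact: polyfun_partial.
have [M FM] := polyfun_box_bounded (fun=> - 2^-1) (fun=> 3 / 2) pF.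
have [a fa] := polyfun_box_bounded (fun=> - 2^-1) (fun=> 3 / 2) (pf i0).
have Q0 : enlarged_cube (0 : E) by move=> i; rewrite mxE; lra.
have M0 : 0 <= M by apply: le_trans (FM _ Q0); exact: normr_ge0.
have a0 : 0 <= a by apply: le_trans (fa _ Q0); exact: normr_ge0.
exists (d`!%:R * a * \prod_(j | j != i0) (1 + M) * d%:R).
  by rewrite mulr_ge0// mulr_ge0 ?mulr_ge0// prodr_ge0// => j _; rewrite addr_ge0.
move=> u bu; have [iu _ _] := bu; pose b (j : 'I_d) := 1 + M.
rewrite -[leRHS]mulrA -/(\prod_(j | j != i0) b j).
apply: (jdet_functional_le (i := i0) (a := a) (b := b)) => //.
- by rewrite mulr_ge0// fine_variation_ge0.
- exact: bvfun_div_bounded.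
- by move=> j; rewrite addr_ge0.
- move=> x j l xQ _; set p := partial l (f j) x.
  have : p ^+ 2 <= M.
    apply: le_trans (FM x xQ); apply: le_trans (ler_norm _).
    have sq (i k : 'I_d) : 0 <= partial k (f i) x ^+ 2 by exact: sqr_ge0.
    rewrite (bigD1 j)//= (bigD1 l)//= -/p -addrA lerDl addr_ge0// sumr_ge0// => i _.
    by apply: sumr_ge0.
  rewrite -(real_normK (num_real p)).
  rewrite /b; set t := `|p| => tM.
  have := sqr_ge0 (t - 2^-1); nra.
Qed.

End jdet_functional_bounded.

Section bernstein_linear.
Context {R : realType} {d : nat} (N : nat).
Local Notation E := 'rV[R]_d.

Lemma bern_linear a (f h : E -> R) :
  bern N (fun x => a * f x + h x) = fun x => a * bern N f x + bern N h x.
Proof.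
apply/funext => x; rewrite /bern mulr_sumr -big_split/=.
by apply: eq_bigr => k _; rewrite mulrDl mulrA.
Qed.

Lemma bern_sub_le e (f h : E -> R) x : enlarged_cube x ->
  (forall y, `|f y - h y| <= e) -> `|bern N f x - bern N h x| <= e.
Proof.
move=> xQ fhe; have x12 := enlarged_cube_node xQ.
rewrite /bern -sumrB (le_trans (ler_norm_sum _ _ _))//.
apply: (@le_trans _ _ (\sum_(k : {ffun 'I_d -> 'I_N.+1}) e * bprod k x)).
  apply: ler_sum => k _; rewrite -mulrBl normrM (ger0_norm (bprod_ge0 k x12)).
  by rewrite ler_wpM2r ?bprod_ge0.
by rewrite -mulr_sumr sum_bprod mulr1.
Qed.

End bernstein_linear.

(** * The limit charge and its continuity in g *)

Section wedge.
Context {R : realType} {d : nat} (gam : 'I_d -> R).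
Local Notation E := 'rV[R]_d.
Local Notation V u := (fine (rV_variation u)).
Hypotheses (d0 : (0 < d)%N) (gam01 : forall i, 0 < gam i < 1)
  (gamd : (d%:R - 1) / d%:R < (\sum_i gam i) / d%:R).
Implicit Types (g : 'I_d -> @unit_cube R d -> R).

Definition wedge g (B : set E) : R :=
  lim_functional (fun n => wedge_approx n g) \1_B.

Local Notation q := (mesh_ratio gam).
Local Notation L := (Lips gam).

(** The last factor [d] is the one of [bvfun_div_bounded]. *)
Definition rate g : R := @step_const R d * (\prod_i L g i) * d%:R.

Lemma prod_Lips_ge0 g : 0 <= \prod_i L g i.
Proof. by apply: prodr_ge0 => i _; exact: Lips_ge0. Qed.

Lemma step_const_ge0 : 0 <= @step_const R d.
Proof.
by rewrite mulr_ge0// mulr_ge0// exprn_ge0// mulr_ge0// addr_ge0// mulr_ge0.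
Qed.

Lemma rate_ge0 g : 0 <= rate g.
Proof. by rewrite mulr_ge0// mulr_ge0 ?step_const_ge0// prod_Lips_ge0. Qed.

Lemma wedge_step_bv g u n : holder_tuple gam g -> bvfun u ->
  `|Ld_functional (wedge_approx n.+1 g) u - Ld_functional (wedge_approx n g) u| <=
  rate g * q ^+ n * V u.
Proof.
move=> hg bu; have [iu _ _] := bu.
apply: le_trans (wedge_step gam01 n iu _ (bvfun_div_bounded d0 bu) hg) _.
  by rewrite mulr_ge0// fine_variation_ge0.
by rewrite /rate le_eqVlt; apply/orP; left; apply/eqP; ring.
Qed.

Lemma wedge_cvg g u : holder_tuple gam g -> bvfun u ->
  cvgn (fun n => Ld_functional (wedge_approx n g) u).
Proof.
move=> hg bu; have [C0 C00 hC] := jdet_functional_bounded d0 (polyfun_approximant 0 g).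
have [|c _] := @lim_functional_cvg R d (fun n => wedge_approx n g) (rate g) q
  (mesh_ratio_itv d0 gamd) _ u bu; last exact: c.
by move=> w n bw; exact: wedge_step_bv.
Qed.

Lemma charge_wedge g : holder_tuple gam g -> is_charge (wedge g).
Proof.
move=> hg; have [C0 C00 hC] := jdet_functional_bounded d0 (polyfun_approximant 0 g).
apply: (@charge_lim_functional R d (fun n => wedge_approx n g) (rate g) q) => //.
- by move=> n; exact: polyfun_wedge_approx.
- exact: mesh_ratio_itv.
- exact: rate_ge0.
- by move=> u n bu; exact: wedge_step_bv.
Qed.


(** The difference of two wedges is represented by the limit of the differences [h], so its norm is
    at most [e] at level [n] plus the two tails beyond it, both governed by [A]. *)
Lemma wedge_sub_strong_norm g g' A e n : holder_tuple gam g -> holder_tuple gam g' ->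
  rate g <= A -> rate g' <= A -> 0 <= e ->
  (forall u, bvfun u -> `|Ld_functional (wedge_approx n g) u -
                          Ld_functional (wedge_approx n g') u| <= e * V u) ->
  (strong_norm (fun B => wedge g B - wedge g' B)%R
     <= (e + (A + A) / (1 - q) * q ^+ n)%:E)%E.
Proof.
move=> hg hg' gA g'A e0 ge.
have /andP[q0 q1] := mesh_ratio_itv d0 gamd.
have q10 : 0 < 1 - q by rewrite subr_gt0.
have A0 : 0 <= A by exact: le_trans (rate_ge0 g) gA.
have AA0 : 0 <= A + A by rewrite addr_ge0.
pose h m x := wedge_approx m g x - wedge_approx m g' x.
have [C C0 hC] := jdet_functional_bounded d0 (polyfun_approximant 0 g).
have [C' C0' hC'] := jdet_functional_bounded d0 (polyfun_approximant 0 g').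
have hE m u : bvfun u -> Ld_functional (h m) u =
    Ld_functional (wedge_approx m g) u - Ld_functional (wedge_approx m g') u.
  by move=> [iu _ _]; apply: Ld_functionalB => //; exact: polyfun_wedge_approx.
have ph m : polyfun (h m) by apply: polyfunB; exact: polyfun_wedge_approx.
clearbody h.
have hbase u : bvfun u -> `|Ld_functional (h 0%N) u| <= (C + C') * V u.
  move=> bu; rewrite (hE 0%N u bu) (le_trans (ler_normB _ _))// mulrDl.
  by apply: lerD; [exact: hC|exact: hC'].
have hstep u m : bvfun u ->
    `|Ld_functional (h m.+1) u - Ld_functional (h m) u| <= (A + A) * q ^+ m * V u.
  move=> bu.
  rewrite (hE m.+1 u bu).
  rewrite (hE m u bu).
  have Hg := wedge_step_bv m hg bu.
  have Hg' := wedge_step_bv m hg' bu.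
  have H4 (x y z t : R) : x - y - (z - t) = (x - z) - (y - t) by ring.
  rewrite H4.
  apply: le_trans (ler_normB _ _) _.
  rewrite mulrDl mulrDl.
  have le r : r <= A -> r * q ^+ m * V u <= A * q ^+ m * V u.
    by move=> rA; rewrite ler_wpM2r ?fine_variation_ge0// ler_wpM2r// exprn_ge0.
  by apply: lerD; [exact: le_trans Hg (le _ gA)
                  |exact: le_trans Hg' (le _ g'A)].
have CC0 : 0 <= C + C' by rewrite addr_ge0.
have qq := mesh_ratio_itv d0 gamd.
have [l1 l2 l3] := represents_lim_functional ph qq AA0 CC0 hstep hbase.
apply: (@le_trans _ _ (dual_norm (lim_functional h))).
  apply: ereal_inf_lbound; exists (lim_functional h) => //; split=> // B bB.
  have c1 := wedge_cvg hg (bvfun_indic bB); have c2 := wedge_cvg hg' (bvfun_indic bB).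
  rewrite /wedge /lim_functional (funext (fun m => hE m _ (bvfun_indic bB))).
  exact: esym (limn_sub c1 c2).
apply: dual_norm_le => [|u bu].
  by rewrite addr_ge0// mulr_ge0 ?exprn_ge0// divr_ge0// ltW.
have [_ H] := lim_functional_cvg qq hstep bu.
rewrite -(subrK (Ld_functional (h n) u) (lim_functional h u)) addrC.
rewrite (le_trans (ler_normD _ _))// mulrDl lerD//.
by rewrite (hE n u bu); exact: ge.
Qed.

Lemma weakly_continuous_wedge : weakly_continuous gam wedge.
Proof.
move=> g_ g hg_ hg gu gS.
pose S i := ereal_sup (range (fun p => Lip (gam i) (g_ p i))).
(* A common bound for the constants of [g] and of every [g_ p]; it makes the tail constant [A]
   uniform in [p]. *)
pose T i := Num.max (L g i) (Num.max 0 (fine (S i))).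
have T0 i : 0 <= T i by rewrite le_max Lips_ge0.
have T1 i : L g i <= T i by rewrite le_max lexx.
have T2 p i : L (g_ p) i <= T i.
  have LS : (Lip (gam i) (g_ p i) <= S i)%E by apply: ereal_sup_ubound; exists p.
  rewrite !le_max; apply/orP; right; rewrite /Lips; move: LS (gS i); rewrite -/(S i).
  case: (S i) => [s| |]//=; case: (Lip _ _) => [l| |]//=; rewrite ?lexx//.
  by rewrite lee_fin => ->; rewrite orbT.
pose A := @step_const R d * (\prod_i T i) * d%:R.
have gA g' : (forall i, L g' i <= T i) -> rate g' <= A.
  move=> gT; rewrite ler_wpM2r// ler_wpM2l ?step_const_ge0//.
  by apply: ler_prod => i _; rewrite Lips_ge0/=.
have A0 : 0 <= A by exact: le_trans (rate_ge0 g) (gA g T1).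
apply/cvge0P => [p|e e0]; first exact: strong_norm_ge0.
have e3 : 0 < e / 3 by rewrite divr_gt0.
have [n qn] := geometric_small ((A + A) / (1 - q)) (mesh_ratio_itv d0 gamd) e3.
pose b j := (1 + 3 * d%:R) * T j * (mesh n `^ gam j / mesh n) : R.
have K1 := @K_ge1 R d.
have K0 : (0 : R) <= 1 + 3 * d%:R by exact: le_trans K1.
have bge j : 0 <= b j.
  apply: mulr_ge0; first exact: mulr_ge0.
  by apply: divr_ge0; [exact: powR_ge0|exact/ltW/mesh_gt0].
(* The gradient bounds [b] depend on [n], so the sup-distance [a] between the tuples is prescribed
   only after [n] is fixed; [M] is the cost per unit of that distance. *)
pose M := \sum_i d`!%:R * (\prod_(j | j != i) b j) * d%:R.
have M0 : 0 <= M.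
  by rewrite sumr_ge0// => i _; rewrite mulr_ge0// mulr_ge0// prodr_ge0.
have M1 : 0 < M + 1 by rewrite ltr_wpDl.
pose a := e / 3 / (M + 1).
have a0 : 0 < a by rewrite divr_gt0.
have : \forall p \near \oo, forall i, forall x, `|g i x - g_ p i x| < a.
  apply: filter_forall => i; exact: (cvg_uniformP (fun p => g_ p i) (g i)).1 (gu i) a a0.
apply: filterS => p gp.
apply: (@le_lt_trans _ _ (e / 3 + e / 3)%:E); last by rewrite lte_fin; lra.
apply: le_trans (@wedge_sub_strong_norm g (g_ p) A (e / 3) n hg (hg_ p)
  (gA _ T1) (gA _ (T2 p)) (ltW e3) _) _; last by rewrite lee_fin lerD2l.
move=> u bu; have [iu _ _] := bu.
have pb g' j x l : holder_tuple gam g' -> (forall i, L g' i <= T i) -> enlarged_cube x ->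
    `|partial l (approximant n g' j) x| <= b j.
  move=> hg' g'T xQ; apply: le_trans (approximant_partial gam01 n l (hg' j) xQ) _.
  apply: ler_wpM2r; first by apply: divr_ge0; [exact: powR_ge0|exact/ltW/mesh_gt0].
  exact: ler_wpM2l.
apply: le_trans (jdet_functional_sub_le (a := fun=> a) (b := b) iu _
  (bvfun_div_bounded d0 bu) (polyfun_approximant n g) (polyfun_approximant n (g_ p))
  bge _ _ _) _.
- by rewrite mulr_ge0// fine_variation_ge0.
- move=> x j xQ; apply: bern_sub_le => // y; exact: ltW (gp j _).
- by move=> x j l; exact: pb.
- by move=> x j l; apply: pb => //; exact: T2.
rewrite [leLHS](_ : _ = a * M * V u).
  rewrite ler_wpM2r ?fine_variation_ge0// /a mulrAC ler_pdivrMr//.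
  by rewrite ler_wpM2l ?(ltW e3)// lerDl.
rewrite /M mulr_sumr mulr_suml; apply: eq_bigr => i _; ring.
Qed.

End wedge.

(** * Multilinearity *)

Section multilinear.
Context {R : realType} {d : nat} (gam : 'I_d -> R).
Local Notation mu := (@leb R d).
Hypotheses (d0 : (0 < d)%N) (gam01 : forall i, 0 < gam i < 1)
  (gamd : (d%:R - 1) / d%:R < (\sum_i gam i) / d%:R).
Implicit Types (g : 'I_d -> @unit_cube R d -> R).

Lemma Ld_functionalZ a h u : polyfun h -> mu.-integrable setT (EFin \o u) ->
  Ld_functional (fun x => a * h x) u = a * Ld_functional h u.
Proof.
move=> ph iu; rewrite -RintegralZl.
- by apply: eq_Rintegral => x _; rewrite mulrA.
- exact: measurable_unit_cube.
- exact: integrable_cube_polyfun.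
Qed.

(** Only row [i] changes, and it is linear in the function because the Bernstein operator is. The
    identity is exact at each level and passes to the limit. *)
Lemma wedge_approx_linear n g i a (f h : @unit_cube R d -> R) x :
  wedge_approx n (update g i (fun v => a * f v + h v)) x =
  a * wedge_approx n (update g i f) x + wedge_approx n (update g i h) x.
Proof.
rewrite -[X in _ + X]mul1r; apply: (determinant_multilinear (i0 := i)).
- apply/rowP => j; rewrite !mxE mul1r /approximant /update eqxx.
  rewrite (bern_linear (4 ^ n) a (ext f) (ext h)) partialD; last 2 first.
  + by apply: polyfunM; [exact: polyfun_cst|exact: polyfun_bern].
  + exact: polyfun_bern.
  by rewrite partialZ//; exact: polyfun_bern.
- by apply/matrixP => k j; rewrite !mxE /approximant /update eq_sym (negbTE (neq_lift i k)).
- by apply/matrixP => k j; rewrite !mxE /approximant /update eq_sym (negbTE (neq_lift i k)).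
Qed.

Lemma multilinear_wedge : multilinear_on gam wedge.
Proof.
move=> g i a f h hg hf hh B bB.
have hu k : holder (gam i) k -> holder_tuple gam (update g i k).
  by move=> hk j; rewrite /update; have [->|_] := eqVneq j i; [exact: hk|exact: hg].
have bu := bvfun_indic bB; have [iu _ _] := bu.
have c1 := wedge_cvg d0 gam01 gamd (hu f hf) bu.
have c2 := wedge_cvg d0 gam01 gamd (hu h hh) bu.
rewrite /wedge /lim_functional.
rewrite -(limn_linear a c1 c2); congr (limn _); apply/funext => n.
rewrite (funext (wedge_approx_linear n g i a f h)).
rewrite Ld_functionalD//; last 2 first.
- by apply: polyfunM; [exact: polyfun_cst|exact: polyfun_wedge_approx].
- exact: polyfun_wedge_approx.
by rewrite Ld_functionalZ//; exact: polyfun_wedge_approx.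
Qed.

End multilinear.

(** * The bound on dyadic cubes *)

Section holder_bound.
Context {R : realType} {d : nat} (gam : 'I_d -> R).
Local Notation E := 'rV[R]_d.
Local Notation mu := (@leb R d).
Hypotheses (d0 : (0 < d)%N) (gam01 : forall i, 0 < gam i < 1)
  (gamd : (d%:R - 1) / d%:R < (\sum_i gam i) / d%:R).
Implicit Types (g : 'I_d -> @unit_cube R d -> R).

(** The first summand bounds the approximant at the scale of the cube, the second the series from
    there on, with 2 d from the perimeter. *)
Definition holder_const : R :=
  d`!%:R * (1 + 3 * d%:R) ^+ d + @step_const R d * (2 * d%:R) / (1 - mesh_ratio gam).

Lemma dyadic_cube_box (K : set E) : dyadic_cube K -> exists n a,
  [/\ K = box a (fun i => a i + @mesh R n), forall i, 0 <= a i &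
      forall i, a i + @mesh R n <= 1].
Proof.
move=> [n [k ->]]; exists n, (fun i => (k i)%:R / 2 ^+ n); split.
- apply/seteqP; split=> x H i; have := H i;
  by rewrite /mesh exprVn -[X in _ + X]mul1r -mulrDl natr1.
- by move=> i; rewrite divr_ge0// exprn_ge0.
- move=> i; rewrite /mesh exprVn -[X in _ + X]mul1r -mulrDl natr1.
  by rewrite ler_pdivrMr ?exprn_gt0// mul1r -natrX ler_nat.
Qed.

Lemma wedge_dyadic_cube g K : holder_tuple gam g -> dyadic_cube K ->
  `|wedge g K| / fine (mu K) `^ ((\sum_i gam i) / d%:R) <=
  holder_const * \prod_i Lips gam g i.
Proof.
move=> hg /dyadic_cube_box[n [a [-> a0 a1]]].
set s := @mesh R n in a1 *; set K' := box _ _.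
have s0 : 0 < s := mesh_gt0 n.
have d0' : d%:R != 0 :> R by rewrite pnatr_eq0 -lt0n.
have KI : K' `<=` unit_cube.
  move=> x xK i; have /andP[h1 h2] := xK i.
  by rewrite (le_trans (a0 i) h1) (le_trans h2 (a1 i)).
have mK : measurable (K' : set (lebesgueT R d)).
  by apply: measurable_lebesgueT; exact: measurable_box.
have muK : mu K' = (s ^+ d)%:E.
  rewrite leb_box => [|i]; last by rewrite lerDl ltW.
  rewrite (eq_bigr (fun=> s)) => [|i _]; last by rewrite addrC addKr.
  by rewrite prodr_const card_ord.
pose P : R := \prod_j s `^ gam j.
have P0 : 0 < P by apply: prodr_gt0 => j _; exact: powR_gt0.
rewrite muK /= [X in _ / X](_ : _ = P); last first.
  rewrite /P prod_powR// -powR_mulrn ?(ltW s0)// -powRrM mulrC divfK//.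
rewrite ler_pdivrMr//.
set PL := \prod_i Lips gam g i.
have PL0 : 0 <= PL by exact: prod_Lips_ge0.
have iK : mu.-integrable setT (EFin \o (\1_K' : E -> R)) by exact: integrable_indic_cube.
have dK : div_bounded \1_K' (2 * d%:R * s ^+ d.-1).
  by apply: box_div_bounded => // i; rewrite addrC addKr.
have W0 : 0 <= 2 * d%:R * s ^+ d.-1 by rewrite !mulr_ge0// exprn_ge0// ltW.
set W := 2 * d%:R * s ^+ d.-1 in dK W0.
(* The series for the single function [\1_K'], with [W] its perimeter, is read off at the index [n]
   matching the side of the cube. *)
have [_ /(_ n) H1] := geometric_cauchy (mesh_ratio_itv d0 gamd)
  (fun m => wedge_step gam01 m iK W0 dK hg).
have KL : (0 : R) <= 1 + 3 * d%:R by rewrite addr_ge0// mulr_ge0.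
(* At this scale the density is at most a constant times P / s^d, and s^d is the volume of the
   cube. *)
have H2 : `|Ld_functional (wedge_approx n g) \1_K'| <=
    d`!%:R * (1 + 3 * d%:R) ^+ d * PL * P.
  pose M := d`!%:R * \prod_j ((1 + 3 * d%:R) * Lips gam g j * (s `^ gam j / s)).
  have M0 : 0 <= M.
    apply: mulr_ge0 => //; apply: prodr_ge0 => j _.
    apply: mulr_ge0; first by apply: mulr_ge0 => //; exact: Lips_ge0.
    by apply: divr_ge0; [exact: powR_ge0|exact: ltW].
  have sd0 : s ^+ d != 0 by rewrite expf_neq0// gt_eqF.
  have -> : d`!%:R * (1 + 3 * d%:R) ^+ d * PL * P = M * fine (mu K').
    rewrite muK/= /M !big_split/= !prodr_const card_ord -/PL -/P.
    by rewrite exprVn; field.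
  apply: Ld_functional_le_indic => //; first exact: polyfun_wedge_approx.
    by rewrite muK ltry.
  move=> x xI; rewrite normrM (ger0_norm (_ : 0 <= \1_K' x))//.
  apply: ler_wpM2r => //; apply: jdet_le => j l.
  apply: approximant_partial => // i; have := xI i; lra.
rewrite -/(lim_functional (fun m => wedge_approx m g) \1_K') in H1.
rewrite -(subrK (Ld_functional (wedge_approx n g) \1_K') (wedge g K')).
apply: le_trans (ler_normD _ _) _.
apply: le_trans (lerD H1 H2) _.
rewrite -prod_mesh -/s -/P -/PL /W /holder_const.
(* The factor s^-(d-1) of the d - 1 gradients cancels against the area s^(d-1) of a face. *)
have e1 : s^-1 ^+ d.-1 * s ^+ d.-1 = 1 by rewrite -exprMn mulVf ?expr1n// gt_eqF.
rewrite le_eqVlt; apply/orP; left; apply/eqP; move: e1.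
set t := s^-1 ^+ _; set r := s ^+ _ => e1.
rewrite -/PL; set D := d`!%:R; set S := step_const; set q1 := (1 - _)^-1.
have -> : S * PL * (2 * d%:R * r) * (P * t) * q1 + D * (1 + 3 * d%:R) ^+ d * PL * P
  = S * PL * (2 * d%:R) * (t * r) * P * q1 + D * (1 + 3 * d%:R) ^+ d * PL * P by ring.
rewrite e1; ring.
Qed.

Lemma wedge_holder_norm g : holder_tuple gam g ->
  (charge_holder_norm ((\sum_i gam i) / d%:R) (wedge g) <=
   (holder_const * \prod_i fine (Lip (gam i) (g i)))%:E)%E.
Proof.
move=> hg; apply: ge_ereal_sup => _ [K dK <-]; rewrite lee_fin.
exact: wedge_dyadic_cube.
Qed.

Lemma sch_wedge g : holder_tuple gam g -> sch ((\sum_i gam i) / d%:R) (wedge g).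
Proof.
move=> hg; split; first exact: charge_wedge.
exact: le_lt_trans (wedge_holder_norm hg) (ltry _).
Qed.

End holder_bound.

(** * Smooth tuples and uniqueness *)

Section open_cube.
Context {R : realType} {d : nat}.
Local Notation E := 'rV[R]_d.
Local Notation mu := (@leb R d).
Local Notation cube := (unit_cube : set (lebesgueT R d)).

(** Around its points the clamped extension is the original function, so gradients of approximants
    converge there; the rest of the cube is a null set. *)
Definition open_cube : set E := [set x | forall i, 0 < x ord0 i < 1].

Lemma measurable_open_cube : measurable (open_cube : set (lebesgueT R d)).
Proof.
apply: measurable_lebesgueT.
rewrite (_ : open_cube = [set x | forall i, `]0, 1[%classic (x ord0 i)]).
  by apply: (measurable_rV_box (A := fun i => `]0, 1[%classic)) => i.
by apply/seteqP; split => x /= H i; have := H i; rewrite /= in_itv.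
Qed.

Lemma open_cube_sub : open_cube `<=` unit_cube.
Proof. by move=> x xI i; have /andP[h1 h2] := xI i; rewrite !ltW. Qed.

Lemma leb_open_cube : mu (open_cube : set (lebesgueT R d)) = 1%E.
Proof.
have oE : open_cube = [set x | forall i, `]0, 1[%classic (x ord0 i)].
  by apply/seteqP; split => x /= H i; have := H i; rewrite /= in_itv.
have mo : measurable (open_cube : set E).
  by rewrite oE; apply: (measurable_rV_box (A := fun i => `]0, 1[%classic)) => i.
rewrite (lebE mo) oE (borel_lebesgue_prod (A := fun=> `]0, 1[%classic) (l := fun=> 1)) //.
  by rewrite big1.
by move=> i; rewrite lebesgue_measure_itv/= lte_fin ltr01 oppr0 adde0.
Qed.

Lemma ae_open_cube : {ae mu, forall x, unit_cube x -> open_cube x}.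
Proof.
exists (cube `\` open_cube); split.
- by apply: measurableD; [exact: measurable_unit_cube|exact: measurable_open_cube].
- rewrite measureD; [|exact: measurable_unit_cube|exact: measurable_open_cube|].
    rewrite setIidr; last exact: open_cube_sub.
    by rewrite [X in (X - _)%E]leb_unit_cube [X in (_ - X)%E]leb_open_cube subee.
  by rewrite [X in (X < _)%E]leb_unit_cube ltry.
- by move=> x /= /not_implyP.
Qed.

Lemma open_cube_ball x : open_cube x ->
  exists2 r : R, 0 < r & forall y, `|y - x| < r -> unit_cube y.
Proof.
move=> xI.
have : \forall r \near 0^'+, forall i, r < x ord0 i /\ r < 1 - x ord0 i.
  apply: filter_forall => i; have /andP[x0 x1] := xI i.
  near=> r; split; near: r; apply: nbhs_right_lt => //; by rewrite subr_gt0.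
move=> /filterI/(_ (nbhs_right_gt 0))/filter_ex[r [rx r0]]; exists r => // y yx i.
have [r1 r2] := rx i.
have : `|y ord0 i - x ord0 i| < r.
  apply: le_lt_trans yx; rewrite [leRHS]/Num.Def.normr/= mx_normrE.
  apply: (@le_trans _ _ `|(y - x) ord0 i|); first by rewrite !mxE.
  exact: (le_bigmax _ (fun ij : 'I_1 * 'I_d => `|(y - x) ij.1 ij.2|) (ord0, i)).
rewrite ltr_norml => /andP[h1 h2]; apply/andP; split; lra.
Unshelve. all: by end_near. Qed.

Lemma Ld_functional_indic h (B : set E) : measurable (B : set (lebesgueT R d)) ->
  B `<=` unit_cube -> Ld_functional h \1_B = density_charge h B.
Proof.
move=> mB cB; rewrite /density_charge /Ld_functional /Rintegral; congr fine.
have <- : cube `&` B = B by apply/setIidr.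
rewrite integral_mkcondr; apply: eq_integral => x _.
rewrite patchE indicE setIidr//; case: ifPn => _ /=; by rewrite ?mulr1 ?mulr0.
Qed.

Lemma lim_functional_bounded_cvg (h_ : nat -> E -> R) (h : E -> R) M (B : set E) :
  (forall n, polyfun (h_ n)) -> measurable_fun [set: lebesgueT R d] (h : lebesgueT R d -> R) ->
  (forall n x, unit_cube x -> `|h_ n x| <= M) ->
  (forall x, open_cube x -> h_ n x @[n --> \oo] --> h x) ->
  measurable (B : set (lebesgueT R d)) -> B `<=` unit_cube ->
  lim_functional h_ \1_B = density_charge h B.
Proof.
move=> ph mh hM hh mB cB.
have Bfin : (mu B < +oo)%E by exact: le_lt_trans (leb_subcube mB cB) (ltry _).
have [|||||iB _ cvB] := @dominated_convergence _ (lebesgueT R d) R mu B mB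
  (fun n => EFin \o h_ n) (EFin \o h) (cst M%:E).
- by move=> n; apply/measurable_EFinP; exact: measurable_polyfun_leb.
- by apply/measurable_EFinP; exact: measurable_funTS.
- apply: (@filterS _ _ (ae_filter_ringOfSetsType (mu : {measure set (lebesgueT R d) -> \bar R}))
    _ _ _ ae_open_cube) => x xo Bx.
  by apply: cvg_EFin; [exact: nearW|apply: hh; apply: xo; exact: cB].
- by apply: (bounded_integrable (M := `|M|)).
- by apply: aeW => x n Bx; rewrite lee_fin; apply: hM; exact: cB.
rewrite /lim_functional; apply: cvg_lim; first exact: Rhausdorff.
rewrite (funext (fun n => Ld_functional_indic (h_ n) mB cB)).
rewrite /density_charge /Rintegral; apply: fine_cvg.
rewrite fineK; first exact: cvB.
by apply: integrable_fin_num.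
Qed.

End open_cube.

Section jdet_limits.
Context {R : realType} {d : nat}.
Local Notation E := 'rV[R]_d.

Lemma cvg_prod_fin m (u : 'I_m -> nat -> R) (l : 'I_m -> R) :
  (forall i, u i @ \oo --> l i) -> (fun n => \prod_i u i n) @ \oo --> \prod_i l i.
Proof.
move=> ul; elim: (index_enum _) => [|i r IH].
  by rewrite big_nil; under eq_cvg do rewrite big_nil; exact: cvg_cst.
by rewrite big_cons; under eq_cvg do rewrite big_cons; exact: cvgM.
Qed.

Lemma jdet_leibniz (f : 'I_d -> E -> R) x :
  jdet f x = \sum_(s : 'S_d) (-1) ^+ s * \prod_i partial (s i) (f i) x.
Proof.
by apply: eq_bigr => s _; congr (_ * _); apply: eq_bigr => i _; rewrite mxE.
Qed.

Lemma jdet_cvg (f_ : nat -> 'I_d -> E -> R) (f : 'I_d -> E -> R) x :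
  (forall i j, partial j (f_ n i) x @[n --> \oo] --> partial j (f i) x) ->
  jdet (f_ n) x @[n --> \oo] --> jdet f x.
Proof.
move=> ff; rewrite jdet_leibniz; under eq_cvg do rewrite jdet_leibniz.
apply: (cvg_big (op := +%R)) => [|s _]; first exact: add_continuous.
apply: cvgMl_tmp; apply: (@cvg_prod_fin d (fun i n => partial (s i) (f_ n i) x)) => i.
exact: ff.
Qed.

Lemma measurable_jdet (f : 'I_d -> E -> R) :
  (forall i j, continuous (partial j (f i))) ->
  measurable_fun [set: E] (jdet f).
Proof.
move=> cf; rewrite (funext (jdet_leibniz f)).
apply: measurable_sum => s; apply: measurable_funM => //.
by apply: measurable_prod => i _; exact: continuous_measurable_rV.
Qed.

End jdet_limits.

Section smooth_tuples.
Context {R : realType} {d : nat}.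
Local Notation E := 'rV[R]_d.
Implicit Types (G : E -> E).

Definition restrict_cube G (i : 'I_d) (v : @unit_cube R d) : R := G (val v) ord0 i.

Lemma differentiable_component G i x : differentiable G x ->
  differentiable (fun y => G y ord0 i) x.
Proof.
move=> dG; exact: (differentiable_comp dG (differentiable_coord (G x) ord0 i)).
Qed.

Lemma partial_component G i j x : differentiable G x ->
  partial j (fun y => G y ord0 i) x = 'D_(delta_mx ord0 j) G x ord0 i.
Proof.
move=> dG; rewrite -jacobian_derive// jacobian_partial// => k.
exact: differentiable_component.
Qed.

Lemma continuous_partial_component G i j : is_Ck 1 G ->
  continuous (partial j (fun y => G y ord0 i)).
Proof.
move=> G1; have [dG _] := G1.
rewrite (funext (fun x => partial_component i j (dG x))).
exact: continuous_coord_derive.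
Qed.

Lemma cube_lipschitz G : is_Ck 1 G -> exists2 M : R, 0 <= M &
  forall i x y, unit_cube x -> unit_cube y ->
    `|G x ord0 i - G y ord0 i| <= M * enorm (x - y).
Proof.
move=> G1; have [dG _] := G1.
have /choice[b Hb] (p : 'I_d * 'I_d) := continuous_cube_bounded
  (@continuous_partial_component G p.1 p.2 G1).
exists ((\sum_p `|b p|) * d%:R); first by rewrite mulr_ge0// sumr_ge0.
move=> i x y xI yI; apply: (@segment_lipschitz R d (fun=> 0) (fun=> 1) (fun y => G y ord0 i)) => // [z _|z j zI].
  exact: differentiable_component.
apply: le_trans (Hb (i, j) z zI) _; rewrite (le_trans (ler_norm _))//.
by rewrite (bigD1 (i, j))//= lerDl sumr_ge0.
Qed.

Lemma restrict_cube_lipschitz G M i : 0 <= M ->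
  (forall x y, unit_cube x -> unit_cube y ->
    `|G x ord0 i - G y ord0 i| <= M * enorm (x - y)) ->
  holder_on_space M 1 (ext (restrict_cube G i)).
Proof.
move=> M0 GM x y; rewrite powRr1 ?enorm_ge0//.
apply: le_trans (GM _ _ (clamp_cube x) (clamp_cube y)) _.
by rewrite ler_wpM2l// enorm_clamp.
Qed.

Lemma partial_approximant_cvg G i j x : is_Ck 1 G -> open_cube x ->
  partial j (approximant n (restrict_cube G) i) x @[n --> \oo] -->
  partial j (fun y => G y ord0 i) x.
Proof.
move=> G1 xI; have [dG _] := G1.
have [r0 r00 xr0] := open_cube_ball xI.
have xcube := open_cube_sub xI.
have fE y : unit_cube y -> ext (restrict_cube G i) y = G y ord0 i.
  by move=> yI; rewrite /ext /restrict_cube /= clampK.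
have [|B HB] := @continuous_cube_bounded R d (fun y => G y ord0 i).
  by move=> y; exact: differentiable_continuous (differentiable_component i (dG y)).
have H : forall e : R, 0 < e -> exists C, forall N, (0 < N)%N ->
    `|partial j (bern N (ext (restrict_cube G i))) x -
      partial j (fun y => G y ord0 i) x| <= e + C / N%:R.
  apply: (@partial_bern_approx R d (ext (restrict_cube G i))
    (fun j => partial j (fun y => G y ord0 i) x) x (B + B) j).
  - move=> e e0.
    have [r r0' Hr] := differentiable_expansion (differentiable_component i (dG x)) e0.
    (* Within [r0] clamping is the identity, so the first-order expansion of [G] is inherited. *)
    exists (Num.min r r0); first by rewrite lt_min r0' r00.
    move=> y; rewrite lt_min => /andP[yr yr0].
    by rewrite (fE x xcube) (fE y (xr0 y yr0)); exact: Hr.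
  - by move=> k; have := xcube k; lra.
  - move=> y; rewrite (le_trans (ler_normB _ _))//.
    by apply: lerD; apply: HB; exact: clamp_cube.
apply/cvgrPdist_le => e e0; have e2 : 0 < e / 2 by rewrite divr_gt0.
have [C HC] := H _ e2.
have : (fun n => C * 4^-1 ^+ n) @ \oo --> C * 0.
  by apply: cvgMl_tmp; apply: cvg_expr; rewrite ger0_norm// invf_lt1// ltr1n.
rewrite mulr0 => /cvgrPdist_le/(_ _ e2); apply: filterS => n.
rewrite sub0r normrN => Cn; rewrite distrC.
apply: le_trans (HC (4 ^ n)%N _) _; first by rewrite expn_gt0.
rewrite [leRHS](splitr e) lerD2l; apply: le_trans Cn.
by rewrite natrX -exprVn ler_norm.
Qed.

(** With exponent 1 the factor s^gam / s is 1, so the bound is independent of [n]; it provides the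
    domination for the passage to the limit. *)
Lemma restrict_approximant_partial G M n i l x : 0 <= M ->
  (forall x y, unit_cube x -> unit_cube y ->
    `|G x ord0 i - G y ord0 i| <= M * enorm (x - y)) -> enlarged_cube x ->
  `|partial l (approximant n (restrict_cube G) i) x| <= (1 + 3 * d%:R) * M.
Proof.
move=> M0 GM xQ; have s0 := @mesh_gt0 R n.
have h11 : 0 < (1 : R) <= 1 by rewrite ltr01 lexx.
have := partial_bern_le s0 (@mesh_sqr R n) l M0 h11 (restrict_cube_lipschitz M0 GM) xQ.
by rewrite powRr1 ?(ltW s0)// divff ?mulr1// gt_eqF.
Qed.

Lemma extends_jacobian_wedge : extends_jacobian (@wedge R d).
Proof.
move=> G sG B [[_ mB _] cB]; have G1 := sG 1%N; have [dG _] := G1.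
have [M M0 GM] := cube_lipschitz G1.
have dG' x k := differentiable_component k (dG x).
apply: (@lim_functional_bounded_cvg R d _ _
  (d`!%:R * \prod_(j < d) ((1 + 3 * d%:R) * M))) => //.
- by move=> n; exact: polyfun_wedge_approx.
- rewrite (funext (fun x => det_jacobian (dG' x))).
  apply: measurable_fun_lebesgueT => //; apply: measurable_jdet => i j.
  exact: continuous_partial_component.
- move=> n x xI; apply: jdet_le => j l.
  apply: restrict_approximant_partial => //; first exact: GM.
  by move=> k; have := xI k; lra.
- move=> x xI; rewrite det_jacobian//; apply: jdet_cvg => i j.
  exact: partial_approximant_cvg.
Qed.

End smooth_tuples.

(** * Uniqueness *)

Section uniqueness.
Context {R : realType} {d : nat} (gam : 'I_d -> R).
Local Notation E := 'rV[R]_d.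
Hypotheses (gam01 : forall i, 0 < gam i < 1).
Implicit Types (g : 'I_d -> @unit_cube R d -> R).

Definition approximant_map n g (x : E) : E := \row_i approximant n g i x.

Lemma is_smooth_approximant_map n g : is_smooth (approximant_map n g).
Proof.
move=> k; apply: polyfun_Ck => i; under eq_fun do rewrite mxE.
exact: polyfun_approximant.
Qed.

Lemma restrict_approximant_map n g i v :
  restrict_cube (approximant_map n g) i v = approximant n g i (val v).
Proof. by rewrite /restrict_cube mxE. Qed.

Local Notation K := (1 + 3 * d%:R : R).

(** Distances t up to the mesh s are handled by the gradient bound and t s^(gam - 1) <= t^gam,
    giving K d. Larger ones are compared through [g], where s^gam <= t^gam gives 2 K + 1. The
    constant is the sum of both cases. *)
Lemma approximant_lipschitz n g i (x y : @unit_cube R d) : holder_tuple gam g ->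
  `|approximant n g i (val x) - approximant n g i (val y)| <=
  (K * d%:R + (K + K + 1)) * Lips gam g i * enorm (val x - val y) `^ gam i.
Proof.
move=> hg; set t := enorm _; set L := Lips gam g i.
have L0 : 0 <= L by exact: Lips_ge0.
have K1 : 1 <= K := @K_ge1 R d.
have t0 : 0 <= t by exact: enorm_ge0.
have s0 := @mesh_gt0 R n; set s := mesh n in s0.
have xI := set_mem (valP x); have yI := set_mem (valP y).
have [g0 g1] := andP (gam01 i).
have Q (v : E) : unit_cube v -> enlarged_cube v.
  by move=> vI k; have := vI k; lra.
have [ts|st] := leP t s.
  have [/eqP t00|tn0] := boolP (t == 0).
    have /eqP -> : val x == val y by rewrite -subr_eq0 -enorm_eq0; apply/eqP.
    rewrite subrr normr0.
    by rewrite mulr_ge0 ?powR_ge0// mulr_ge0// addr_ge0 ?mulr_ge0 ?addr_ge0//; lra.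
  have tp : 0 < t by rewrite lt_neqAle eq_sym tn0.
  have H : `|approximant n g i (val x) - approximant n g i (val y)| <=
      K * L * (s `^ gam i / s) * d%:R * t.
    apply: (@segment_lipschitz R d (fun=> 0) (fun=> 1) (approximant n g i)) => // [z _|z j zI].
      exact: polyfun_differentiable (polyfun_approximant n g i).
    by apply: approximant_partial => //; exact: Q.
  apply: le_trans H _.
  have H : s `^ gam i / s * t <= t `^ gam i.
    have z1 : t / s <= 1 by rewrite ler_pdivrMr// mul1r.
    have z0 : 0 < t / s by exact: divr_gt0.
    rewrite -[in leRHS](divfK (lt0r_neq0 s0) t) powRM ?(ltW s0) ?(ltW z0)//.
    rewrite [leLHS](_ : _ = t / s * s `^ gam i); last by ring.
    apply: ler_wpM2r; first exact: powR_ge0.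
    by rewrite -[leLHS](powRr1 (ltW z0)) ger_powR ?z0 ?z1 ?(ltW g1).
  rewrite [leLHS](_ : _ = K * d%:R * L * (s `^ gam i / s * t)); last by ring.
  apply: (@le_trans _ _ (K * d%:R * L * t `^ gam i)).
    by rewrite ler_wpM2l// !mulr_ge0//; lra.
  by rewrite ler_wpM2r ?powR_ge0// ler_wpM2r// lerDl; lra.
have sg : s `^ gam i <= t `^ gam i.
  by apply: ge0_ler_powR; rewrite ?nnegrE ?(ltW s0)// ltW.
have H : `|g i x - g i y| <= L * t `^ gam i := holder_le x y g0 (hg i).
have Hx := approximant_close gam01 n (hg i) (Q _ xI).
have Hy := approximant_close gam01 n (hg i) (Q _ yI).
rewrite ext_val in Hx; rewrite ext_val in Hy.
set a := approximant n g i (val x) in Hx *; set b := approximant n g i (val y) in Hy *.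
rewrite (_ : a - b = (a - g i x) - (b - g i y) + (g i x - g i y)); last by ring.
apply: le_trans (ler_normD _ _) _; apply: le_trans (lerD (ler_normB _ _) (lexx _)) _.
apply: le_trans (lerD (lerD Hx Hy) H) _.
rewrite -/L -/s; apply: (@le_trans _ _ ((K + K + 1) * L * t `^ gam i)).
  rewrite [leRHS](_ : _ = K * L * t `^ gam i + K * L * t `^ gam i + L * t `^ gam i);
    last by ring.
  by rewrite lerD2r; apply: lerD; rewrite ler_wpM2l// mulr_ge0//; lra.
by rewrite ler_wpM2r ?powR_ge0// ler_wpM2r// lerDr mulr_ge0//; lra.
Qed.

Lemma approximant_uniform g i : holder_tuple gam g ->
  {uniform, (fun p => restrict_cube (approximant_map p g) i) @ \oo --> g i}.
Proof.
move=> hg; have [g0 g1] := andP (gam01 i).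
apply/cvg_uniformP => e e0; set L := Lips gam g i.
have : (fun n => K * L * (2^-1 `^ gam i) ^+ n) @ \oo --> K * L * 0.
  apply: cvgMl_tmp; apply: cvg_expr; rewrite ger0_norm ?powR_ge0//.
  apply: (@lt_le_trans _ _ (1 `^ gam i)); last by rewrite powR1.
  by apply: gt0_ltr_powR => //; rewrite ?nnegrE//; lra.
rewrite mulr0 => /cvgrPdist_lt/(_ _ e0); apply: filterS => n.
rewrite sub0r normrN => nn x; rewrite restrict_approximant_map distrC.
have xI := set_mem (valP x).
have xQ : enlarged_cube (val x) by move=> k; have := xI k; lra.
have := approximant_close gam01 n (hg i) xQ; rewrite ext_val => H.
apply: le_lt_trans H _; apply: le_lt_trans nn.
by rewrite /mesh powR_expr// ler_norm.
Qed.

(** The sequence on the left does not involve [D], so two operators with (A) and (B) share its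
    limit. *)
Lemma exterior_product_cvg D g (B : set E) : exterior_product gam D -> holder_tuple gam g ->
  bvset_cube B ->
  density_charge (fun x => \det ('J (approximant_map p g) x)) B @[p --> \oo] --> D g B.
Proof.
move=> [_ _ DJ Dw] hg bB.
have hol p i x y : `|restrict_cube (approximant_map p g) i x -
   restrict_cube (approximant_map p g) i y| <=
   (K * d%:R + (K + K + 1)) * Lips gam g i * enorm (val x - val y) `^ gam i.
  by rewrite !restrict_approximant_map; exact: approximant_lipschitz.
have : strong_norm (fun A => D g A - D (restrict_cube (approximant_map p g)) A)
    @[p --> \oo] --> 0%E.
  apply: Dw => // [p i|i|i].
  - exact: le_lt_trans (Lip_le (hol p i)) (ltry _).
  - exact: approximant_uniform.
  - apply: le_lt_trans (ltry ((K * d%:R + (K + K + 1)) * Lips gam g i)).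
    by apply: ge_ereal_sup => _ [p _ <-]; exact: Lip_le (hol p i).
move=> /(strong_norm_cvg0 bB) H.
have : D g B - (D g B - D (restrict_cube (approximant_map p g)) B) @[p --> \oo]
    --> D g B - 0 by apply: cvgB => //; exact: cvg_cst.
rewrite subr0; under eq_cvg do rewrite subKr.
by under eq_cvg do rewrite (DJ _ (is_smooth_approximant_map _ g) B bB).
Qed.

End uniqueness.

Theorem theorem9 (R : realType) (d : nat) (gam : 'I_d -> R) :
  (1 <= d)%N ->
  (forall i, 0 < gam i < 1) ->
  (d%:R - 1) / d%:R < (\sum_i gam i) / d%:R ->
  exists D : ('I_d -> @unit_cube R d -> R) -> set 'rV[R]_d -> R,
    [/\ exterior_product gam D,
        forall D' : ('I_d -> @unit_cube R d -> R) -> set 'rV[R]_d -> R,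
          exterior_product gam D' ->
          forall g, holder_tuple gam g -> eq_charge (D' g) (D g) &
        exists C : R, forall g, holder_tuple gam g ->
          (charge_holder_norm ((\sum_i gam i) / d%:R) (D g)
             <= (C * \prod_i fine (Lip (gam i) (g i)))%:E)%E].
Proof.
move=> d0 gam01 gamd.
have ext_wedge : exterior_product gam (@wedge R d).
  split; [exact: sch_wedge|exact: multilinear_wedge|exact: extends_jacobian_wedge
         |exact: weakly_continuous_wedge].
exists (@wedge R d); split => //.
  move=> D' extD' g hg B bB.
  apply: (cvg_unique (@Rhausdorff R) (exterior_product_cvg gam01 extD' hg bB)
    (exterior_product_cvg gam01 ext_wedge hg bB)).
by exists (@holder_const R d gam) => g hg; exact: wedge_holder_norm.
Qed.
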